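(* (i) Every hypercomplex $8$-dimensional nilpotent Lie group admits a minimal compatible metric. (ii) Two hypercomplex $8$-dimensional nilpotent Lie groups $(N_\mu,\{J_1,J_2,J_3\})$ and $(N_\lambda,\{J_1,J_2,J_3\})$ (with $\mu,\lambda\in W_h$) are isomorphic if and only if $\mu$ and $c\lambda$ lie in the same $\mathrm{Sp}(1)\times\mathrm{Sp}(1)$-orbit for some non-zero $c\in\mathbb{R}$. (iii) The moduli space of all $8$-dimensional hypercomplex nilpotent Lie groups up to isomorphism is parameterized by $\mathbb{P}W_h/\mathrm{Sp}(1)\times\mathrm{Sp}(1)$. The representation $W_h$ is equivalent to $(\mathfrak{su}(2)\otimes\mathbb{R}^4)\oplus\mathbb{R}^4$, where $\mathfrak{su}(2)$ is the adjoint representation and $\mathbb{R}^4$ is the standard representation of $\mathrm{SU}(2)=\mathrm{Sp}(1)$ viewed as real. Since the isotropy of an element in general position is finite, the dimension of this quotient is $15-6=9$. (iv) The moduli space of all $8$-dimensional abelian hypercomplex nilpotent Lie groups up to isomorphism is parameterized by $\mathbb{P}W_{ah}/\mathrm{Sp}(1)\times\mathrm{Sp}(1)$. The representation $W_{ah}$ is equivalent to $\mathfrak{su}(2)\otimes\mathbb{R}^4$, and since the isotropy of an element in general position is again finite, the dimension of this quotient is $11-6=5$.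
   Context: A hypercomplex nilpotent Lie group $(N,\{J_1,J_2,J_3\})$ is a simply connected nilpotent Lie group $N$ with Lie algebra $(\mathfrak{n},\mu)$ and endomorphisms $J_i$ of $\mathfrak{n}$ with $J_i^2=-I$, $J_1J_2=J_3=-J_2J_1$, each integrable: $\mu(J_iX,J_iY)=\mu(X,Y)+J_i\mu(J_iX,Y)+J_i\mu(X,J_iY)$ for all $X,Y\in\mathfrak{n}$. It is called abelian hypercomplex if the hypercomplex structure is abelian, that is, $\mu(J_iX,J_iY)=\mu(X,Y)$ for all $X,Y$ and $i=1,2,3$. Two hypercomplex nilpotent Lie groups $(N,\{J_i\})$ and $(N',\{J_i'\})$ are isomorphic if there is a Lie algebra isomorphism $\varphi:\mathfrak{n}'\to\mathfrak{n}$ with $\varphi J_i'\varphi^{-1}=J_i$, $i=1,2,3$. A compatible (hyper-hermitian) metric is a left invariant metric given by an inner product on $\mathfrak{n}$ with $\langle J_iX,J_iY\rangle=\langle X,Y\rangle$ for all $X,Y$ and $i$. Invariant Ricci operator: for a compatible metric, $\mathrm{Ric}^\gamma_{\langle\cdot,\cdot\rangle}=\frac14(\mathrm{Ric}-J_1\mathrm{Ric}J_1-J_2\mathrm{Ric}J_2-J_3\mathrm{Ric}J_3)$, where $\mathrm{Ric}$ is the Ricci operator. A compatible metric is minimal if it attains the minimum of $\mathrm{tr}(\mathrm{Ric}^\gamma)^2$ among all compatible left invariant metrics on $(N,\{J_1,J_2,J_3\})$ with the same scalar curvature. Fixed data: $\mathfrak{n}=\mathfrak{n}_1\oplus\mathfrak{n}_2$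 with bases $\{X_1,\dots,X_4\}$ of $\mathfrak{n}_1$ and $\{Z_1,\dots,Z_4\}$ of $\mathfrak{n}_2$, and inner product making $\{X_i,Z_j\}$ orthonormal. On each $\mathfrak{n}_i$ (with ordered basis denoted $e_1,\dots,e_4$) the $J$'s act by $J_1e_1=e_2,\ J_1e_2=-e_1,\ J_1e_3=e_4,\ J_1e_4=-e_3$; $J_2e_1=e_3,\ J_2e_2=-e_4,\ J_2e_3=-e_1,\ J_2e_4=e_2$; $J_3=J_1J_2$. $W=\Lambda^2\mathfrak{n}_1^*\otimes\mathfrak{n}_2$ is the $24$-dimensional space of skew-symmetric bilinear maps $\mu:\mathfrak{n}_1\times\mathfrak{n}_1\to\mathfrak{n}_2$, each extended by zero to a (at most 2-step nilpotent) Lie bracket on $\mathfrak{n}$ with $\mathfrak{n}_2$ central; $N_\mu$ is the corresponding simply connected Lie group. $W_h\subset W$ is the ($16$-dimensional) subspace of those $\mu$ for which $J_1,J_2,J_3$ are all integrable, and $W_{ah}\subset W_h$ the ($12$-dimensional) subspace of those with $\mu=\mu(J_i\cdot,J_i\cdot)$ for $i=1,2,3$. By results of Dotti and Fino, the Lie bracket of an $8$-dimensional nilpotent Lie algebra with a hypercomplex structure is always given by such a $\mu$. $\mathrm{Sp}(1)\times\mathrm{Sp}(1)$ is the group of $(\varphi_1,\varphi_2)\in\mathrm{O}(\mathfrak{n}_1)\times\mathrm{O}(\mathfrak{n}_2)$ commuting with $J_1,J_2,J_3$, acting on $W$ by $((\varphi_1,\varphi_2).\mu)(X,Y)=\varphi_2\mu(\varphi_1^{-1}X,\varphi_1^{-1}Y)$.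 $\mathbb{P}W_h,\mathbb{P}W_{ah}$ are the projective spaces of lines.
   Formalization: In (iii) and (iv) the moduli space is parameterized after removing the single isomorphism class of the abelian group R^8 (μ = 0), which corresponds to no line in PW_h or PW_ah. *)

(* Defs.v *)
From HB Require Import structures.
From mathcomp Require Import all_boot all_order all_algebra.
From mathcomp Require Import complex.
From mathcomp Require Import all_classical all_reals all_analysis.

Set Implicit Arguments.
Unset Strict Implicit.
Unset Printing Implicit Defensive.

Import Order.TTheory GRing.Theory Num.Theory.
Import numFieldNormedType.Exports.

Local Open Scope classical_set_scope.
Local Open Scope ring_scope.

Section HypercomplexLieAlgebras.
Variable R : realType.

(* A simply connected Lie group is encoded by its Lie algebra.  [lieJ i] for
   i = 0, 1, 2 is the endomorphism J_(i+1).  The axioms are in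
   [hypercomplex_nilpotent]. *)
Record lie_data := LieData {
  lie_space :> vectType R;
  lie_br : lie_space -> lie_space -> lie_space;
  lieJ : 'I_3 -> lie_space -> lie_space }.

Definition lie_algebra (n : lie_data) : Prop :=
  [/\ forall x : n, linear (lie_br x),
      forall y : n, linear (fun x : n => lie_br x y),
      forall x : n, lie_br x x = 0
    & forall x y z : n, lie_br x (lie_br y z) + lie_br y (lie_br z x)
                        + lie_br z (lie_br x y) = 0].

Definition nilpotent_lie (n : lie_data) : Prop :=
  exists k : nat, forall (s : seq n) (z : n),
    size s = k -> foldr (@lie_br n) z s = 0.

Definition quaternionic (n : lie_data) : Prop :=
  [/\ forall i, linear (@lieJ n i),
      forall i (x : n), lieJ i (lieJ i x) = - x,
      forall x : n, lieJ 0 (lieJ 1 x) = lieJ 2 x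
    & forall x : n, lieJ 1 (lieJ 0 x) = - lieJ 2 x].

Definition J_integrable (n : lie_data) : Prop :=
  forall i (x y : n), lie_br (lieJ i x) (lieJ i y) =
    lie_br x y + lieJ i (lie_br (lieJ i x) y) + lieJ i (lie_br x (lieJ i y)).

Definition abelian_hypercomplex (n : lie_data) : Prop :=
  forall i (x y : n), lie_br (lieJ i x) (lieJ i y) = lie_br x y.

Definition hypercomplex_nilpotent (n : lie_data) : Prop :=
  [/\ lie_algebra n, nilpotent_lie n, quaternionic n & J_integrable n].

Definition hypercomplex8 (n : lie_data) : Prop :=
  hypercomplex_nilpotent n /\ \dim {:n} = 8%N.

Definition isomorphic (n n' : lie_data) : Prop :=
  exists f : n' -> n,
    [/\ linear f, bijective f,
        forall x y, f (lie_br x y) = lie_br (f x) (f y)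
      & forall i x, f (lieJ i x) = lieJ i (f x)].

(* [lie_data R] is too large for [set]: collections of Lie algebras and of
   isomorphism classes are plain predicates. *)
Definition isoclass (n : lie_data) : lie_data -> Prop :=
  fun n' => hypercomplex8 n' /\ isomorphic n n'.

Definition moduli : (lie_data -> Prop) -> Prop :=
  fun C => exists2 n, hypercomplex8 n & C = isoclass n.

Definition moduli_abelian : (lie_data -> Prop) -> Prop :=
  fun C => exists2 n, hypercomplex8 n /\ abelian_hypercomplex n
                      & C = isoclass n.

Section Metrics.
Variable n : lie_data.
Implicit Types (g : n -> n -> R) (x y z : n).

Definition inner_product g : Prop :=
  [/\ forall a x y z, g (a *: x + y) z = a * g x z + g y z,
      forall x y, g x y = g y x
    & forall x, x != 0 -> 0 < g x x].

Definition compatible g : Prop :=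
  inner_product g /\ forall i x y, g (lieJ i x) (lieJ i y) = g x y.

Let d := \dim {:n}.
Let b := vbasis {:n}.

(* The vector v with g v z = f z for all z, for f a linear form. *)
Definition riesz g (f : n -> R) : n :=
  let gram := \matrix_(i < d, j < d) g b`_i b`_j in
  \sum_(i < d) (\sum_(j < d) f b`_j * invmx gram j i) *: b`_i.

Definition trace (f : n -> n) : R := \sum_(i < d) coord b i (f b`_i).

(* Koszul formula on left invariant vector fields. *)
Definition levi_civita g x y : n :=
  riesz g (fun z =>
    (g (lie_br x y) z - g (lie_br y z) x + g (lie_br z x) y) / 2%:R).

Definition curvature g x y z : n :=
  levi_civita g x (levi_civita g y z) - levi_civita g y (levi_civita g x z)
  - levi_civita g (lie_br x y) z.

Definition ricci_form g x y : R := trace (fun z => curvature g z x y).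

Definition Ric g x : n := riesz g (ricci_form g x).

Definition scal g : R := trace (Ric g).

Definition Ric_inv g x : n :=
  4%:R^-1 *: (Ric g x - \sum_(i < 3) lieJ i (Ric g (lieJ i x))).

Definition minimal g : Prop :=
  compatible g /\
  forall g', compatible g' -> scal g' = scal g ->
    trace (Ric_inv g \o Ric_inv g) <= trace (Ric_inv g' \o Ric_inv g').

End Metrics.
End HypercomplexLieAlgebras.

Section FixedData.
Variable R : realType.

(* Coordinates on n_1 and on n_2; [e i] is X_(i+1), resp. Z_(i+1). *)
Notation H := 'rV[R]_4.
Notation bracket := 'Hom(H, 'Hom(H, H)).

Definition dot (x y : H) : R := \sum_i x 0 i * y 0 i.

(* [x *m delta_mx i j] sends e_i to e_j and kills the other e_k. *)
Definition J1 (x : H) : H :=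
  x *m (delta_mx 0 1 - delta_mx 1 0 + delta_mx 2 3 - delta_mx 3 2).
Definition J2 (x : H) : H :=
  x *m (delta_mx 0 2 - delta_mx 1 3 - delta_mx 2 0 + delta_mx 3 1).
Definition J (i : 'I_3) : H -> H :=
  if i == 0 then J1 else if i == 1 then J2 else J1 \o J2.

Definition N_ (mu : bracket) : lie_data R :=
  @LieData R (H * H)%type
    (fun p q => (0, mu p.1 q.1)) (fun i p => (J i p.1, J i p.2)).

Definition W : set bracket := [set mu : bracket | forall x, mu x x = 0].
Definition Wh : set bracket := [set mu | W mu /\ J_integrable (N_ mu)].
Definition Wah : set bracket :=
  [set mu : bracket | Wh mu /\ forall i x y, mu (J i x) (J i y) = mu x y].

Definition Sp1 : set 'End(H) :=
  [set f : 'End(H) | (forall x y, dot (f x) (f y) = dot x y) /\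
           forall i x, f (J i x) = J i (f x)].

Definition Sp1Sp1 : set ('End(H) * 'End(H)) := Sp1 `*` Sp1.

(* The Lie algebra of Sp1. *)
Definition sp1 : set 'End(H) :=
  [set a : 'End(H) | (forall x y, dot (a x) y + dot x (a y) = 0) /\
           forall i x, a (J i x) = J i (a x)].

Definition act_fun (phi : 'End(H) * 'End(H)) (mu : bracket) (x : H) :
    'Hom(H, H) := (phi.2 \o mu (phi.1^-1 x) \o phi.1^-1)%VF.

Fact act_fun_linear phi mu : linear (act_fun phi mu).
Proof.
move=> a x y; apply/lfunP => z.
by rewrite /act_fun !(add_lfunE, scale_lfunE, comp_lfunE, linearP).
Qed.

HB.instance Definition _ phi mu :=
  GRing.isLinear.Build R H 'Hom(H, H) _ (act_fun phi mu)
    (act_fun_linear phi mu).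

Definition act (phi : 'End(H) * 'End(H)) (mu : bracket) : bracket :=
  linfun (act_fun phi mu).

Lemma actE phi mu x y :
  act phi mu x y = phi.2 (mu (phi.1^-1%VF x) (phi.1^-1%VF y)).
Proof. by rewrite /act lfunE /= /act_fun !comp_lfunE. Qed.

End FixedData.

Section Topology.
Variables (R : realType) (V : vectType R).

Definition has_dimv (S : set V) (d : nat) : Prop :=
  exists2 U : {vspace V}, S = [set` U] & \dim U = d.

(* The points of the projective space of S. *)
Definition lines (S : set V) : set {vspace V} :=
  [set L | \dim L = 1%N /\ [set` L] `<=` S].

Definition has_proj_dim (S : set V) (d : nat) : Prop := has_dimv S d.+1.

(* The standard topology of a finite-dimensional real vector space. *)
Definition vopen (A : set V) : Prop :=
  open [set u : 'rV[R]_(\dim {:V}) |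
          A (\sum_(i < \dim {:V}) u 0 i *: (vbasis {:V})`_i)].

Definition relopen (S A : set V) : Prop :=
  exists2 O : set V, vopen O & A = S `&` O.

Definition in_general_position (S P : set V) : Prop :=
  exists U : set V,
    [/\ relopen S U, U `<=` P
      & forall A, relopen S A -> A !=set0 -> (U `&` A) !=set0].

(* The quotient topology of the projective space of S. *)
Definition popen (S : set V) (A : set {vspace V}) : Prop :=
  A `<=` lines S /\ relopen S [set v | v != 0 /\ A <[v]>%VS].

End Topology.

(* Dimension of a space with a dense set of manifold points, the topology being
   given by its open sets.  The orbit space of a compact group action is not a
   manifold in general, so only the points of a dense subset are required to
   have a neighbourhood O homeomorphic to an open subset of R^d. *)
Definition locally_euclidean_at (R : realType) (T : Type)
    (opn : set (set T)) (d : nat) (x : T) : Prop :=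
  exists (O : set T) (f : T -> 'rV[R]_d),
    [/\ opn O, O x, set_inj O f
      & forall A, A `<=` O -> (opn A <-> open (f @` A))].

Definition top_dim (R : realType) (T : Type)
    (opn : set (set T)) (d : nat) : Prop :=
  forall A, opn A -> A !=set0 ->
    exists2 x, A x & locally_euclidean_at R opn d x.

Section Quotient.
Variable R : realType.
Notation H := 'rV[R]_4.
Notation bracket := 'Hom(H, 'Hom(H, H)).

Definition maps_line (phi : 'End(H) * 'End(H)) (L L' : {vspace bracket}) :=
  act phi @` [set` L] = [set` L'].

Definition line_orbit (L : {vspace bracket}) : set {vspace bracket} :=
  [set L' | exists2 phi, Sp1Sp1 phi & maps_line phi L L'].

Definition isotropy (L : {vspace bracket}) : set ('End(H) * 'End(H)) :=
  [set phi | Sp1Sp1 phi /\ maps_line phi L L].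

(* The quotient of the projective space of S by Sp(1) x Sp(1), and its quotient
   topology. *)
Definition quotient (S : set bracket) : set (set {vspace bracket}) :=
  [set line_orbit L | L in lines S].

Definition qopen (S : set bracket) (Q : set (set {vspace bracket})) : Prop :=
  Q `<=` quotient S /\ popen S [set L | lines S L /\ Q (line_orbit L)].

(* F is a bijection onto the classes in M other than that of mu = 0: the
   projective space omits mu = 0, i.e. the group R^8, which is a single
   isomorphism class. *)
Definition parameterized_by (M : (lie_data R -> Prop) -> Prop)
    (S : set bracket) : Prop :=
  exists F : set {vspace bracket} -> (lie_data R -> Prop),
    [/\ forall q, quotient S q -> M (F q) /\ F q <> isoclass (N_ 0),
        forall q q', quotient S q -> quotient S q' -> F q = F q' -> q = q',
        forall C, M C -> C <> isoclass (N_ 0) ->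
          exists2 q, quotient S q & F q = C
      & forall L mu, lines S L -> mu \in L -> mu != 0 ->
          F (line_orbit L) = isoclass (N_ mu)].

Definition generic_isotropy_finite (S : set bracket) : Prop :=
  in_general_position S
    [set mu | mu != 0 /\ finite_set (isotropy <[mu]>%VS)].

End Quotient.

Section Realify.
Variable R : realType.

(* Restriction of scalars from C to R. *)
Definition realify (V : lmodType R[i]) : Type := V.

Variable V : lmodType R[i].

HB.instance Definition _ := GRing.Zmodule.copy (realify V) V.

Definition realify_scale (a : R) (v : realify V) : realify V :=
  (a%:C)%C *: (v : V).

Fact realify_scaleA a b v :
  realify_scale a (realify_scale b v) = realify_scale (a * b) v.
Proof. by rewrite /realify_scale scalerA -rmorphM. Qed.
Fact realify_scale1 : left_id 1 realify_scale.
Proof. by move=> v; rewrite /realify_scale rmorph1 scale1r. Qed.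
Fact realify_scaleDr : right_distributive realify_scale +%R.
Proof. by move=> a u v; rewrite /realify_scale scalerDr. Qed.
Fact realify_scaleDl v : {morph realify_scale^~ v : a b / a + b}.
Proof. by move=> a b; rewrite /realify_scale rmorphD scalerDl. Qed.

HB.instance Definition _ := GRing.Zmodule_isLmodule.Build R (realify V)
  realify_scaleA realify_scale1 realify_scaleDr realify_scaleDl.

End Realify.

Section TensorProduct.
Variables (R : realType) (U V T : lmodType R).

Definition linear_on (A B : lmodType R) (S : set A) (f : A -> B) : Prop :=
  forall a x y, S x -> S y -> f (a *: x + y) = a *: f x + f y.

Definition bilinear_on (X : lmodType R) (SU : set U) (SV : set V)
    (t : U -> V -> X) : Prop :=
  (forall v, SV v -> linear_on SU (fun u => t u v)) /\
  (forall u, SU u -> linear_on SV (t u)).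

(* The subspace ST of T, with t, is a tensor product of the subspaces SU of U
   and SV of V. *)
Definition is_tensor_product (SU : set U) (SV : set V) (ST : set T)
    (t : U -> V -> T) : Prop :=
  [/\ forall u v, SU u -> SV v -> ST (t u v),
      bilinear_on SU SV t,
      forall (X : lmodType R) (b : U -> V -> X), bilinear_on SU SV b ->
        exists2 f : T -> X, linear_on ST f
          & forall u v, SU u -> SV v -> f (t u v) = b u v
    & forall (X : lmodType R) (f f' : T -> X),
        linear_on ST f -> linear_on ST f' ->
        (forall u v, SU u -> SV v -> f (t u v) = f' (t u v)) ->
        forall x, ST x -> f x = f' x].

End TensorProduct.

Section Representations.
Variable R : realType.
Notation H := 'rV[R]_4.
Notation bracket := 'Hom(H, 'Hom(H, H)).
Notation M2C := (realify 'M[R[i]]_2).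
Notation C2 := (realify 'cV[R[i]]_2).

Definition SU2 : set 'M[R[i]]_2 :=
  [set u | u *m (map_mx conjc u)^T = 1%:M /\ \det u = 1].

Definition su2 : set M2C :=
  [set a : 'M[R[i]]_2 | (map_mx conjc a)^T = - a /\ \tr a = 0].

Definition Ad (u : 'M[R[i]]_2) (a : M2C) : M2C :=
  u *m (a : 'M[R[i]]_2) *m invmx u.

Definition std (u : 'M[R[i]]_2) (v : C2) : C2 := u *m (v : 'cV[R[i]]_2).

(* (H, J1) as C^2, with complex basis e_0, e_2. *)
Definition toC2 (x : H) : 'cV[R[i]]_2 :=
  \col_k (if k == 0 then (x 0 0 +i* x 0 1)%C else (x 0 2 +i* x 0 3)%C).

(* The matrix in that basis; an element of Sp1 commutes with J1. *)
Definition toSU2 (f : 'End(H)) : 'M[R[i]]_2 :=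
  \matrix_(k, l) toC2 (f (delta_mx 0 (if l == 0 then 0 else 2))) k 0.

Definition Sp1_iso_SU2 : Prop :=
  set_bij (@Sp1 R) SU2 toSU2 /\
  forall f g, Sp1 f -> Sp1 g -> toSU2 (f \o g)%VF = toSU2 f *m toSU2 g.

(* t exhibits ST as su(2) (x) R^4 as representations of Sp(1) x Sp(1), the first
   factor acting on su(2) and the second one on R^4. *)
Definition is_su2_tensor_R4 (ST : set bracket) (t : M2C -> C2 -> bracket) :=
  is_tensor_product su2 setT ST t /\
  forall phi a v, Sp1Sp1 phi -> su2 a ->
    t (Ad (toSU2 phi.1) a) (std (toSU2 phi.2) v) = act phi (t a v).

Definition equiv_su2_tensor_R4 (S : set bracket) : Prop :=
  exists t : M2C -> C2 -> bracket, is_su2_tensor_R4 S t.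

(* In the second summand only the second factor of Sp(1) x Sp(1) acts. *)
Definition equiv_su2_tensor_R4_plus_R4 (S : set bracket) : Prop :=
  exists (T : {vspace bracket}) (t : M2C -> C2 -> bracket) (s : C2 -> bracket),
    [/\ is_su2_tensor_R4 [set` T] t,
        linear s,
        forall phi v, Sp1Sp1 phi -> s (std (toSU2 phi.2) v) = act phi (s v),
        forall v, s v \in T -> v = 0
      & S = [set x + s v | x in [set` T] & v in setT]].

End Representations.

(* Main.v *)
(** Identify [n_1] and [n_2] with the quaternions: the [J_i] become left
    multiplications and Sp(1) consists of the right multiplications by unit
    quaternions.  Solving the integrability equations, the elements of W_h are
      mu(x, y) = sum_k <x e_k, y> z_k + sum_l <e_l x, y> e_l v
    with z_1, z_2, z_3, v arbitrary quaternions, and W_ah is given by v = 0;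
    (p, r) in Sp(1) x Sp(1) rotates the index k by the image of p in SO(3) and
    multiplies z_k and v by r on the right.  This yields the two representations.

    (i) Completing the square, every compatible metric on N_mu is a multiple of
    the pullback of the standard one by an automorphism.  As the scalar curvature
    is -|mu|^2/4 in the standard metric, for mu <> 0 it determines the multiple,
    so that all compatible metrics of a given scalar curvature have the same
    tr (Ric^gamma)^2.  That each hypercomplex nilpotent n is some N_mu (Dotti and
    Fino) follows from the Obata connection L: there is a central z with
    L_z z = 0, and the quaternionic line Hz of such a z is central and
    contains [n, n].

    (ii) An isomorphism preserves the quaternionic line n_2 spanned by the image
    of mu, and hence acts on n_1 and n_2 by nonzero quaternions on the right;
    their norms only rescale mu.

    (iii), (iv) From z one builds covariants that are imaginary quaternions rotated
    by p.  Where two of them are independent, the frame that they define fixes p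
    up to sign, and then z_1 = 1 fixes r and the scale: the normal forms make up
    an open subset of R^9, resp. R^5. *)

(* The delicate point is that [n, n] lies in a central quaternionic line. L is H-linear in its
   second argument and L_X z = L_z X for central z, so that [p z, q z] = (q p - p q) L_z z.
   Obstructions are removed by one device: were a certain quaternionic coefficient nonzero, some ad
   x would preserve a nonempty set of nonzero vectors, against nilpotency. The operator is most
   often p -> (p r - r p) u on H, and for each u <> 0 some r makes it non-nilpotent.

   The covariants exist because right multiplication by r preserves the skew forms <c x, y>, c = i,
   j, k; the values of one such form on the pairs from (z_1, z_2, z_3) make up an element of
   Lambda^2 R^3 = R^3, on which only p acts. They are quadratic in mu, so the factor c of a
   projective change enters as c^2 > 0, and the signs that define the chamber survive it. Nine
   parameters are left: 16 less three for p, three for r and one for the scale. *)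
From HB Require Import structures.
Require Import Defs.
From mathcomp Require Import all_boot all_order all_algebra.
From mathcomp Require Import complex.
From mathcomp Require Import all_classical all_reals all_analysis.
From mathcomp Require Import ring lra.

Set Implicit Arguments.
Unset Strict Implicit.
Unset Printing Implicit Defensive.

Import Order.TTheory GRing.Theory Num.Theory.
Import numFieldNormedType.Exports.

Local Open Scope classical_set_scope.
Local Open Scope ring_scope.

(** * Quaternions *)

Section Quaternions.
Variable R : realType.
Notation H := 'rV[R]_4.
Implicit Types (x y p q : H) (a b : R).

(* Locked: rewriting with [mxE] must not expand products of quaternions. *)
Fact quat_key : unit. Proof. exact: tt. Qed.
Definition quat a b c d : H :=
  locked_with quat_key (\row_(i < 4) nth 0 [:: a; b; c; d] i).

Lemma quat0 a b c d : quat a b c d 0 0 = a. Proof. by rewrite /quat unlock mxE. Qed.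
Lemma quat1 a b c d : quat a b c d 0 1 = b. Proof. by rewrite /quat unlock mxE. Qed.
Lemma quat2 a b c d : quat a b c d 0 2 = c. Proof. by rewrite /quat unlock mxE. Qed.
Lemma quat3 a b c d : quat a b c d 0 3 = d. Proof. by rewrite /quat unlock mxE. Qed.
Definition quatE := (quat0, quat1, quat2, quat3).

Lemma ord4P (P : 'I_4 -> Prop) : P 0 -> P 1 -> P 2 -> P 3 -> forall i, P i.
Proof.
move=> P0 P1 P2 P3 [[|[|[|[|i]]]] Hi] //.
- by rewrite (_ : Ordinal Hi = 0) //; apply: val_inj.
- by rewrite (_ : Ordinal Hi = 1) //; apply: val_inj.
- by rewrite (_ : Ordinal Hi = 2) //; apply: val_inj.
- by rewrite (_ : Ordinal Hi = 3) //; apply: val_inj.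
Qed.

Lemma ord3P (P : 'I_3 -> Prop) : P 0 -> P 1 -> P 2 -> forall i, P i.
Proof.
move=> P0 P1 P2 [[|[|[|i]]] Hi] //.
- by rewrite (_ : Ordinal Hi = 0) //; apply: val_inj.
- by rewrite (_ : Ordinal Hi = 1) //; apply: val_inj.
- by rewrite (_ : Ordinal Hi = 2) //; apply: val_inj.
Qed.

Lemma sum4 (V : nmodType) (F : 'I_4 -> V) :
  \sum_i F i = F 0 + F 1 + F 2 + F 3.
Proof.
rewrite !big_ord_recr big_ord0 /= add0r.
by congr (F _ + F _ + F _ + F _); apply: val_inj.
Qed.

Lemma sum3 (V : nmodType) (F : 'I_3 -> V) : \sum_i F i = F 0 + F 1 + F 2.
Proof.
rewrite !big_ord_recr big_ord0 /= add0r.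
by congr (F _ + F _ + F _); apply: val_inj.
Qed.

Lemma quat_ext x y : x 0 0 = y 0 0 -> x 0 1 = y 0 1 -> x 0 2 = y 0 2 ->
  x 0 3 = y 0 3 -> x = y.
Proof. by move=> *; apply/rowP; elim/ord4P. Qed.

Lemma quat_eta x : x = quat (x 0 0) (x 0 1) (x 0 2) (x 0 3).
Proof. by apply: quat_ext; rewrite quatE. Qed.

Lemma dotE x y :
  dot x y = x 0 0 * y 0 0 + x 0 1 * y 0 1 + x 0 2 * y 0 2 + x 0 3 * y 0 3.
Proof. by rewrite /dot sum4. Qed.

Lemma J1E x : J1 x = quat (- x 0 1) (x 0 0) (- x 0 3) (x 0 2).
Proof.
by apply: quat_ext; rewrite quatE /J1 !mxE sum4 !mxE /=; ring.
Qed.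

Lemma J2E x : J2 x = quat (- x 0 2) (x 0 3) (x 0 0) (- x 0 1).
Proof.
by apply: quat_ext; rewrite quatE /J2 !mxE sum4 !mxE /=; ring.
Qed.

Definition qmul x y : H := quat
  (x 0 0 * y 0 0 - x 0 1 * y 0 1 - x 0 2 * y 0 2 - x 0 3 * y 0 3)
  (x 0 0 * y 0 1 + x 0 1 * y 0 0 + x 0 2 * y 0 3 - x 0 3 * y 0 2)
  (x 0 0 * y 0 2 - x 0 1 * y 0 3 + x 0 2 * y 0 0 + x 0 3 * y 0 1)
  (x 0 0 * y 0 3 + x 0 1 * y 0 2 - x 0 2 * y 0 1 + x 0 3 * y 0 0).
Definition qconj x : H := quat (x 0 0) (- x 0 1) (- x 0 2) (- x 0 3).
Definition qr a : H := quat a 0 0 0.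
Definition qi : H := quat 0 1 0 0.
Definition qj : H := quat 0 0 1 0.
Definition qk : H := quat 0 0 0 1.
Definition qu (i : 'I_3) : H := nth 0 [:: qi; qj; qk] i.
Definition qinv x : H := (dot x x)^-1 *: qconj x.

End Quaternions.

Arguments qr {R}. Arguments qi {R}. Arguments qj {R}. Arguments qk {R}.
Arguments qu {R}.

Section Coordinates.
Variable R : realType.
Implicit Types (x y : 'rV[R]_4) (a : R).

Lemma qmulE0 x y : qmul x y 0 0 =
  x 0 0 * y 0 0 - x 0 1 * y 0 1 - x 0 2 * y 0 2 - x 0 3 * y 0 3.
Proof. exact: quat0. Qed.
Lemma qmulE1 x y : qmul x y 0 1 =
  x 0 0 * y 0 1 + x 0 1 * y 0 0 + x 0 2 * y 0 3 - x 0 3 * y 0 2.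
Proof. exact: quat1. Qed.
Lemma qmulE2 x y : qmul x y 0 2 =
  x 0 0 * y 0 2 - x 0 1 * y 0 3 + x 0 2 * y 0 0 + x 0 3 * y 0 1.
Proof. exact: quat2. Qed.
Lemma qmulE3 x y : qmul x y 0 3 =
  x 0 0 * y 0 3 + x 0 1 * y 0 2 - x 0 2 * y 0 1 + x 0 3 * y 0 0.
Proof. exact: quat3. Qed.

Lemma qiE : (((qi : 'rV[R]_4) 0 0 = 0) * ((qi : 'rV[R]_4) 0 1 = 1) *
  ((qi : 'rV[R]_4) 0 2 = 0) * ((qi : 'rV[R]_4) 0 3 = 0))%type.
Proof. by rewrite !quatE. Qed.
Lemma qjE : (((qj : 'rV[R]_4) 0 0 = 0) * ((qj : 'rV[R]_4) 0 1 = 0) *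
  ((qj : 'rV[R]_4) 0 2 = 1) * ((qj : 'rV[R]_4) 0 3 = 0))%type.
Proof. by rewrite !quatE. Qed.
Lemma qkE : (((qk : 'rV[R]_4) 0 0 = 0) * ((qk : 'rV[R]_4) 0 1 = 0) *
  ((qk : 'rV[R]_4) 0 2 = 0) * ((qk : 'rV[R]_4) 0 3 = 1))%type.
Proof. by rewrite !quatE. Qed.
Lemma qrE a : ((qr a 0 0 = a) * (qr a 0 1 = 0) * (qr a 0 2 = 0) * (qr a 0 3 = 0))%type.
Proof. by rewrite !quatE. Qed.
Lemma qconjE x : ((qconj x 0 0 = x 0 0) * (qconj x 0 1 = - x 0 1) *
  (qconj x 0 2 = - x 0 2) * (qconj x 0 3 = - x 0 3))%type.
Proof. by rewrite !quatE. Qed.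
End Coordinates.

Definition qcoordE := (qmulE0, qmulE1, qmulE2, qmulE3, qconjE, qiE, qjE, qkE, qrE).

Ltac qring := apply: quat_ext;
  rewrite ?dotE ?J1E ?J2E ?(qcoordE, quatE, mxE); ring.

Section QuatTheory.
Variable R : realType.
Notation H := 'rV[R]_4.
Implicit Types (x y p q : H) (a b : R).

Lemma qmulA x y p : qmul x (qmul y p) = qmul (qmul x y) p.
Proof. qring. Qed.
Lemma qmulDl x y p : qmul (x + y) p = qmul x p + qmul y p.
Proof. qring. Qed.
Lemma qmulDr p x y : qmul p (x + y) = qmul p x + qmul p y.
Proof. qring. Qed.
Lemma qmulZl a x y : qmul (a *: x) y = a *: qmul x y.
Proof. qring. Qed.
Lemma qmulZr a x y : qmul x (a *: y) = a *: qmul x y.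
Proof. qring. Qed.
Lemma qmulNl x y : qmul (- x) y = - qmul x y.
Proof. qring. Qed.
Lemma qmulNr x y : qmul x (- y) = - qmul x y.
Proof. qring. Qed.
Lemma qmul0l x : qmul 0 x = 0. Proof. qring. Qed.
Lemma qmul0r x : qmul x 0 = 0. Proof. qring. Qed.
Lemma qrmul a x : qmul (qr a) x = a *: x. Proof. qring. Qed.
Lemma qmulr a x : qmul x (qr a) = a *: x. Proof. qring. Qed.
Lemma qmul1l x : qmul (qr 1) x = x. Proof. qring. Qed.
Lemma qmul1r x : qmul x (qr 1) = x. Proof. qring. Qed.
Lemma qconjK x : qconj (qconj x) = x. Proof. qring. Qed.
Lemma qconjM x y : qconj (qmul x y) = qmul (qconj y) (qconj x). Proof. qring. Qed.
Lemma qmulCr x : qmul x (qconj x) = qr (dot x x). Proof. qring. Qed.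
Lemma qmulCl x : qmul (qconj x) x = qr (dot x x). Proof. qring. Qed.
Lemma qii x : qmul qi (qmul qi x) = - x. Proof. qring. Qed.
Lemma qjj x : qmul qj (qmul qj x) = - x. Proof. qring. Qed.
Lemma qkk x : qmul qk (qmul qk x) = - x. Proof. qring. Qed.
Lemma qij x : qmul qi (qmul qj x) = qmul qk x. Proof. qring. Qed.
Lemma qji x : qmul qj (qmul qi x) = - qmul qk x. Proof. qring. Qed.
Lemma qjk x : qmul qj (qmul qk x) = qmul qi x. Proof. qring. Qed.
Lemma qkj x : qmul qk (qmul qj x) = - qmul qi x. Proof. qring. Qed.
Lemma qki x : qmul qk (qmul qi x) = qmul qj x. Proof. qring. Qed.
Lemma qik x : qmul qi (qmul qk x) = - qmul qj x. Proof. qring. Qed.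
Lemma qrZ a b : a *: qr b = qr (a * b) :> H. Proof. qring. Qed.

Ltac dring := rewrite ?dotE ?J1E ?J2E ?(qcoordE, quatE, mxE); ring.

Lemma dotC x y : dot x y = dot y x. Proof. dring. Qed.
Lemma dotDl x y p : dot (x + y) p = dot x p + dot y p. Proof. dring. Qed.
Lemma dotDr x y p : dot p (x + y) = dot p x + dot p y. Proof. dring. Qed.
Lemma dotZl a x y : dot (a *: x) y = a * dot x y. Proof. dring. Qed.
Lemma dotZr a x y : dot x (a *: y) = a * dot x y. Proof. dring. Qed.
Lemma dotNl x y : dot (- x) y = - dot x y. Proof. dring. Qed.
Lemma dotNr x y : dot x (- y) = - dot x y. Proof. dring. Qed.
Lemma dot0l x : dot 0 x = 0 :> R. Proof. dring. Qed.
Lemma dot0r x : dot x 0 = 0 :> R. Proof. dring. Qed.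
Lemma dot_qmulr x y p : dot (qmul x p) (qmul y p) = dot p p * dot x y.
Proof. dring. Qed.
Lemma dot_qmull x y p : dot (qmul p x) (qmul p y) = dot p p * dot x y.
Proof. dring. Qed.
Lemma dot_conj x : dot (qconj x) (qconj x) = dot x x. Proof. dring. Qed.
Lemma dot_adjr x y p : dot (qmul x p) y = dot x (qmul y (qconj p)).
Proof. dring. Qed.
Lemma dot_adjl x y p : dot (qmul p x) y = dot x (qmul (qconj p) y).
Proof. dring. Qed.

Lemma dot_ge0 x : 0 <= dot x x.
Proof. by rewrite dotE -!expr2 !addr_ge0 ?sqr_ge0. Qed.

Lemma dot_eq0 x : (dot x x == 0) = (x == 0).
Proof.
apply/eqP/eqP => [|->]; last exact: dot0l.
rewrite dotE => h; apply: quat_ext; rewrite mxE; nra.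
Qed.

Lemma dot_gt0 x : x != 0 -> 0 < dot x x.
Proof. by rewrite lt_def dot_ge0 dot_eq0 => ->. Qed.

Lemma dot_inj x y : (forall z, dot x z = dot y z) -> x = y.
Proof.
move=> h; apply/eqP; rewrite -subr_eq0 -dot_eq0; apply/eqP.
by rewrite dotDl dotNl h subrr.
Qed.

Lemma qmulVl x : x != 0 -> qmul (qinv x) x = qr 1.
Proof.
by move=> x0; rewrite /qinv qmulZl qmulCl qrZ mulVf ?dot_eq0.
Qed.
Lemma qmulVr x : x != 0 -> qmul x (qinv x) = qr 1.
Proof.
by move=> x0; rewrite /qinv qmulZr qmulCr qrZ mulVf ?dot_eq0.
Qed.

Lemma qr_eq0 a : (qr a == 0 :> H) = (a == 0).
Proof.
apply/eqP/eqP => [/rowP/(_ 0)|->]; first by rewrite quatE mxE.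
by apply: quat_ext; rewrite quatE mxE.
Qed.

Lemma qmul_eq0 x y : (qmul x y == 0) = (x == 0) || (y == 0).
Proof.
apply/eqP/orP => [xy0|[]/eqP->]; rewrite ?qmul0l ?qmul0r //.
case: (eqVneq x 0) => [_|x0]; [by left|right].
by rewrite -(qmul1l y) -(qmulVl x0) -qmulA xy0 qmul0r.
Qed.

Lemma qinv_neq0 x : x != 0 -> qinv x != 0.
Proof.
move=> x0; apply/eqP => xi; have /eqP := qmulVl x0.
by rewrite xi qmul0l eq_sym qr_eq0 oner_eq0.
Qed.

Lemma qmulIr x y p : p != 0 -> qmul x p = qmul y p -> x = y.
Proof.
by move=> p0 e; rewrite -(qmul1r x) -(qmulVr p0) qmulA e -qmulA qmulVr // qmul1r.
Qed.

Lemma J0q x : J 0 x = qmul qi x. Proof. rewrite /J /=; qring. Qed.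
Lemma J1q x : J 1 x = qmul qj x. Proof. rewrite /J /=; qring. Qed.
Lemma J2q x : J 2 x = qmul qk x. Proof. rewrite /J /=; qring. Qed.
Lemma Jq i x : J i x = qmul (qu i) x.
Proof. by elim/ord3P: i x => x; rewrite ?J0q ?J1q ?J2q. Qed.

Lemma qdecomp x : x = qr (x 0 0) + x 0 1 *: qi + x 0 2 *: qj + x 0 3 *: qk.
Proof. qring. Qed.

Lemma qmul_decomp x p : qmul x p =
  x 0 0 *: p + x 0 1 *: J 0 p + x 0 2 *: J 1 p + x 0 3 *: J 2 p.
Proof. by rewrite J0q J1q J2q; qring. Qed.

Lemma linfunE (U V : vectType R) (f : U -> V) (x : U) : linear f -> linfun f x = f x.
Proof.
move=> lf; pose bl := GRing.isLinear.Build R U V _ f lf.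
by pose L : {linear U -> V} := HB.pack f bl; rewrite (lfunE L).
Qed.

Lemma linear_lin (U V : lmodType R) (f : U -> V) : linear f ->
  [/\ f 0 = 0, forall x y : U, f (x + y) = f x + f y,
      forall a (x : U), f (a *: x) = a *: f x & forall x : U, f (- x) = - f x].
Proof.
move=> lf; pose bl := GRing.isLinear.Build R U V _ f lf.
pose L : {linear U -> V} := HB.pack f bl.
split; [exact: (linear0 L)|exact: (linearD L)|exact: (linearZ_LR L)|exact: (linearN L)].
Qed.

Definition rm p : 'End(H) := linfun (fun x : H => qmul x p).
Lemma rmE p x : rm p x = qmul x p.
Proof. by rewrite linfunE // => a u v; rewrite qmulDl qmulZl. Qed.

(** The [J i] are left multiplications, and 1 generates the quaternions as a left module over
    themselves. *)
Lemma comm_J_rm (f : H -> H) : linear f -> (forall i x, f (J i x) = J i (f x)) ->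
  forall x, f x = qmul x (f (qr 1)).
Proof.
move=> lf fJ x; have [f0 fD fZ fN] := linear_lin lf.
rewrite {1}(_ : x = x 0 0 *: qr 1 + x 0 1 *: J 0 (qr 1) + x 0 2 *: J 1 (qr 1)
  + x 0 3 *: J 2 (qr 1)); last by rewrite -qmul_decomp qmul1r.
by rewrite !fD !fZ !fJ -qmul_decomp.
Qed.

Lemma Sp1P (f : 'End(H)) : Sp1 f <-> exists2 p, dot p p = 1 & f = rm p.
Proof.
split=> [[fd fJ]|[p p1 ->]].
  exists (f (qr 1)); first by rewrite fd dotE /qr !quatE; ring.
  by apply/lfunP => x; rewrite rmE -(comm_J_rm _ fJ) //; exact: linearP.
split=> [x y|i x]; first by rewrite !rmE dot_qmulr p1 mul1r.
by rewrite !rmE !Jq qmulA.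
Qed.

Lemma rm_inv p : p != 0 -> (rm p)^-1%VF = rm (qinv p).
Proof.
move=> p0; apply/lfunP => x.
have k0 : lker (rm p) == 0%VS.
  apply/lker0P => u v; rewrite !rmE; exact: qmulIr.
by apply: (lker0P k0); rewrite lker0_lfunVK // !rmE -qmulA qmulVl // qmul1r.
Qed.

Lemma qinv_unit p : dot p p = 1 -> qinv p = qconj p.
Proof. by move=> p1; rewrite /qinv p1 invr1 scale1r. Qed.

Lemma unit_neq0 p : dot p p = 1 -> p != 0.
Proof. by move=> p1; rewrite -dot_eq0 p1 oner_eq0. Qed.

End QuatTheory.
Ltac dring := rewrite ?dotE ?J1E ?J2E ?(qcoordE, quatE, mxE); ring.

(** * Nilpotent Lie algebras *)

Section LinearAlgebra.
Variables (R : realType) (V : vectType R).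
Implicit Types (x y : V) (U : {vspace V}) (phi : V -> R).

Definition linform phi : Prop :=
  [/\ forall x y, phi (x + y) = phi x + phi y,
      forall a x, phi (a *: x) = a * phi x,
      forall x, phi (- x) = - phi x & phi 0 = 0].

Lemma linform_mk phi : (forall x y, phi (x + y) = phi x + phi y) ->
  (forall a x, phi (a *: x) = a * phi x) -> linform phi.
Proof.
move=> fD fZ; split=> // [x|]; first by rewrite -scaleN1r fZ mulN1r.
by rewrite -(scale0r 0) fZ mul0r.
Qed.

Lemma linform_coord n (X : n.-tuple V) i (f : V -> V) : linear f ->
  linform (fun x => coord X i (f x)).
Proof.
move=> lf; have [f0 fD fZ fN] := linear_lin lf.
by apply: linform_mk => [x y|a x]; rewrite ?fD ?fZ ?linearD ?linearZ.
Qed.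

Lemma linform_ext x y : (forall phi, linform phi -> phi x = phi y) -> x = y.
Proof.
move=> h; rewrite (coord_vbasis (memvf x)) (coord_vbasis (memvf y)).
by apply: eq_bigr => i _; congr (_ *: _); apply: h; apply: (@linform_coord _ _ i id).
Qed.

Lemma separating_form U x : x \notin U ->
  exists2 phi, linform phi & phi x = 1 /\ forall u, u \in U -> phi u = 0.
Proof.
move=> xU; have fX : free (x :: vbasis U).
  by rewrite free_cons (span_basis (vbasisP U)) xU (basis_free (vbasisP U)).
(* The family [X] is free but may fail to span; its coordinates are nevertheless linear on all of
   [V]. *)
pose X : (\dim U).+1.-tuple V := [tuple of x :: vbasis U].
exists (coord X ord0); first exact: (@linform_coord _ X ord0 id).
split=> [|u uU]; first by rewrite (_ : x = X`_(ord0 : 'I_(\dim U).+1)) // coord_free ?eqxx.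
rewrite (coord_vbasis uU) linear_sum big1 //= => i _; rewrite linearZ /=.
rewrite (_ : (vbasis U)`_i = X`_(lift ord0 i)) //.
by rewrite coord_free // eq_sym (negbTE (neq_lift _ _)) mulr0.
Qed.

Lemma span_ind (P : V -> Prop) (s : seq V) :
  P 0 -> (forall a x y, P x -> P y -> P (a *: x + y)) ->
  (forall x, x \in s -> P x) -> forall x, x \in span s -> P x.
Proof.
move=> P0 PL Ps x /(coord_span (X := in_tuple s)) ->.
elim: (index_enum _) => [|i r IH]; first by rewrite big_nil.
by rewrite big_cons; apply: PL => //; apply: Ps; apply: mem_nth.
Qed.

End LinearAlgebra.

Section NilpotentLie.
Variables (R : realType) (n : lie_data R).
Hypotheses (lieP : lie_algebra n) (nilP : nilpotent_lie n).
Notation br := (@lie_br R n).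
Implicit Types (x y z : n) (D U : {vspace n}).

Lemma brDr x y z : br x (y + z) = br x y + br x z.
Proof. by have [l _ _ _] := lieP; have [_ -> _ _] := linear_lin (l x). Qed.
Lemma brZr a x y : br x (a *: y) = a *: br x y.
Proof. by have [l _ _ _] := lieP; have [_ _ -> _] := linear_lin (l x). Qed.
Lemma brNr x y : br x (- y) = - br x y.
Proof. by have [l _ _ _] := lieP; have [_ _ _ ->] := linear_lin (l x). Qed.
Lemma br0r x : br x 0 = 0.
Proof. by have [l _ _ _] := lieP; have [-> _ _ _] := linear_lin (l x). Qed.
Lemma brDl x y z : br (x + y) z = br x z + br y z.
Proof. by have [_ l _ _] := lieP; have [_ -> _ _] := linear_lin (l z). Qed.
Lemma brZl a x y : br (a *: x) y = a *: br x y.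
Proof. by have [_ l _ _] := lieP; have [_ _ -> _] := linear_lin (l y). Qed.
Lemma brNl x y : br (- x) y = - br x y.
Proof. by have [_ l _ _] := lieP; have [_ _ _ ->] := linear_lin (l y). Qed.
Lemma br0l x : br 0 x = 0.
Proof. by have [_ l _ _] := lieP; have [-> _ _ _] := linear_lin (l x). Qed.
Lemma brxx x : br x x = 0. Proof. by have [_ _ -> _] := lieP. Qed.
Lemma brC x y : br x y = - br y x.
Proof.
apply/eqP; rewrite -addr_eq0; apply/eqP; move: (brxx (x + y)).
by rewrite brDl !brDr !brxx add0r addr0.
Qed.
Lemma jacobi x y z : br x (br y z) + br y (br z x) + br z (br x y) = 0.
Proof. by have [_ _ _ ->] := lieP. Qed.

(** Contradictions with nilpotency take this form: iterating ad x from [y] would never reach 0. *)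
Lemma nil_no_orbit (P : n -> Prop) x y : P y -> (forall y, P y -> P (br x y)) ->
  (forall y, P y -> y != 0) -> False.
Proof.
move=> Py PS P0; have [k hk] := nilP.
suff: P (foldr br y (nseq k x)) by move/P0; rewrite hk ?size_nseq ?eqxx.
by elim: k {hk} => //= k IH; apply: PS.
Qed.

Definition brs D : {vspace n} :=
  <<[seq br x d | x <- vbasis {:n}, d <- vbasis D]>>%VS.

Lemma mem_brs D x d : d \in D -> br x d \in brs D.
Proof.
move=> dD; rewrite (coord_vbasis (memvf x)) (coord_vbasis dD).
elim/big_rec: _ => [|i u _ IH]; first by rewrite br0l mem0v.
rewrite brDl brZl memvD // memvZ //.
elim/big_rec: _ => [|j v _ IH']; first by rewrite br0r mem0v.
rewrite brDr brZr memvD // memvZ // memv_span //.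
by apply: allpairs_f; apply: mem_nth; rewrite size_tuple.
Qed.

Lemma brs_ind D (P : n -> Prop) :
  P 0 -> (forall a x y, P x -> P y -> P (a *: x + y)) ->
  (forall x d, d \in D -> P (br x d)) -> forall x, x \in brs D -> P x.
Proof.
move=> P0 PL PB; apply: span_ind => // x /allpairsP[[u v] /= [_ vD ->]].
by apply: PB; apply: vbasis_mem.
Qed.

Lemma brsS D U : (D <= U)%VS -> (brs D <= brs U)%VS.
Proof.
move=> /subvP DU; apply/subvP; apply: brs_ind => [|a x y hx hy|x d dD].
- exact: mem0v.
- by rewrite memvD ?memvZ.
- by apply: mem_brs; apply: DU.
Qed.

Lemma foldr_br_lin s a x y :
  foldr br (a *: x + y) s = a *: foldr br x s + foldr br y s.
Proof. by elim: s => //= u s ->; rewrite brDr brZr. Qed.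

Lemma lcs_nil : exists k, iter k brs {:n}%VS = 0%VS.
Proof.
have [k hk] := nilP; exists k.
have foldr0 s : foldr br 0 s = 0 by elim: s => //= u s ->; rewrite br0r.
(* A vector of the j-th term of the lower central series counts as j brackets, so k - j further ones
   kill it. *)
suff h j : (j <= k)%N -> forall x, x \in iter j brs {:n}%VS ->
    forall s, size s = (k - j)%N -> foldr br x s = 0.
  apply/eqP; rewrite -subv0; apply/subvP => x xk.
  by rewrite memv0; apply/eqP; apply: (h k (leqnn _) x xk [::]); rewrite subnn.
elim: j => [_ x _ s|j IH jk x]; first by rewrite subn0; apply: hk.
move: x; apply: brs_ind => [s _|a x y hx hy s hs|x d dD s hs]; first exact: foldr0.
  by rewrite foldr_br_lin hx // hy // scaler0 addr0.
have := IH (ltnW jk) d dD (rcons s x); rewrite -cats1 foldr_cat /=; apply.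
by rewrite size_cat addn1 hs subnSK.
Qed.

(** Iterating the inclusion puts [D] inside every term of the lower central series, and one of these
    is 0. *)
Lemma nakayama D : (D <= brs D)%VS -> D = 0%VS.
Proof.
move=> DD; have [k hk] := lcs_nil; apply/eqP; rewrite -subv0 -hk.
elim: k {hk} => [|k IH]; first exact: subvf.
exact: subv_trans DD (brsS IH).
Qed.

Definition closed_form (phi : n -> R) := linform phi /\ forall x y, phi (br x y) = 0.

(** The quotient n / [n, n] has dimension at least 2: if n = [n, n] + R x, then [x, x] = 0 gives
    [n, n] = [n, [n, n]], so that [n, n] = 0 and n = R x. *)
Lemma two_closed : (1 < \dim {:n})%N ->
  exists phi1 phi2 x y, [/\ closed_form phi1, closed_form phi2,
    phi1 x = 1, phi2 x = 0 & phi2 y = 1].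
Proof.
move=> dn; set D := brs {:n}%VS.
have Dbr x y : br x y \in D by apply: mem_brs; exact: memvf.
have [x xD] : exists x, x \notin D.
  apply/not_existsP => h; move: dn; rewrite (nakayama (D := {:n}%VS)) ?dimv0 //.
  by apply/subvP => x _; apply/negP => /negP/h.
have [y yD] : exists y, y \notin (D + <[x]>)%VS.
  apply/not_existsP => h.
  have full y : exists2 d, d \in D & exists a, y = d + a *: x.
    have /memv_addP[d dD [_ /vlineP[a ->] ->]] : y \in (D + <[x]>)%VS.
      by apply/negP => /negP/h.
    by exists d => //; exists a.
  have D0 : D = 0%VS.
    apply: nakayama; apply/subvP; apply: brs_ind => [|a u v hu hv|u v _].
    - exact: mem0v.
    - by rewrite memvD ?memvZ.
    have [d dD [a ->]] := full u; have [e eD [b ->]] := full v.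
    rewrite brDl !brDr !brZl !brZr brxx !scaler0 addr0 (brC d x).
    by rewrite !memvD ?memvZ ?memvN ?mem_brs.
  have : (\dim {:n} <= \dim <[x]>)%N.
    by apply: dimvS; apply/subvP => y _; have := h y; rewrite D0 add0v => /negP/negPn.
  by rewrite dim_vline => /(leq_trans dn); case: (x != 0).
have [phi1 l1 [p1 q1]] := separating_form xD.
have [phi2 l2 [p2 q2]] := separating_form yD.
exists phi1, phi2, x, y; split=> //.
- by split=> // u v; apply: q1.
- by split=> // u v; apply: q2; apply: (subvP (addvSl _ _)).
- by apply: q2; apply: (subvP (addvSr _ _)); apply: memv_line.
Qed.

(** An iterated bracket outside [I] of the greatest possible length is central modulo [I]. *)
Lemma central_mod (I : n -> Prop) : I 0 -> (exists x, ~ I x) ->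
  exists2 x, ~ I x & forall y, I (br y x).
Proof.
move=> I0 [x0 Ix0]; have [k hk] := nilP.
have {hk} : forall s z, size s = k -> I (foldr br z s) by move=> s z /hk ->.
elim: k => [/(_ [::] x0 erefl)//|k IH hk].
case: (pselect (forall s z, size s = k -> I (foldr br z s))) => [/IH //|].
move=> /existsNP[s] /existsNP[z] /not_implyP[sk Is].
by exists (foldr br z s) => // y; have := hk (y :: s) z; apply; rewrite /= sk.
Qed.

End NilpotentLie.

(** * The Obata connection *)

(** The maps q -> e q e' with e, e' among 1, i, j, k are linearly independent, as H (x) H^op is
    M_4(R). Evaluating at q = 1, i, j, k and multiplying by q on the left changes only the signs of
    the four terms, and the signs separate them. *)
Lemma quat_left_indep (R : realType) (c0 c1 c2 c3 : 'rV[R]_4) :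
  (forall q, qmul q c0 + qmul qi (qmul q c1) + qmul qj (qmul q c2)
     + qmul qk (qmul q c3) = 0) -> c3 = 0.
Proof.
move=> h; have e1 := h (qr 1); rewrite !qmul1l in e1.
have mulE := (qmulDr, qmulNr, qii, qjj, qkk, qij, qji, qjk, qkj, qki, qik).
have ei := congr1 (qmul qi) (h qi); rewrite !mulE qmul0r in ei.
have ej := congr1 (qmul qj) (h qj); rewrite !mulE qmul0r in ej.
have ek := congr1 (qmul qk) (h qk); rewrite !mulE qmul0r in ek.
have e : qmul qk c3 = 0.
  by apply/rowP => i; move: e1 ei ej ek => /rowP/(_ i) + /rowP/(_ i) + /rowP/(_ i) + /rowP/(_ i);
    rewrite !mxE; lra.
by rewrite -[c3]opprK -(qkk c3) e qmul0r oppr0.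
Qed.

Lemma quat_re_ext (R : realType) (x y : 'rV[R]_4) :
  (forall q, (qmul q x) 0 0 = (qmul q y) 0 0) -> x = y.
Proof.
move=> h; have := (h (qr 1), h qi, h qj, h qk).
by case; case; case; rewrite /qmul /qr /qi /qj /qk ?(quatE, mxE) => h0 h1 h2 h3;
  apply: quat_ext; lra.
Qed.

(* Right multiplication by [u] composed with [ad r] is never nilpotent: for an
   imaginary [r] commuting with [u] it preserves the quaternions anticommuting
   with [r], and is injective on them. *)
Lemma ad_mul_not_nil (R : realType) (u : 'rV[R]_4) : u != 0 ->
  exists r, exists E : 'rV[R]_4 -> Prop, [/\ exists p, E p, forall p, E p -> p != 0
    & forall p, E p -> E (qmul (qmul p r - qmul r p) u)].
Proof.
move=> u0; have [r [r00 r0 ru]] : exists r : 'rV[R]_4,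
    [/\ r 0 0 = 0, r != 0 & qmul r u = qmul u r].
  case: (eqVneq (quat 0 (u 0 1) (u 0 2) (u 0 3)) 0) => [/rowP h|h].
    exists qi; split; first by rewrite quatE.
      by apply/eqP => /rowP/(_ 1); rewrite quatE mxE => /eqP; rewrite oner_eq0.
    have := (h 1, h 2, h 3); rewrite !(quatE, mxE) => -[[h1 h2] h3].
    by apply: quat_ext; rewrite ?(qcoordE, h1, h2, h3); ring.
  by exists (quat 0 (u 0 1) (u 0 2) (u 0 3)); split; [rewrite quatE|exact: h|qring].
exists r, (fun p => p != 0 /\ qmul p r = - qmul r p); split=> [|p [] //|p [p0 pr]].
  (* The quaternion (0, r_2, - r_1, 0) is imaginary and orthogonal to [r], hence anticommutes with
     it; it vanishes only if [r] is a multiple of k, and then i will do. *)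
  case: (eqVneq (quat 0 (r 0 2) (- r 0 1) 0) 0) => [/rowP h|h].
    exists qi; split.
      by apply/eqP => /rowP/(_ 1); rewrite quatE mxE => /eqP; rewrite oner_eq0.
    have := (h 1, h 2); rewrite !(quatE, mxE) => -[h1 h2].
    by apply: quat_ext; rewrite ?(qcoordE, mxE, r00, h1); lra.
  exists (quat 0 (r 0 2) (- r 0 1) 0); split => //.
  by apply: quat_ext; rewrite ?(qcoordE, quatE, mxE, r00); ring.
have e : qmul (qmul p r - qmul r p) u = 2%:R *: qmul (qmul p r) u.
  by rewrite pr qmulDl scaler_nat mulr2n.
rewrite e; split; first by rewrite scaler_eq0 pnatr_eq0 !qmul_eq0 !negb_or p0 r0 u0.
by rewrite qmulZl qmulZr -scalerN -!qmulA -ru (qmulA p) pr qmulNl !qmulA.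
Qed.

Section Obata.
Variables (R : realType) (n : lie_data R).
Hypotheses (lieP : lie_algebra n) (quatP : quaternionic n) (intP : J_integrable n).
Notation H := 'rV[R]_4.
Notation br := (@lie_br R n).
Notation I := (@lieJ R n 0).
Notation J := (@lieJ R n 1).
Notation K := (@lieJ R n 2).
Implicit Types (x y z : n) (p q : H).

Lemma lJD i x y : lieJ i (x + y) = lieJ i x + lieJ i y.
Proof. by have [l _ _ _] := quatP; have [_ -> _ _] := linear_lin (l i). Qed.
Lemma lJZ i a x : lieJ i (a *: x) = a *: lieJ i x.
Proof. by have [l _ _ _] := quatP; have [_ _ -> _] := linear_lin (l i). Qed.
Lemma lJN i x : lieJ i (- x) = - lieJ i x.
Proof. by have [l _ _ _] := quatP; have [_ _ _ ->] := linear_lin (l i). Qed.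
Lemma lJ0 i : lieJ i 0 = 0 :> n.
Proof. by have [l _ _ _] := quatP; have [-> _ _ _] := linear_lin (l i). Qed.
Lemma lJJ i x : lieJ i (lieJ i x) = - x.
Proof. by have [_ -> _ _] := quatP. Qed.
Lemma IJ x : I (J x) = K x. Proof. by have [_ _ -> _] := quatP. Qed.
Lemma JI x : J (I x) = - K x. Proof. by have [_ _ _ ->] := quatP. Qed.
Lemma IK x : I (K x) = - J x. Proof. by rewrite -IJ lJJ. Qed.
Lemma KJ x : K (J x) = - I x. Proof. by rewrite -IJ lJJ lJN. Qed.
Lemma JK x : J (K x) = I x. Proof. by rewrite -IJ JI KJ opprK. Qed.
Lemma KI x : K (I x) = J x. Proof. by rewrite -IJ JI lJN IK opprK. Qed.
Definition lJE := (lJD, lJZ, lJN, lJ0, lJJ, IJ, JI, IK, KJ, JK, KI).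

Fact qact_key : unit. Proof. exact: tt. Qed.
Definition qact q x : n := locked_with qact_key
  (q 0 0 *: x + q 0 1 *: I x + q 0 2 *: J x + q 0 3 *: K x).
Lemma qactE q x : qact q x = q 0 0 *: x + q 0 1 *: I x + q 0 2 *: J x + q 0 3 *: K x.
Proof. by rewrite /qact unlock. Qed.

Ltac vring := apply: linform_ext;
  let phi := fresh in let fD := fresh in let fZ := fresh in let fN := fresh in
  let f0 := fresh in move=> phi [fD fZ fN f0];
  rewrite ?(lJE, fD, fZ, fN, f0); ring.

Lemma qactM p q x : qact (qmul p q) x = qact p (qact q x).
Proof. rewrite !qactE ?qcoordE; vring. Qed.
Lemma qactDl p q x : qact (p + q) x = qact p x + qact q x.
Proof. rewrite !qactE !mxE; vring. Qed.
Lemma qactDr p x y : qact p (x + y) = qact p x + qact p y.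
Proof. rewrite !qactE; vring. Qed.
Lemma qactZl a p x : qact (a *: p) x = a *: qact p x.
Proof. rewrite !qactE !mxE; vring. Qed.
Lemma qactNl p x : qact (- p) x = - qact p x.
Proof. rewrite !qactE !mxE; vring. Qed.
Lemma qactNr p x : qact p (- x) = - qact p x.
Proof. rewrite !qactE; vring. Qed.
Lemma qact0l x : qact 0 x = 0. Proof. rewrite !qactE !mxE; vring. Qed.
Lemma qact0r p : qact p 0 = 0. Proof. rewrite !qactE; vring. Qed.
Lemma qact1 x : qact (qr 1) x = x. Proof. rewrite !qactE !qcoordE; vring. Qed.
Lemma qacti x : qact qi x = I x. Proof. rewrite !qactE !qcoordE; vring. Qed.
Lemma qactj x : qact qj x = J x. Proof. rewrite !qactE !qcoordE; vring. Qed.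
Lemma qactk x : qact qk x = K x. Proof. rewrite !qactE !qcoordE; vring. Qed.

Lemma qactK p x : p != 0 -> qact (qinv p) (qact p x) = x.
Proof. by move=> p0; rewrite -qactM qmulVl // qact1. Qed.
Lemma qact_eq0 p x : qact p x = 0 -> p = 0 \/ x = 0.
Proof.
case: (eqVneq p 0) => [|p0 e]; [by left|right].
by rewrite -(qactK x p0) e qact0r.
Qed.

(* The Obata connection: torsion free with all [J_i] parallel. *)
Definition obata x y : n := locked_with qact_key (2%:R^-1 *:
  (br x y + I (br (I x) y) - J (br x (J y)) + K (br (I x) (J y)))).
Lemma obataE x y : obata x y = 2%:R^-1 *:
  (br x y + I (br (I x) y) - J (br x (J y)) + K (br (I x) (J y))).
Proof. by rewrite /obata unlock. Qed.

Notation brE := (brDr lieP, brDl lieP, brZr lieP, brZl lieP, brNl lieP, brNr lieP).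

Lemma obataZl a x z : obata (a *: x) z = a *: obata x z.
Proof. by rewrite !obataE !(lJE, brE); vring. Qed.
Lemma obataDr z x y : obata z (x + y) = obata z x + obata z y.
Proof. by rewrite !obataE !(lJE, brE); vring. Qed.
Lemma obataZr a z x : obata z (a *: x) = a *: obata z x.
Proof. by rewrite !obataE !(lJE, brE); vring. Qed.

(** Commutation with J follows from the shape of the formula alone; for I it rests on the
    integrability of I at (x, y) and at (x, J y). *)
Lemma obataI x y : obata x (I y) = I (obata x y).
Proof.
rewrite !obataE JI !(lJE, brE).
have e1 := intP 0 x y; have e2 := intP 0 x (J y).
rewrite IJ in e2; rewrite e1 e2 !lJE; vring.
Qed.

Lemma obataJ x y : obata x (J y) = J (obata x y).
Proof. by rewrite !obataE !(lJE, brE); vring. Qed.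

Lemma obataK x y : obata x (K y) = K (obata x y).
Proof. by rewrite -!IJ obataI obataJ. Qed.

Lemma obata_qact q x y : obata x (qact q y) = qact q (obata x y).
Proof. by rewrite !qactE !obataDr !obataZr obataI obataJ obataK. Qed.

Lemma obata_torsion x y : obata x y - obata y x = br x y.
Proof.
(* As K I = J, the integrability of J at (x, y) and of K at (I x, I y) give two expressions for
   [J x, J y]; the one of I removes [I x, I y]. Comparing them yields the vanishing of the
   torsion. *)
have e1 := intP 0 x y; have e2 := intP 1 x y; have e3 := intP 2 (I x) (I y).
rewrite !KI in e3; rewrite e1 in e3.
have {e2 e3} := etrans (esym e2) e3.
rewrite !obataE (brC lieP y x) (brC lieP (I y) x) (brC lieP y (J x)) (brC lieP (I y) (J x)) !lJE.
move=> e; apply: linform_ext => phi [fD fZ fN f0].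
have := congr1 phi e; rewrite !(fD, fZ, fN); lra.
Qed.

Lemma obata_br x y : obata x y = obata y x + br x y.
Proof. by rewrite -obata_torsion addrC subrK. Qed.

End Obata.

(** * The theorem of Dotti and Fino *)

Section DottiFino.
Variables (R : realType) (n : lie_data R).
Hypothesis hn : hypercomplex8 n.
Notation H := 'rV[R]_4.
Notation br := (@lie_br R n).
Notation L := (@obata R n).
Notation qa := (@qact R n).
Implicit Types (x y z v w X Y : n) (p q r s : H).

Let lieP : lie_algebra n. Proof. by have [[]] := hn. Qed.
Let nilP : nilpotent_lie n. Proof. by have [[]] := hn. Qed.
Let quatP : quaternionic n. Proof. by have [[]] := hn. Qed.
Let intP : J_integrable n. Proof. by have [[]] := hn. Qed.
Let dim8 : \dim {:n} = 8%N. Proof. by have [] := hn. Qed.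

Let L_br X Y : L X Y = L Y X + br X Y. Proof. exact: obata_br. Qed.
Let Lq q X Y : L X (qa q Y) = qa q (L X Y). Proof. exact: obata_qact. Qed.
Let Lbr X Y : br X Y = L X Y - L Y X.
Proof. by rewrite (obata_torsion lieP quatP intP). Qed.
Let qaM p q X : qa (qmul p q) X = qa p (qa q X). Proof. exact: qactM. Qed.
Let qaDl p q X : qa (p + q) X = qa p X + qa q X. Proof. exact: qactDl. Qed.
Let qaDr p X Y : qa p (X + Y) = qa p X + qa p Y. Proof. exact: qactDr. Qed.
Let qaNl p X : qa (- p) X = - qa p X. Proof. exact: qactNl. Qed.
Let qaNr p X : qa p (- X) = - qa p X. Proof. exact: qactNr. Qed.
Let qa0l X : qa 0 X = 0. Proof. exact: qact0l. Qed.
Let qa0r p : qa p 0 = 0. Proof. exact: qact0r. Qed.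
Let qa1 X : qa (qr 1) X = X. Proof. exact: qact1. Qed.

Ltac vabel := apply: linform_ext;
  let phi := fresh in let fD := fresh in let fZ := fresh in let fN := fresh in
  let f0 := fresh in move=> phi [fD fZ fN f0]; rewrite ?(fD, fZ, fN, f0); ring.

Definition inH z X := exists q, X = qa q z.

Lemma quat_pair_free z v p q : z != 0 -> ~ inH z v ->
  qa p z + qa q v = 0 -> p = 0 /\ q = 0.
Proof.
move=> z0 vz e; case: (eqVneq q 0) => [q0|q0].
  move: e; rewrite q0 qa0l addr0 => /(qact_eq0 quatP) [-> //|z0'].
  by rewrite z0' eqxx in z0.
case: vz; exists (- qmul (qinv q) p); apply/eqP; rewrite qaNl -addr_eq0 addrC qaM.
by rewrite -[X in _ + X](qactK quatP v q0) -qaDr e qa0r.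
Qed.

Lemma quat_pair_inj z v p q p' q' : z != 0 -> ~ inH z v ->
  qa p z + qa q v = qa p' z + qa q' v -> p = p' /\ q = q'.
Proof.
move=> z0 vz /eqP; rewrite -subr_eq0 opprD addrACA -!qaNl -!qaDl => /eqP.
by move=> /(quat_pair_free z0 vz) [/eqP + /eqP]; rewrite !subr_eq0 => /eqP -> /eqP ->.
Qed.

Lemma quat_pair_span z v : z != 0 -> ~ inH z v ->
  forall X, exists p q, X = qa p z + qa q v.
Proof.
move=> z0 vz X; pose f (u : H * H) := qa u.1 z + qa u.2 v.
have lf : linear f.
  move=> a u w; rewrite /f /= !qaDl !qactZl; vabel.
have k0 : lker (linfun f) == 0%VS.
  rewrite -subv0; apply/subvP => u; rewrite memv_ker linfunE // => /eqP.
  by move=> /(quat_pair_free z0 vz); case: u => p q /= [-> ->]; rewrite memv0.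
have : X \in limg (linfun f).
  suff -> : limg (linfun f) = fullv by exact: memvf.
  apply/eqP; rewrite eqEdim subvf /= dim8.
  by rewrite limg_dim_eq ?(eqP k0) ?capv0 // dimvf.
by move=> /memv_imgP[[p q] _ ->]; exists p, q; rewrite linfunE.
Qed.

Definition central z := forall X, br z X = 0.

Lemma central_L z X : central z -> L X z = L z X.
Proof. by move=> cz; rewrite (L_br z) cz addr0. Qed.

(** For central z, L_X (q z) = q L_X z = q L_z X, so brackets with the line Hz only involve
    derivatives along that line. *)
Lemma br_qcentral z q X : central z -> br (qa q z) X = L (qa q z) X - qa q (L z X).
Proof. by move=> cz; rewrite -(central_L X cz) -Lq Lbr. Qed.

Lemma Lqz z q : central z -> L (qa q z) z = qa q (L z z).
Proof. by move=> cz; rewrite central_L // Lq. Qed.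

Lemma br_qq z p q : central z ->
  br (qa p z) (qa q z) = qa (qmul q p - qmul p q) (L z z).
Proof. by move=> cz; rewrite br_qcentral // !Lq Lqz // qaDl qaNl !qaM. Qed.

(** Modulo [I], [r v, p v] = (p r - r p) u v. If u <> 0, then [ad_mul_not_nil] supplies an r for
    which ad (r v) is not nilpotent. *)
Lemma central_mod_square (I : n -> Prop) v u :
  (forall X Y, I X -> I Y -> I (X + Y)) -> (forall q X, I X -> I (qa q X)) ->
  (forall X Y, I Y -> I (L X Y)) -> (forall X Y, I X -> I (L X Y)) ->
  ~ I v -> (forall X, I (br X v)) -> I (L v v - qa u v) -> u = 0.
Proof.
move=> ID Iq IL IR vI cv hu; apply/eqP; apply/negPn/negP => /ad_mul_not_nil.
move=> [r [E [[p0 Ep0] E0 ES]]].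
have IN X : I X -> I (- X) by move=> /(Iq (- qr 1)); rewrite qaNl qa1.
have I0 : I 0.
  suff: I (qa 0 (br v v)) by rewrite qa0l.
  exact: Iq.
apply: (@nil_no_orbit _ n nilP (fun Y => exists2 p, E p & I (Y - qa p v)) (qa r v) (qa p0 v)).
- by exists p0; rewrite ?subrr.
- move=> Y [p Ep hY].
  exists (qmul (qmul p r - qmul r p) u); first exact: ES.
  have Lv s : I (L (qa s v) v - qa (qmul s u) v).
    rewrite L_br Lq qaM addrAC -qaNr -qaDr; apply: (ID); first exact: Iq.
    exact: cv.
  have -> : br (qa r v) Y - qa (qmul (qmul p r - qmul r p) u) v =
      br (qa r v) (Y - qa p v) + (qa p (L (qa r v) v - qa (qmul r u) v)
      - qa r (L (qa p v) v - qa (qmul p u) v)).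
    rewrite (brDr lieP) (brNr lieP) !Lbr !Lq qmulDl qmulNl -!qmulA !(qaDl, qaNl, qaDr, qaNr, qaM).
    vabel.
  apply: (ID); last first.
    by apply: (ID); [apply: Iq|apply: (IN); apply: Iq]; exact: Lv.
  by rewrite Lbr; apply: (ID); [exact: IL|apply: (IN); exact: IR].
- move=> Y [p Ep hY]; apply/eqP => Y0; apply: vI.
  rewrite -(qactK quatP v (E0 _ Ep)) -[qa p v]opprK -[- qa p v]add0r -Y0.
  by apply: (Iq); apply: (IN).
Qed.

(** The left H-linear map from n to H whose real part is [phi]. *)
Definition Hform (phi : n -> R) X : H :=
  quat (phi X) (- phi (lieJ 0 X)) (- phi (lieJ 1 X)) (- phi (lieJ 2 X)).

Section Hform.
Variable phi : n -> R.
Hypothesis lphi : linform phi.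

Lemma HformD X Y : Hform phi (X + Y) = Hform phi X + Hform phi Y.
Proof.
have [fD _ _ _] := lphi.
by apply: quat_ext; rewrite !(quatE, mxE) ?(lJD quatP) !fD ?opprD.
Qed.
Lemma HformN X : Hform phi (- X) = - Hform phi X.
Proof.
have [_ _ fN _] := lphi.
by apply: quat_ext; rewrite !(quatE, mxE) ?(lJN quatP) !fN ?opprK.
Qed.
Lemma Hform0 : Hform phi 0 = 0.
Proof.
have [_ _ _ f0] := lphi.
by apply: quat_ext; rewrite !(quatE, mxE) ?(lJ0 quatP) !f0 ?oppr0.
Qed.
Lemma Hform_qact q X : Hform phi (qa q X) = qmul q (Hform phi X).
Proof.
have [fD fZ fN _] := lphi.
by apply: quat_ext; rewrite qcoordE !(quatE, mxE) qactE ?(lJE quatP, fD, fZ, fN); ring.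
Qed.
Lemma form_qact q X : phi (qa q X) = qmul q (Hform phi X) 0 0.
Proof. by rewrite -Hform_qact quatE. Qed.
End Hform.

Lemma re_qmulC p q : qmul p q 0 0 = qmul q p 0 0.
Proof. by rewrite !qcoordE; ring. Qed.

(** The real part is cyclic, and the real parts of all q x determine x. This turns the vanishing of
    a real form on brackets into an identity between quaternions. *)
Lemma re_twist (a b p xi : H) :
  (forall q, qmul (qmul q b - qmul p (qmul q a)) xi 0 0 = 0) ->
  qmul b xi = qmul (qmul a xi) p.
Proof.
move=> h; apply: quat_re_ext => q; apply/eqP; rewrite -subr_eq0 -[X in _ == X](h q).
by rewrite qmulDl qmulNl !mxE -!qmulA (re_qmulC p) -!qmulA.
Qed.

(** By [nakayama], [n, Hy] cannot contain Hy. *)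
Lemma line_form y : y != 0 -> exists phi,
  [/\ linform phi, Hform phi y != 0 & forall X q, phi (br X (qa q y)) = 0].
Proof.
move=> y0; pose f q := qa q y; have lf : linear f.
  by move=> a p q; rewrite /f qaDl qactZl.
pose D := limg (linfun f).
have memD q : qa q y \in D by rewrite -[qa q y]/(f q) -(linfunE _ lf) memv_img ?memvf.
have [q qD] : exists q, qa q y \notin brs D.
  apply/not_existsP => h; move: y0; rewrite -memv0 -(nakayama lieP nilP (D := D)).
    by rewrite -[y]qa1 memD.
  apply/subvP => _ /memv_imgP[q _ ->]; rewrite linfunE //.
  by apply/negP => /negP; exact: h.
have [phi lphi [p1 pD]] := separating_form qD.
exists phi; split=> // [|X p].
  apply/eqP => xi0; move: p1; rewrite form_qact // xi0 qmul0r mxE => /eqP.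
  by rewrite eq_sym oner_eq0.
by apply: pD; apply: mem_brs.
Qed.

(** * Central vectors z with L_z z = 0 *)

Section SquareZero.
Variable z : n.
Hypotheses (z0 : z != 0) (cz : central z) (Lzz : L z z = 0).

Let Lqzz q : L (qa q z) z = 0. Proof. by rewrite Lqz // Lzz qa0r. Qed.

Lemma br_qz_qz p q : br (qa p z) (qa q z) = 0.
Proof. by rewrite br_qq // Lzz qa0r. Qed.

Lemma square0_line_stable v : ~ inH z v -> inH z (L z v) /\ forall q, inH z (L (qa q z) v).
Proof.
move=> vz; have span := quat_pair_span z0 vz; have inj := quat_pair_inj z0 vz.
have [t [s Lv]] := span (L z v).
(* Modulo Hz, ad (q z) acts on Hv by r -> r b - q r s. *)
have act q : exists b, forall h r, exists h',
    br (qa q z) (qa h z + qa r v) = qa h' z + qa (qmul r b - qmul q (qmul r s)) v.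
  have [c [b Lb]] := span (L (qa q z) v); exists b => h r.
  exists (qmul r c - qmul q (qmul r t)).
  rewrite (brDr lieP) br_qz_qz add0r br_qcentral // !Lq Lb Lv.
  rewrite !(qaDl, qaNl, qaDr, qaNr, qaM); vabel.
have [b1 B1] := act qi; have [b2 B2] := act qj.
have ss : qmul s s = 0.
  (* As [i z, j z] = 0, ad (i z) and ad (j z) commute. Their commutator at q v, modulo Hz, is a sum
     of terms q c0, i q c1, j q c2, k q c3 with c3 = 2 s s. *)
  have c3 : (2%:R *: qmul s s = 0 :> H).
    apply: (@quat_left_indep _ (qmul b2 b1 - qmul b1 b2)
      (qmul s b2 - qmul b2 s) (qmul b1 s - qmul s b1)) => q.
    have [h1 e1] := B1 0 q; have [h2 e2] := B2 0 q.
    have [h3 e3] := B1 h2 (qmul q b2 - qmul qj (qmul q s)).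
    have [h4 e4] := B2 h1 (qmul q b1 - qmul qi (qmul q s)).
    have := jacobi lieP (qa qi z) (qa qj z) (qa 0 z + qa q v).
    rewrite br_qz_qz (br0r lieP) addr0 (brC lieP _ (qa qi z)) (brNr lieP) e1 e2 e3 e4.
    move=> /eqP; rewrite subr_eq0 => /eqP/inj[_ /eqP]; rewrite -subr_eq0 => /eqP e.
    rewrite -[RHS]e !(qmulDl, qmulDr, qmulNl, qmulNr, qmulZl, qmulZr) -!qmulA qij qji.
    by rewrite scaler_nat mulr2n; apply/rowP => a; rewrite !mxE; ring.
  by move/eqP: c3; rewrite scaler_eq0 pnatr_eq0 => /eqP.
have {ss} s0 : s = 0 by move/eqP: ss; rewrite qmul_eq0 orbb => /eqP.
split; first by exists t; rewrite Lv s0 qa0l addr0.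
have b0 q : inH z (L (qa q z) v).
  have [c [b Lb]] := span (L (qa q z) v); suff b0 : b = 0.
    by exists c; rewrite Lb b0 qa0l addr0.
  (* With s = 0, ad (q z) acts modulo Hz by r -> r b, which is injective for b <> 0. *)
  apply/eqP/negPn/negP => b0.
  apply: (@nil_no_orbit _ n nilP
     (fun Y => exists h, exists2 p, p != 0 & Y = qa h z + qa p v) (qa q z) (qa 0 z + qa (qr 1) v)).
  - by exists 0, (qr 1); rewrite // qr_eq0 oner_eq0.
  - move=> Y [h [p p0 ->]]; exists (qmul p c - qmul q (qmul p t)), (qmul p b).
      by rewrite qmul_eq0 negb_or p0.
    rewrite (brDr lieP) br_qz_qz add0r br_qcentral // !Lq Lb Lv s0 qa0l addr0.
    by rewrite !(qaDl, qaNl, qaDr, qaNr, qaM); vabel.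
  - move=> Y [h [p p0 ->]]; apply/eqP => /(quat_pair_free z0 vz) [_ pe].
    by rewrite pe eqxx in p0.
exact: b0.
Qed.

Lemma inHD X Y : inH z X -> inH z Y -> inH z (X + Y).
Proof. by move=> [p ->] [q ->]; exists (p + q); rewrite qaDl. Qed.
Lemma inHq q X : inH z X -> inH z (qa q X).
Proof. by move=> [p ->]; exists (qmul q p); rewrite qaM. Qed.

Lemma L_inH X Y : inH z X -> inH z (L X Y).
Proof.
move=> [q ->]; have [[p ->]|Yz] := pselect (inH z Y).
  by rewrite Lq Lqzz qa0r; exists 0; rewrite qa0l.
exact: (square0_line_stable Yz).2.
Qed.

Lemma L_inHr X Y : inH z Y -> inH z (L X Y).
Proof.
by move=> [q ->]; rewrite Lq central_L //; apply: inHq; apply: L_inH; exists (qr 1); rewrite qa1.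
Qed.

(** Unless n = Hz, the quotient n / Hz is one quaternionic line. A v that is central in it has L_v v
    in Hz by [central_mod_square], and then the multiples of v commute modulo Hz. *)
Lemma br_inH X Y : inH z (br X Y).
Proof.
have B U V : inH z U -> inH z (br V U).
  move=> hU; rewrite Lbr; apply: inHD; first exact: L_inHr.
  by rewrite -[L U V]qa1 -qaNl; apply: inHq; apply: L_inH.
have I0 : inH z 0 by exists 0; rewrite qa0l.
have [hX|/existsNP hX] := pselect (forall X, inH z X); first exact: hX.
have [v vz cv] := central_mod nilP I0 hX.
have [u [w Lv]] := quat_pair_span z0 vz (L v v).
have w0 : w = 0.
  apply: (@central_mod_square (inH z) v) => //; [exact: inHD|exact: inHq|exact: L_inHr|exact: L_inH|].
  by rewrite Lv addrK; exists u.
have [p [q ->]] := quat_pair_span z0 vz X; have [p' [q' ->]] := quat_pair_span z0 vz Y.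
rewrite (brDr lieP); apply: inHD; first by apply: B; exists p'.
rewrite (brDl lieP); apply: inHD.
  by rewrite (brC lieP) -[br _ _]qa1 -qaNl; apply: inHq; apply: B; exists p.
have Lqv r : inH z (L (qa r v) v).
  by rewrite L_br Lq Lv w0 qa0l addr0 -qaM; apply: inHD => //; exists (qmul r u).
rewrite Lbr !Lq -qaNl; apply: inHD; apply: inHq; exact: Lqv.
Qed.

(** A form that kills [n, Hz] but not Hz makes every L_(p z) v depend on L_z v = al z alone, so that
    it suffices to prove al = 0. *)
Lemma line_central q : central (qa q z).
Proof.
have [phi [lphi xi0 hphi]] := line_form z0.
have [[v vz]|hz] := pselect (exists v, ~ inH z v); last first.
  move=> X; have [[p ->]|] := pselect (inH z X); first exact: br_qz_qz.
  by move=> Xz; case: hz; exists X.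
have [[al Lal] Lbe] := square0_line_stable vz.
have brv p b r : L (qa p z) v = qa b z ->
    br (qa p z) (qa r v) = qa (qmul r b - qmul p (qmul r al)) z.
  by move=> e; rewrite br_qcentral // !Lq e Lal qaDl qaNl !qaM.
set xi := Hform phi z in xi0.
have twist p : exists2 b, L (qa p z) v = qa b z & qmul b xi = qmul (qmul al xi) p.
  have [b Lb] := Lbe p; exists b => //; apply: re_twist => r.
  rewrite -Hform_qact // -(brv p b r Lb) quatE (brC lieP).
  by have [_ _ -> _] := lphi; rewrite hphi oppr0.
have al0 : al = 0.
  apply/eqP/negPn/negP => al0.
  have [r [E [[p0 Ep0] E0 ES]]] := ad_mul_not_nil (qinv_neq0 xi0).
  (* The coefficient is chosen so that ad w acts on Hz by p -> (p r - r p) xi^-1. *)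
  pose w := qa (qmul (qmul r (qinv xi)) (qinv al)) v.
  apply: (@nil_no_orbit _ n nilP (fun Y => exists2 p, E p & Y = qa p z) w (qa p0 z)).
  - by exists p0.
  - move=> _ [p Ep ->]; exists (qmul (qmul p r - qmul r p) (qinv xi)); first exact: ES.
    have [b Lb bxi] := twist p.
    rewrite /w (brC lieP) (brv p b _ Lb) -qaNl; congr qa.
    rewrite -[b]qmul1r -(qmulVr xi0) (qmulA b) bxi -!qmulA qmulVl // qmul1r.
    rewrite (qmulA (qinv al)) qmulVl // qmul1l (qmulA (qinv xi)) qmulVl // qmul1l.
    by rewrite opprB qmulDl qmulNl -!qmulA.
  - move=> _ [p Ep ->]; apply/eqP => /(qact_eq0 quatP) [pe|ze].
      by have := E0 p Ep; rewrite pe eqxx.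
    by move: z0; rewrite ze eqxx.
move=> X; have [p [r ->]] := quat_pair_span z0 vz X.
rewrite (brDr lieP) br_qz_qz add0r; have [b Lb bxi] := twist q.
have b0 : b = 0.
  move/eqP: bxi; rewrite al0 !qmul0l qmul_eq0 (negbTE xi0) orbF => /eqP //.
by rewrite (brv q b r Lb) b0 al0 !qmul0r subr0 qa0l.
Qed.

End SquareZero.

(* In this case n = Hz + Hw, where [w = L z z] turns out to be central. *)
Section SquareNonzero.
Variable z : n.
Hypotheses (z0 : z != 0) (cz : central z) (w0 : L z z != 0).
Notation w := (L z z).

Lemma square_notin : ~ inH z w.
Proof.
move=> [u wu]; suff u0 : u = 0 by move: w0; rewrite wu u0 qa0l eqxx.
apply: (@central_mod_square (fun X => X = 0) z) => //.
- by move=> X Y -> ->; rewrite addr0.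
- by move=> q X ->; rewrite qa0r.
- by move=> X Y ->; rewrite -[0 in LHS](qa0l X) Lq qa0l.
- by move=> X Y ->; rewrite -[0 in LHS](scale0r X) obataZl // scale0r.
- by move=> ze; move: z0; rewrite ze eqxx.
- by move=> X; rewrite (brC lieP) cz oppr0.
- by rewrite wu subrr.
Qed.

Let span := quat_pair_span z0 square_notin.
Let al := L z w.
Let B p := L (qa p z) w.

Let br_zw p q : br (qa p z) (qa q w) = qa q (B p) - qa (qmul p q) al.
Proof. by rewrite br_qcentral // !Lq qaM. Qed.

Let qcomm_jk : qmul qk qj - qmul qj qk = - 2%:R *: qi :> H. Proof. qring. Qed.
Let qcomm_ki : qmul qi qk - qmul qk qi = - 2%:R *: qj :> H. Proof. qring. Qed.
Let qcomm_ij : qmul qj qi - qmul qi qj = - 2%:R *: qk :> H. Proof. qring. Qed.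

Let sqi : qmul qi qi = - qr 1 :> H. Proof. qring. Qed.
Let sqj : qmul qj qj = - qr 1 :> H. Proof. qring. Qed.
Let sqk : qmul qk qk = - qr 1 :> H. Proof. qring. Qed.

(** This is the Jacobi identity for i z, j z, k z, whose brackets in cyclic order are - 2 k w, - 2 i
    w, - 2 j w. *)
Let jacobi_B : qa qi (B qi) + qa qj (B qj) + qa qk (B qk) + 3%:R *: al = 0.
Proof.
have := jacobi lieP (qa qi z) (qa qj z) (qa qk z).
rewrite !br_qq // qcomm_jk qcomm_ki qcomm_ij !br_zw !qmulZr sqi sqj sqk.
rewrite !qactZl !qaNl !qa1 => e.
apply: linform_ext => phi [fD fZ fN f0].
have := congr1 phi e; rewrite ?(fD, fZ, fN, f0); lra.
Qed.

(** The sum on the left is 4 times the imaginary part of q. *)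
Let real_of_sum q : qmul qi (qmul q qi) + qmul qj (qmul q qj) + qmul qk (qmul q qk)
  + 3%:R *: q = 0 -> q = qr (q 0 0).
Proof.
move=> /rowP e; move: (e 1) (e 2) (e 3); rewrite !mxE !qcoordE => h1 h2 h3.
by apply: quat_ext; rewrite !qrE //; lra.
Qed.

Section Form.
Variable phi : n -> R.
Hypothesis cphi : closed_form phi.
Notation F := (Hform phi).
Let lphi : linform phi. Proof. by case: cphi. Qed.

(** The brackets [p z, q z] = (q p - p q) w span the multiples of w by imaginary quaternions, and a
    closed form vanishes on them. *)
Lemma Hform_w : F w = qr (phi w).
Proof.
have h p q : qmul (qmul q p - qmul p q) (F w) 0 0 = 0.
  by rewrite -form_qact // -br_qq //; case: cphi.
move: (h qj qk) (h qk qi) (h qi qj); rewrite qcomm_jk qcomm_ki qcomm_ij.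
rewrite !qmulZl !mxE !qcoordE => h1 h2 h3.
by apply: quat_ext; rewrite !qrE; [rewrite quatE| | |]; lra.
Qed.

Lemma Hform_B p : F (B p) = qmul (F al) p.
Proof.
rewrite -[F (B p)]qmul1r -[F al]qmul1r; apply: re_twist => q.
rewrite qmul1r qmulA -!Hform_qact // -HformN // -HformD // -br_zw quatE.
by case: cphi.
Qed.

Lemma Hform_al : F al = qr (phi al).
Proof.
have := congr1 F jacobi_B.
have -> : 3%:R *: al = qa (qr 3%:R) al.
  have -> : qr 3%:R = 3%:R *: qr 1 :> H by qring.
  by rewrite qactZl qa1.
rewrite !HformD // !Hform_qact // !Hform_B Hform0 // qrmul => /real_of_sum ->.
by rewrite quatE.
Qed.

Lemma Hform_br p : F (br (qa p z) w) = 0.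
Proof.
rewrite -[w in br _ w]qa1 br_zw qa1 qmul1r HformD // HformN // Hform_qact // Hform_B.
by rewrite Hform_al qmulr qrmul subrr.
Qed.

End Form.

(** A closed form is determined by its quaternionic values at z and at w, the latter being real, and
    its quaternionic value at [p z, w] is 0. Two independent closed forms are available; the cases
    differ in whether both vanish at w. *)
Lemma br_z_square p : br (qa p z) w = 0.
Proof.
have d8 : (1 < \dim {:n})%N by rewrite dim8.
have [phi1 [phi2 [x [y [c1 c2 x1 x2 y2]]]]] := two_closed lieP nilP d8.
have [l1 _] := c1; have [l2 _] := c2.
have F0 phi : linform phi -> Hform phi z = 0 -> Hform phi w = 0 -> forall X, phi X = 0.
  move=> lf fz fw X; have [r [q ->]] := span X; have [fD _ _ _] := lf.
  by rewrite fD !form_qact // fz fw !qmul0r mxE addr0.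
have indep a b : (forall X, a * phi1 X + b * phi2 X = 0) -> a = 0 /\ b = 0.
  move=> h; have := h x; rewrite x1 x2 mulr1 mulr0 addr0 => a0.
  by have := h y; rewrite y2 a0 mul0r add0r mulr1.
have lincomb a b : closed_form (fun X => a * phi1 X + b * phi2 X).
  have [[D1 Z1 _ _] b1] := c1; have [[D2 Z2 _ _] b2] := c2.
  split; last by move=> X Y; rewrite b1 b2 !mulr0 addr0.
  by apply: linform_mk => [X Y|k X]; rewrite ?D1 ?D2 ?Z1 ?Z2; ring.
have [[cw1 cw2]|cw] := pselect (phi1 w = 0 /\ phi2 w = 0).
  have w1 : Hform phi1 w = 0 by rewrite Hform_w // cw1; apply/eqP; rewrite (qr_eq0 0).
  have w2 : Hform phi2 w = 0 by rewrite Hform_w // cw2; apply/eqP; rewrite (qr_eq0 0).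
  have z1 : Hform phi1 z != 0.
    apply/eqP => z1; have := F0 _ l1 z1 w1 x.
    by rewrite x1 => /eqP; rewrite oner_eq0.
  have [r [a e]] := span al.
  have r0 : r = 0.
    (* The combination [psi] vanishes at [al], so r times its value at z is 0. Hence [psi] = 0, so
       [phi1] also vanishes at [al], and the same argument contradicts its nonzero value at z. *)
    apply/eqP/negPn/negP => r0; set psi := fun X => phi2 al * phi1 X + (- phi1 al) * phi2 X.
    have cpsi : closed_form psi by exact: lincomb.
    have [lpsi _] := cpsi.
    have psiw : Hform psi w = 0.
      rewrite Hform_w // (_ : psi w = 0); first by apply/eqP; rewrite qr_eq0.
      by rewrite /psi cw1 cw2 !mulr0 addr0.
    have : qmul r (Hform psi z) = 0.
      have := Hform_al cpsi; rewrite [in Hform _ al]e HformD // !Hform_qact // psiw qmul0r addr0 => ->.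
      by rewrite (_ : psi al = 0); [apply/eqP; rewrite qr_eq0|rewrite /psi; ring].
    move=> /eqP; rewrite qmul_eq0 (negbTE r0) => /eqP psiz.
    have [_ /eqP] := indep _ _ (F0 _ lpsi psiz psiw); rewrite oppr_eq0 => /eqP al1.
    have := Hform_al c1; rewrite e HformD // !Hform_qact // w1 qmul0r addr0 -e al1.
    move/eqP; rewrite (_ : qr 0 = 0) ?qmul_eq0 ?(negbTE r0) ?(negbTE z1) //.
    by apply/eqP; rewrite qr_eq0.
  have {r r0} e : al = qa a w by rewrite e r0 qa0l add0r.
  have Bw t : exists b, B t = qa b w.
    have [r [b eb]] := span (B t); exists b.
    have : qmul r (Hform phi1 z) = 0.
      have := Hform_B c1 t; rewrite eb e HformD // !Hform_qact // w1 !qmul0r addr0.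
      by rewrite qmul0l.
    by move/eqP; rewrite qmul_eq0 (negbTE z1) orbF => /eqP r0; rewrite eb r0 qa0l add0r.
  (* Now [al] and all the [B t] lie in Hw, where both closed forms vanish. The missing relation
     comes from a form that kills [n, Hw] but not Hw. *)
  have [phi [lphi xi0 hphi]] := line_form w0; set xi := Hform phi w in xi0.
  have twist t b : B t = qa b w -> qmul b xi = qmul (qmul a xi) t.
    move=> eb; apply: re_twist => q.
    rewrite -Hform_qact // qaDl qaNl (qaM q) -eb (qmulA t) (qaM _ a) -e -br_zw quatE.
    exact: hphi.
  have aR : qmul a xi = qr (qmul a xi 0 0).
    have [bi ei] := Bw qi; have [bj ej] := Bw qj; have [bk ek] := Bw qk.
    apply: real_of_sum; rewrite -!(twist _ _ ei, twist _ _ ej, twist _ _ ek).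
    have := jacobi_B; rewrite ei ej ek e -!qaM -qactZl -!qaDl.
    move=> /(qact_eq0 quatP) [h|h]; last by move: w0; rewrite h eqxx.
    by rewrite !qmulA -qmulZl -!qmulDl h qmul0l.
  have [b eb] := Bw p; rewrite -[w in br _ w]qa1 br_zw qa1 qmul1r eb e -qaM.
  suff -> : b = qmul p a by rewrite subrr.
  by apply: (qmulIr xi0); rewrite (twist _ _ eb) -(qmulA p) aR qrmul qmulr.
have [r [q e]] := span (br (qa p z) w).
(* This combination vanishes at w without being zero, so it detects the z-component of [p z, w]. A
   closed form with nonzero value at w then detects the w-component. *)
set psi := fun X => phi2 w * phi1 X + (- phi1 w) * phi2 X.
have cpsi : closed_form psi by exact: lincomb.
have [lpsi _] := cpsi.
have psiw : Hform psi w = 0.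
  rewrite Hform_w // (_ : psi w = 0); first by apply/eqP; rewrite qr_eq0.
  by rewrite /psi; ring.
have psiz : Hform psi z != 0.
  apply/eqP => psiz; apply: cw; have [] := indep _ _ (F0 _ lpsi psiz psiw).
  by move=> -> /eqP; rewrite oppr_eq0 => /eqP ->.
have r0 : r = 0.
  have := Hform_br cpsi p; rewrite e HformD // !Hform_qact // psiw qmul0r addr0.
  by move=> /eqP; rewrite qmul_eq0 (negbTE psiz) orbF => /eqP.
have q0 : q = 0.
  have h phi : closed_form phi -> phi w != 0 -> q = 0.
    move=> cf fw; have [lf _] := cf; have := Hform_br cf p.
    rewrite e r0 qa0l add0r Hform_qact // Hform_w // qmulr => /eqP.
    by rewrite scaler_eq0 (negbTE fw) => /eqP.
  have [w1|/(h _ c1) //] := eqVneq (phi1 w) 0.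
  by have [w2|/(h _ c2) //] := eqVneq (phi2 w) 0; case: cw.
by rewrite e r0 q0 !qa0l addr0.
Qed.

(** Since w commutes with Hz, by Jacobi it commutes with the brackets [p z, r z], which span the
    imaginary multiples of w; and n = Hz + Hw. *)
Lemma square_central : central w.
Proof.
have ww q : br (qa q w) w = 0.
  have jac p r : br (br (qa p z) (qa r z)) w = 0.
    have := jacobi lieP (qa p z) (qa r z) w.
    rewrite br_z_square (br0r lieP) add0r (brC lieP w) br_z_square oppr0 (br0r lieP) add0r.
    by rewrite (brC lieP w) => /eqP; rewrite oppr_eq0 => /eqP.
  have n2 : (- 2%:R : R) != 0 by rewrite oppr_eq0 pnatr_eq0.
  have jac' e p r : qmul r p - qmul p r = (- 2%:R) *: e -> br (qa e w) w = 0.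
    move=> h; have := jac p r; rewrite br_qq // h qactZl (brZl lieP) => /eqP.
    by rewrite scaler_eq0 (negbTE n2) => /eqP.
  rewrite qactE !(brDl lieP) !(brZl lieP) (brxx lieP) -qacti -qactj -qactk.
  by rewrite (jac' _ _ _ qcomm_jk) (jac' _ _ _ qcomm_ki) (jac' _ _ _ qcomm_ij) !scaler0 !addr0.
move=> X; have [p [q ->]] := span X; rewrite (brC lieP) (brDl lieP).
by rewrite br_z_square ww addr0 oppr0.
Qed.

End SquareNonzero.

(* Otherwise [z |-> L z z] could be iterated forever on central vectors, while
   each iterate goes one step down the lower central series. *)
Lemma exists_central_square0 : exists z, [/\ z != 0, central z & L z z = 0].
Proof.
apply: contrapT => /forallNP h.
have hz z : z != 0 -> central z -> L z z != 0 /\ central (L z z).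
  move=> z0 cz; have w0 : L z z != 0 by apply/eqP => w0; apply: (h z).
  by split=> //; apply: square_central.
have [z0 [z0n cz0]] : exists z0, z0 != 0 /\ central z0.
  have [|z0 z0n cz] := @central_mod _ n nilP (fun X => X = 0) erefl.
    apply: contrapT => /forallNP all0; move: dim8.
    suff -> : ({:n} = 0)%VS by rewrite dimv0.
    apply/eqP; rewrite -subv0; apply/subvP => X _; rewrite memv0; apply/eqP.
    exact: contrapT (all0 X).
  by exists z0; split; [apply/eqP|move=> X; rewrite (brC lieP) cz oppr0].
pose zm m := iter m (fun z => L z z) z0.
have zmP m : zm m != 0 /\ central (zm m).
  by elim: m => //= m [a b]; apply: hz.
have [k lk] := lcs_nil lieP nilP.
have n2 : (- 2%:R : R) != 0 by rewrite oppr_eq0 pnatr_eq0.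
have lcsP m : [/\ qa qi (zm m) \in iter m (@brs _ n) {:n}%VS,
    qa qj (zm m) \in iter m (@brs _ n) {:n}%VS & qa qk (zm m) \in iter m (@brs _ n) {:n}%VS].
  elim: m => [|m [Ii Ij Ik]]; first by rewrite !memvf.
  have [_ cm] := zmP m.
  have step e p r : qmul r p - qmul p r = (- 2%:R) *: e ->
      qa r (zm m) \in iter m (@brs _ n) {:n}%VS ->
      qa e (zm m.+1) \in iter m.+1 (@brs _ n) {:n}%VS.
    move=> eq hr; have := mem_brs lieP (qa p (zm m)) hr.
    by rewrite br_qq // eq qactZl; move/(memvZ (- 2%:R)^-1); rewrite scalerA mulVf // scale1r.
  split; [apply: (step _ qj qk) => //; qring|apply: (step _ qk qi) => //; qring|
    apply: (step _ qi qj) => //; qring].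
have [zk0 _] := zmP k; have [hk _ _] := lcsP k.
move: hk; rewrite lk memv0 => /eqP/(qact_eq0 quatP) [/rowP/(_ 1)|ze].
  by rewrite qcoordE mxE => /eqP; rewrite oner_eq0.
by move: zk0; rewrite ze eqxx.
Qed.

Theorem central_line : exists z, [/\ z != 0, forall q, central (qa q z)
  & forall X Y, inH z (br X Y)].
Proof.
have [z [z0 cz Lzz]] := exists_central_square0; exists z; split=> //.
  by move=> q; apply: line_central.
exact: br_inH.
Qed.

End DottiFino.

(** * Hypercomplex brackets *)

Section Isomorphisms.
Variable R : realType.
Implicit Types n : lie_data R.

Lemma isomorphic_refl n : isomorphic n n.
Proof. by exists id; split=> //; exists id. Qed.

Lemma isomorphic_sym n n' : isomorphic n n' -> isomorphic n' n.
Proof.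
move=> [f [lf [g fg gf] fb fJ]]; exists g; split=> [a x y||x y|i x].
- by apply: (can_inj fg); rewrite gf lf !gf.
- by exists f.
- by apply: (can_inj fg); rewrite fb !gf.
- by apply: (can_inj fg); rewrite fJ !gf.
Qed.

Lemma isomorphic_trans n1 n2 n3 :
  isomorphic n1 n2 -> isomorphic n2 n3 -> isomorphic n1 n3.
Proof.
move=> [f [lf bf fb fJ]] [g [lg bg gb gJ]]; exists (f \o g); split=> [a x y||x y|i x] /=.
- by rewrite lg lf.
- exact: bij_comp.
- by rewrite gb fb.
- by rewrite gJ fJ.
Qed.

Lemma isomorphic_integrable n n' :
  isomorphic n n' -> J_integrable n -> J_integrable n'.
Proof.
move=> [f [lf bf fb fJ]] h i x y; apply: (bij_inj bf).
have [f0 fD fZ fN] := linear_lin lf.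
by rewrite !(fD, fb, fJ) h.
Qed.

Lemma isomorphic_abelian n n' :
  isomorphic n n' -> abelian_hypercomplex n -> abelian_hypercomplex n'.
Proof.
by move=> [f [lf bf fb fJ]] h i x y; apply: (bij_inj bf); rewrite !(fb, fJ) h.
Qed.

End Isomorphisms.

Section Brackets.
Variable R : realType.
Notation H := 'rV[R]_4.
Notation bracket := 'Hom(H, 'Hom(H, H)).
Implicit Types (mu la : bracket) (x y v : H) (z : 'I_3 -> H).

Lemma brkDl mu x y u : mu (x + y) u = mu x u + mu y u.
Proof. by rewrite linearD add_lfunE. Qed.
Lemma brkZl mu a x u : mu (a *: x) u = a *: mu x u.
Proof. by rewrite linearZ scale_lfunE. Qed.
Lemma brkDr mu x y u : mu u (x + y) = mu u x + mu u y.
Proof. by rewrite linearD. Qed.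
Lemma brkZr mu a x u : mu u (a *: x) = a *: mu u x.
Proof. by rewrite linearZ. Qed.

Lemma bracket_ext mu la : (forall x y, mu x y = la x y) -> mu = la.
Proof. by move=> h; apply/lfunP => x; apply/lfunP => y. Qed.

Definition mkbr (b : H -> H -> H) : bracket := linfun (fun x => linfun (b x)).
Lemma mkbrE b x y : (forall x, linear (b x)) -> (forall y, linear (b^~ y)) ->
  mkbr b x y = b x y.
Proof.
move=> bl br; rewrite /mkbr linfunE ?linfunE // => a u v.
by apply/lfunP => w; rewrite add_lfunE scale_lfunE !linfunE //; apply: br.
Qed.

Lemma W_antisym mu x y : W mu -> mu x y = - mu y x.
Proof.
move=> h; apply/eqP; rewrite -addr_eq0; apply/eqP; move: (h (x + y)).
by rewrite brkDl !brkDr !h add0r addr0.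
Qed.

Definition wform (z : 'I_3 -> H) v x y : H := \sum_(k < 3)
  (dot (qmul x (qu k)) y *: z k + dot (qmul (qu k) x) y *: qmul (qu k) v).
Definition wbr z v : bracket := mkbr (wform z v).

Lemma qu0 : qu 0 = qi :> H. Proof. by []. Qed.
Lemma qu1 : qu 1 = qj :> H. Proof. by []. Qed.
Lemma qu2 : qu 2 = qk :> H. Proof. by []. Qed.
Definition quE := (qu0, qu1, qu2).

Lemma wbrE z v x y : wbr z v x y = wform z v x y.
Proof.
apply: mkbrE => u a p q; rewrite /wform scaler_sumr -big_split; apply: eq_bigr => k _ /=.
  by rewrite !(dotDr, dotZr); apply/rowP => b; rewrite !mxE; ring.
by rewrite !(qmulDl, qmulDr, qmulZl, qmulZr, dotDl, dotZl); apply/rowP => b; rewrite !mxE; ring.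
Qed.

(** With indices modulo 3, <x e_k, y> takes opposite values on (1, e_k) and (e_(k+1), e_(k+2)), and
    <e_k x, y> takes equal ones. So the half difference of the values of mu is z_k, and the half sum
    is e_k v. *)
Definition zc mu (k : 'I_3) : H :=
  2%:R^-1 *: (mu (qr 1) (qu k) - mu (qu (k + 1)) (qu (k + 2))).
Definition vc mu : H :=
  - (2%:R^-1 *: qmul qi (mu (qr 1) qi + mu qj qk)).

Lemma Wh_integrable mu i x y : Wh mu ->
  mu (J i x) (J i y) = mu x y + J i (mu (J i x) y) + J i (mu x (J i y)).
Proof.
by move=> [_ /(_ i (x, 0) (y, 0))] /= /(congr1 snd) /=.
Qed.

Lemma ord3_add : ((0 + 1 = 1 :> 'I_3)%R * (0 + 2 = 2 :> 'I_3)%R * (1 + 1 = 2 :> 'I_3)%R *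
  (1 + 2 = 0 :> 'I_3)%R * (2 + 1 = 0 :> 'I_3)%R * (2 + 2 = 1 :> 'I_3)%R)%type.
Proof. by do !split; apply: val_inj. Qed.

Lemma mul_ij : qmul qi qj = qk :> H. Proof. qring. Qed.
Lemma mul_jk : qmul qj qk = qi :> H. Proof. qring. Qed.
Lemma mul_ki : qmul qk qi = qj :> H. Proof. qring. Qed.
Lemma mul_ji : qmul qj qi = - qk :> H. Proof. qring. Qed.
Lemma mul_kj : qmul qk qj = - qi :> H. Proof. qring. Qed.
Lemma mul_ik : qmul qi qk = - qj :> H. Proof. qring. Qed.

(** The integrability of [J 0] at (1, j) and of [J 1] at (1, k) links the three half sums, so that
    they are e_k v with a single v. *)
Lemma Wh_wbr mu : Wh mu -> mu = wbr (zc mu) (vc mu).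
Proof.
move=> hmu; have [Wm _] := hmu.
have ej : mu (qr 1) qj + mu qk qi = - qmul qi (mu (qr 1) qk + mu qi qj).
  have := Wh_integrable 0 (qr 1) qj hmu; rewrite !J0q qmul1r mul_ij => e.
  by rewrite (W_antisym qk qi Wm) e qmulDr; apply/rowP => a; rewrite !mxE; ring.
have ek : mu (qr 1) qk + mu qi qj = - qmul qj (mu (qr 1) qi + mu qj qk).
  have := Wh_integrable 1 (qr 1) qk hmu; rewrite !J1q qmul1r mul_jk => e.
  by rewrite (W_antisym qi qj Wm) e qmulDr; apply/rowP => a; rewrite !mxE; ring.
have ei : qmul qj (mu (qr 1) qk + mu qi qj) = mu (qr 1) qi + mu qj qk.
  by rewrite ek qmulNr qjj opprK.
have ui : qmul qi (vc mu) = 2%:R^-1 *: (mu (qr 1) qi + mu qj qk).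
  by rewrite /vc qmulNr qmulZr qii scalerN opprK.
have uj : qmul qj (vc mu) = 2%:R^-1 *: (mu (qr 1) qj + mu qk qi).
  by rewrite -qki ui qmulZr ej -ei qkj.
have uk : qmul qk (vc mu) = 2%:R^-1 *: (mu (qr 1) qk + mu qi qj).
  by rewrite ek scalerN -qmulZr -ui qji opprK.
apply: bracket_ext => x y; rewrite wbrE /wform sum3 /zc !ord3_add !quE ui uj uk.
have expand (u : H) : u = u 0 0 *: qr 1 + u 0 1 *: qi + u 0 2 *: qj + u 0 3 *: qk.
  by rewrite {1}(qdecomp u); congr (_ + _ + _ + _); qring.
have dots : ((dot (qmul x qi) y = (x 0 0 * y 0 1 - x 0 1 * y 0 0) - (x 0 2 * y 0 3 - x 0 3 * y 0 2))%R
  * (dot (qmul x qj) y = (x 0 0 * y 0 2 - x 0 2 * y 0 0) - (x 0 3 * y 0 1 - x 0 1 * y 0 3))%R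
  * (dot (qmul x qk) y = (x 0 0 * y 0 3 - x 0 3 * y 0 0) - (x 0 1 * y 0 2 - x 0 2 * y 0 1))%R
  * (dot (qmul qi x) y = (x 0 0 * y 0 1 - x 0 1 * y 0 0) + (x 0 2 * y 0 3 - x 0 3 * y 0 2))%R
  * (dot (qmul qj x) y = (x 0 0 * y 0 2 - x 0 2 * y 0 0) + (x 0 3 * y 0 1 - x 0 1 * y 0 3))%R
  * (dot (qmul qk x) y = (x 0 0 * y 0 3 - x 0 3 * y 0 0) + (x 0 1 * y 0 2 - x 0 2 * y 0 1))%R)%type.
  by clear; repeat split; dring.
rewrite !dots [in LHS](expand x) [in LHS](expand y) !(brkDl, brkZl, brkDr, brkZr) !Wm.
rewrite !(W_antisym _ (qr 1) Wm) (W_antisym qj qi Wm) (W_antisym qk qj Wm) (W_antisym qi qk Wm).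
move: (mu (qr 1) qi) (mu (qr 1) qj) (mu (qr 1) qk) (mu qj qk) (mu qk qi) (mu qi qj).
by clear; move=> *; apply/rowP => a; rewrite !mxE; field.
Qed.

Lemma wbr_W z v : W (wbr z v).
Proof.
move=> x; rewrite wbrE /wform; apply: big1 => k _.
have -> : dot (qmul x (qu k)) x = 0 by elim/ord3P: k; rewrite quE; dring.
have -> : dot (qmul (qu k) x) x = 0 by elim/ord3P: k; rewrite quE; dring.
by rewrite !scale0r addr0.
Qed.

Lemma dot_adj_i x y : dot x (qmul qi y) = - dot (qmul qi x) y. Proof. dring. Qed.
Lemma dot_adj_j x y : dot x (qmul qj y) = - dot (qmul qj x) y. Proof. dring. Qed.
Lemma dot_adj_k x y : dot x (qmul qk y) = - dot (qmul qk x) y. Proof. dring. Qed.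

Lemma dot_units : ((dot qi qi = 1 :> R) * (dot qj qj = 1 :> R) * (dot qk qk = 1 :> R) *
  (dot qi qj = 0 :> R) * (dot qj qk = 0 :> R) * (dot qk qi = 0 :> R) *
  (dot qj qi = 0 :> R) * (dot qk qj = 0 :> R) * (dot qi qk = 0 :> R) *
  (dot (qr 1) qi = 0 :> R) * (dot (qr 1) qj = 0 :> R) * (dot (qr 1) qk = 0 :> R) *
  (dot (qr 1) (qr 1) = 1 :> R))%type.
Proof. by repeat split; rewrite dotE !qcoordE; ring. Qed.

Lemma qsq : ((qmul qi qi = - qr 1 :> H) * (qmul qj qj = - qr 1 :> H) *
  (qmul qk qk = - qr 1 :> H))%type.
Proof. by repeat split; qring. Qed.

Lemma wbr_Wh z v : Wh (wbr z v).
Proof.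
split; first exact: wbr_W.
move=> i [x x'] [y y']; congr pair; first by rewrite /= !Jq !qmul0r !addr0.
rewrite /= !wbrE /wform !sum3 !quE !Jq !(qmulDr, qmulZr).
elim/ord3P: i; rewrite !quE ?(dot_adj_i, dot_adj_j, dot_adj_k, =^~ qmulA);
  rewrite ?(qii, qjj, qkk, qij, qji, qjk, qkj, qki, qik, qmulNr, dotNl);
  by apply/rowP => a; rewrite !mxE; ring.
Qed.

Lemma wbr_coord z v : (zc (wbr z v) = z) * (vc (wbr z v) = v).
Proof.
have e k : wbr z v (qr 1) (qu k) = z k + qmul (qu k) v.
  rewrite wbrE /wform !sum3 !quE; elim/ord3P: k; rewrite !quE !(qmul1l, qmul1r) !dot_units;
    by rewrite !(scale0r, scale1r, addr0, add0r).
have e' k : wbr z v (qu (k + 1)) (qu (k + 2)) = - z k + qmul (qu k) v.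
  rewrite wbrE /wform !sum3 !quE; elim/ord3P: k;
    rewrite ?ord3_add !quE ?(mul_ij, mul_jk, mul_ki, mul_ji, mul_kj, mul_ik, qsq) ?dotNl ?dot_units;
    by rewrite ?oppr0 ?(scale0r, scale1r, addr0, add0r) scaleN1r.
split.
  by apply/funext => k; rewrite /zc e e'; apply/rowP => a; rewrite !mxE; field.
have := (e 0, e' 0); rewrite !ord3_add !quE /vc => -[-> ->].
rewrite (_ : _ + _ = 2%:R *: qmul qi v); last by apply/rowP => a; rewrite !mxE; ring.
by rewrite qmulZr qii scalerA mulVf ?pnatr_eq0 // scale1r opprK.
Qed.

Lemma Wah_wbr mu : Wah mu <-> exists z, mu = wbr z 0.
Proof.
split=> [[hmu ab]|[z ->]].
  exists (zc mu); rewrite {1}(Wh_wbr hmu); congr wbr.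
  have h' := ab 1 (qr 1) qi.
  have e : mu (qr 1) qi + mu qj qk = 0.
    rewrite !J1q qmul1r mul_ji in h'.
    by rewrite -h' linearN /= addNr.
  by rewrite /vc e qmul0r scaler0 oppr0.
split; first exact: wbr_Wh.
move=> i x y; rewrite !wbrE /wform; apply: eq_bigr => k _.
have q1 : dot (qu i) (qu i) = 1 :> R by elim/ord3P: i; rewrite quE dot_units.
by rewrite !qmul0r !scaler0 !addr0 !Jq -!qmulA dot_qmull q1 mul1r.
Qed.


Lemma N_hypercomplex8 mu : Wh mu -> hypercomplex8 (N_ mu).
Proof.
move=> hmu; have [Wm Jm] := hmu; split; last by rewrite dimvf.
split=> //.
- split.
  + move=> [p1 p2] a [q1 q2] [r1 r2]; congr pair => /=; first by rewrite scaler0 addr0.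
    by rewrite brkDr brkZr.
  + move=> [p1 p2] a [q1 q2] [r1 r2]; congr pair => /=; first by rewrite scaler0 addr0.
    by rewrite brkDl brkZl.
  + by move=> [p1 p2]; congr pair; apply: Wm.
  + by move=> [p1 p2] [q1 q2] [r1 r2]; congr pair; rewrite /= ?linear0 ?addr0.
- by exists 2%N => [[|u [|v []]]] //= z _; congr pair; rewrite linear0.
- split.
  + by move=> i a [p1 p2] [q1 q2]; congr pair; rewrite /= !Jq qmulDr qmulZr.
  + by move=> i [p1 p2]; congr pair; rewrite /= !Jq; elim/ord3P: i; rewrite quE ?(qii, qjj, qkk).
  + by move=> [p1 p2]; congr pair; rewrite /= J0q J1q J2q qij.
  + by move=> [p1 p2]; congr pair; rewrite /= J0q J1q J2q qji.
Qed.

Lemma N_abelian mu : Wh mu -> (abelian_hypercomplex (N_ mu) <-> Wah mu).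
Proof.
move=> hmu; split=> [h|[_ h] i [x x'] [y y']]; last by congr pair; rewrite /= h.
by split=> // i x y; have /(congr1 snd) := h i (x, 0) (y, 0).
Qed.

(** For v outside the central line Hz, n = Hv + Hz, and the whole bracket is recorded by [x v, y v]
    = b(x, y) z. *)
Theorem hypercomplex8_model (n : lie_data R) : hypercomplex8 n ->
  exists2 mu, Wh mu & isomorphic n (N_ mu).
Proof.
move=> hn; have [[lieP nilP quatP intP] dim8] := hn.
have [z [z0 cz hz]] := central_line hn.
have [v vz] : exists v : n, ~ inH z v.
  apply: contrapT => /forallNP h.
  pose f q := qact q z; have lf : linear f by move=> a p q; rewrite /f qactDl qactZl.
  have : (\dim {:n} <= \dim {:H})%N.
    apply: (@leq_trans (\dim (limg (linfun f)))); last by rewrite -(limg_ker_dim (linfun f) fullv) leq_addl.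
    apply: dimvS; apply/subvP => X _; have [q ->] := contrapT (h X).
    by rewrite -[qact q z]/(f q) -(linfunE q lf) memv_img ?memvf.
  by rewrite dim8 dimvf.
have span := quat_pair_span hn z0 vz; have inj := quat_pair_inj hn z0 vz.
pose b x y := sval (cid (hz (qact x v) (qact y v))).
have bE x y : lie_br (qact x v) (qact y v) = qact (b x y) z.
  by rewrite /b; case: cid.
have bU p q : qact p z = qact q z -> p = q.
  move=> e; suff [] : p = q /\ (0 : H) = 0 by [].
  by apply: inj; rewrite e.
have muE x y : mkbr b x y = b x y.
  apply: mkbrE => u a p q; apply: bU; rewrite qactDl qactZl -!bE.
    by rewrite qactDl qactZl (brDr lieP) (brZr lieP).
  by rewrite qactDl qactZl (brDl lieP) (brZl lieP).
have iso : isomorphic n (N_ (mkbr b)).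
  exists (fun u : N_ (mkbr b) => qact u.2 z + qact u.1 v : n); split.
  - move=> a p q /=; rewrite !qactDl !qactZl; apply: linform_ext => phi [fD fZ _ _].
    by rewrite !(fD, fZ); ring.
  - have [|g gE] := @choice n (N_ (mkbr b)) (fun X u => X = qact u.2 z + qact u.1 v).
      by move=> X; have [p [q ->]] := span X; exists (q, p).
    exists g => [u|X]; last by rewrite -gE.
    by have [] := inj _ _ _ _ (gE (qact u.2 z + qact u.1 v)); move: (g _) => [g1 g2]; case: u => u1 u2 /= -> ->.
  - move=> p q /=; rewrite muE (qact0l v) addr0 -bE (brDl lieP) cz add0r (brDr lieP).
    by rewrite (brC lieP _ (qact q.2 z)) cz oppr0 add0r.
  - have qJ i p (X : n) : qact (J i p) X = lieJ i (qact p X).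
      by elim/ord3P: i; rewrite ?J0q ?J1q ?J2q qactM // ?qacti ?qactj ?qactk.
    by move=> i p /=; rewrite !qJ (lJD quatP).
exists (mkbr b) => //; split; last exact: isomorphic_integrable iso intP.
by move=> x; rewrite muE; apply: bU; rewrite -bE (brxx lieP) (qact0l z).
Qed.

End Brackets.

(** * Isomorphisms and the moduli space *)

Section GroupAction.
Variable R : realType.
Notation H := 'rV[R]_4.
Notation bracket := 'Hom(H, 'Hom(H, H)).
Implicit Types (mu la : bracket) (x y p r : H) (phi : 'End(H) * 'End(H)).

Lemma actZ phi c mu : act phi (c *: mu) = c *: act phi mu.
Proof.
by apply: bracket_ext => x y; rewrite !scale_lfunE !actE !scale_lfunE linearZ.
Qed.

Lemma act_rm p r mu x y : dot p p = 1 ->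
  act (rm p, rm r) mu x y = qmul (mu (qmul x (qconj p)) (qmul y (qconj p))) r.
Proof. by move=> p1; rewrite actE /= rm_inv ?unit_neq0 // !rmE qinv_unit. Qed.

Lemma Sp1Sp1P phi : Sp1Sp1 phi <->
  exists p r, [/\ dot p p = 1, dot r r = 1 & phi = (rm p, rm r)].
Proof.
case: phi => f g; split=> [[/= /Sp1P[p p1 ->] /Sp1P[r r1 ->]]|[p [r [p1 r1 [-> ->]]]]].
  by exists p, r.
by split; apply/Sp1P; [exists p|exists r].
Qed.

Lemma act_comp p r p' r' mu : dot p p = 1 -> dot p' p' = 1 ->
  act (rm p, rm r) (act (rm p', rm r') mu) = act (rm (qmul p' p), rm (qmul r' r)) mu.
Proof.
move=> p1 p1'; apply: bracket_ext => x y.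
rewrite !act_rm //; last by rewrite dot_qmulr p1 p1' mul1r.
by rewrite qconjM !qmulA.
Qed.

Lemma dot_qr1 : dot (qr 1) (qr 1) = 1 :> R.
Proof. by rewrite dot_units. Qed.

Lemma act1 mu : act (rm (qr 1), rm (qr 1)) mu = mu.
Proof.
apply: bracket_ext => x y; rewrite act_rm ?dot_qr1 // qmul1r.
by rewrite (_ : qconj (qr 1) = qr 1) ?qmul1r //; qring.
Qed.

Lemma act_inv p r mu : dot p p = 1 -> dot r r = 1 ->
  act (rm (qconj p), rm (qconj r)) (act (rm p, rm r) mu) = mu.
Proof.
by move=> p1 r1; rewrite act_comp ?dot_conj // !qmulCr p1 r1 act1.
Qed.

Definition orbit_rel mu la := exists2 c : R, c != 0 &
  exists2 phi, Sp1Sp1 phi & mu = act phi (c *: la).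

Lemma orbit_relP mu la : orbit_rel mu la <-> exists c p r,
  [/\ c != 0, dot p p = 1, dot r r = 1 & mu = c *: act (rm p, rm r) la].
Proof.
split=> [[c c0 [phi /Sp1Sp1P[p [r [p1 r1 ->]]] ->]]|[c [p [r [c0 p1 r1 ->]]]]].
  by exists c, p, r; rewrite actZ.
exists c => //; exists (rm p, rm r); last by rewrite actZ.
by apply/Sp1Sp1P; exists p, r.
Qed.

Lemma orbit_rel_sym mu la : orbit_rel mu la -> orbit_rel la mu.
Proof.
move=> /orbit_relP[c [p [r [c0 p1 r1 ->]]]]; apply/orbit_relP.
exists c^-1, (qconj p), (qconj r); rewrite !dot_conj invr_eq0.
by split=> //; rewrite actZ act_inv // scalerA mulVf // scale1r.
Qed.

Lemma normalize p : p != 0 -> exists s q, [/\ 0 < s, dot q q = 1 & p = s *: q].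
Proof.
move=> p0; have h := dot_gt0 p0; set s := Num.sqrt (dot p p).
have s0 : 0 < s by rewrite sqrtr_gt0.
exists s, (s^-1 *: p); split=> //.
  by rewrite dotZl dotZr mulrA -invfM -expr2 sqr_sqrtr ?ltW // mulVf // gt_eqF.
by rewrite scalerA mulfV ?scale1r // gt_eqF.
Qed.

Lemma isomorphic_orbit mu la : isomorphic (N_ mu) (N_ la) <-> orbit_rel mu la.
Proof.
split=> [[f [lf bf fb fJ]]|/orbit_relP[c [p [r [c0 p1 r1 ->]]]]]; last first.
  exists (fun u : N_ la => (qmul u.1 p, c *: qmul u.2 r) : N_ _); split.
  - move=> a u v; congr pair => /=; first by rewrite qmulDl qmulZl.
    by rewrite qmulDl qmulZl scalerDr !scalerA mulrC.
  - exists (fun u : N_ _ => (qmul u.1 (qconj p), c^-1 *: qmul u.2 (qconj r)) : N_ la) => u.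
      rewrite /= qmulZl !scalerA mulVf // scale1r -!qmulA !qmulCr p1 r1 !qmul1r.
      by case: u.
    rewrite /= qmulZl !scalerA mulfV // scale1r -!qmulA !qmulCl p1 r1 !qmul1r.
    by case: u.
  - move=> u v; congr pair => /=; first by rewrite qmul0l.
    by rewrite scale_lfunE scale_lfunE act_rm // -!qmulA qmulCr p1 !qmul1r.
  - by move=> i u; congr pair; rewrite /= !Jq ?qmulZr qmulA.
have [f0 fD fZ fN] := linear_lin lf.
have surj u : exists v, f v = u by case: bf => g gK fK; exists (g u).
(* For [la] = 0 the image of the bracket does not single out n_2, so this case is treated apart. *)
have [la0|/eqP la0] := eqVneq la 0.
  have mu0 : mu = 0.
    apply: bracket_ext => x y; rewrite !zero_lfunE.
    have [u hu] := surj (x, 0); have [v hv] := surj (y, 0).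
    have /= := congr1 snd (fb u v); rewrite hu hv /= la0 !zero_lfunE => <-.
    by have /= -> := congr1 snd f0.
  apply/orbit_relP; exists 1, (qr 1), (qr 1); rewrite oner_neq0 dot_qr1 la0 mu0.
  by split=> //; rewrite act1 scaler0.
have [x0 [y0 w0]] : exists x0 y0, la x0 y0 != 0.
  apply: contrapT => h; apply: la0; apply: bracket_ext => x y.
  rewrite !zero_lfunE; apply/eqP/negPn/negP => n0; apply: h; by exists x, y.
pose g1 x := (f (0, x)).1; pose f1 x := (f (x, 0)).1; pose f2 x := (f (0, x)).2.
have pair2 a (x y : H) : ((0, a *: x + y) : N_ la) = a *: ((0, x) : N_ la) + (0, y).
  by congr pair; rewrite /= scaler0 addr0.
have pair1 a (x y : H) : ((a *: x + y, 0) : N_ la) = a *: ((x, 0) : N_ la) + (y, 0).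
  by congr pair; rewrite /= scaler0 addr0.
have pairJ2 i (x : H) : ((0, J i x) : N_ la) = lieJ i ((0, x) : N_ la).
  by congr pair; rewrite Jq qmul0r.
have pairJ1 i (x : H) : ((J i x, 0) : N_ la) = lieJ i ((x, 0) : N_ la).
  by congr pair; rewrite Jq qmul0r.
have g1E : forall x, g1 x = qmul x (g1 (qr 1)).
  apply: comm_J_rm => [a x y|i x]; first by rewrite /g1 pair2 lf.
  by rewrite /g1 pairJ2 fJ.
have f1E : forall x, f1 x = qmul x (f1 (qr 1)).
  apply: comm_J_rm => [a x y|i x]; first by rewrite /f1 pair1 lf.
  by rewrite /f1 pairJ1 fJ.
have f2E : forall x, f2 x = qmul x (f2 (qr 1)).
  apply: comm_J_rm => [a x y|i x]; first by rewrite /f2 pair2 lf.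
  by rewrite /f2 pairJ2 fJ.
(* As [f] sends brackets to brackets, it maps [la x0 y0] into n_2, and this vector generates n_2
   over the quaternions. *)
have g10 x : g1 x = 0.
  suff g0 : g1 (qr 1) = 0 by rewrite g1E g0 qmul0r.
  have : g1 (la x0 y0) = 0 by rewrite /g1 (fb (x0, 0) (y0, 0)).
  by rewrite g1E => /eqP; rewrite qmul_eq0 (negbTE w0) => /eqP.
set p := f1 (qr 1) in f1E; set r := f2 (qr 1) in f2E.
have fst_f u : (f u).1 = qmul u.1 p.
  case: u => a b; have -> : f (a, b) = f (a, 0) + f (0, b).
    by rewrite -fD; congr f; congr pair; rewrite /= ?addr0 ?add0r.
  by rewrite /= -f1E; apply: etrans (congr1 (+%R _) (g10 b)) (addr0 _).
have p0 : p != 0.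
  apply/eqP => p0; have [u hu] := surj (qr 1, 0).
  have := congr1 fst hu; rewrite fst_f p0 qmul0r /= => /eqP.
  by rewrite eq_sym qr_eq0 oner_eq0.
have r0 : r != 0.
  apply/eqP => r0; have : f (0, qr 1) = f 0.
    by rewrite f0 [LHS]surjective_pairing; congr pair; [exact: g10|exact: r0].
  by move/(bij_inj bf) => [] /eqP; rewrite qr_eq0 oner_eq0.
have hb x y : mu (qmul x p) (qmul y p) = qmul (la x y) r.
  rewrite -f2E /f2 (fb (x, 0) (y, 0)) /=.
  by rewrite -[(f (x, 0)).1]/(f1 x) -[(f (y, 0)).1]/(f1 y) !f1E.
have [s [p' [s0 p1' ep]]] := normalize p0; have [t [r' [t0 r1' er]]] := normalize r0.
(* In mu (x p, y p) = la (x, y) r put p = s p' and r = t r'. *)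
apply/orbit_relP; exists (t / s ^+ 2), p', r'.
split=> //; first by rewrite mulf_neq0 ?invr_neq0 ?expf_neq0 // gt_eqF.
apply: bracket_ext => x y; rewrite !scale_lfunE act_rm //.
have := hb (qmul x (qconj p')) (qmul y (qconj p')).
rewrite ep er !qmulZr -!qmulA !qmulCl p1' !qmul1r brkZl brkZr => e.
rewrite mulrC -scalerA -e !scalerA -mulrA -expr2 mulVf ?scale1r //.
by rewrite expf_neq0 // gt_eqF.
Qed.

Lemma isoclass_eq (n n' : lie_data R) : isomorphic n n' -> isoclass n = isoclass n'.
Proof.
move=> h; apply/funext => m; apply/propext; split=> -[hm h'].
  by split=> //; apply: isomorphic_trans h'; apply: isomorphic_sym.
by split=> //; apply: isomorphic_trans h'.
Qed.

Lemma isoclass_inj (n n' : lie_data R) :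
  hypercomplex8 n' -> isoclass n = isoclass n' -> isomorphic n n'.
Proof.
move=> h e; suff [] : isoclass n n' by [].
by rewrite e; split=> //; exact: isomorphic_refl.
Qed.

End GroupAction.

(** * Lines in a vector space *)

Section Lines.
Variables (R : realType) (V : vectType R).
Implicit Types (v w : V) (L : {vspace V}) (S : set V).

Lemma lineZ c v : c != 0 -> <[c *: v]>%VS = <[v]>%VS.
Proof.
move=> c0; apply/eqP; rewrite eqEsubv -!memvE memvZ ?memv_line //=.
by rewrite -[v in v \in _](scalerK c0) memvZ // memv_line.
Qed.

Lemma line_eq v w : v != 0 -> <[v]>%VS = <[w]>%VS -> exists2 c, c != 0 & v = c *: w.
Proof.
move=> v0 e; have : v \in <[w]>%VS by rewrite -e memv_line.
move=> /vlineP[c vc]; exists c => //; apply/eqP => c0.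
by move: v0; rewrite vc c0 scale0r eqxx.
Qed.

Lemma linesP S : (forall c v, S v -> S (c *: v)) ->
  forall L, lines S L <-> exists v, [/\ v != 0, S v & L = <[v]>%VS].
Proof.
move=> SZ L; split=> [[d1 LS]|[v [v0 Sv ->]]].
  have p0 : vpick L != 0.
    by rewrite vpick0; apply/eqP => L0; move: d1; rewrite L0 dimv0.
  exists (vpick L); split=> //; first by apply: LS; apply: memv_pick.
  by apply/eqP; rewrite eq_sym eqEdim -memvE memv_pick d1 dim_vline p0.
by split=> [|w /= /vlineP[c ->]]; [rewrite dim_vline v0|exact: SZ].
Qed.

Lemma mem_line_eq L v : \dim L = 1%N -> v \in L -> v != 0 -> L = <[v]>%VS.
Proof.
by move=> d1 vL v0; apply/eqP; rewrite eq_sym eqEdim -memvE vL d1 dim_vline v0.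
Qed.

Lemma has_dimv_param (T : vectType R) (f : T -> V) S : linear f ->
  (forall x, f x = 0 -> x = 0) -> (forall v, S v <-> exists x, v = f x) ->
  has_dimv S (\dim {:T}).
Proof.
move=> lf inj hS; exists (limg (linfun f)).
  apply/seteqP; split=> v /=.
    by move=> /hS[x ->]; rewrite -(linfunE x lf) memv_img ?memvf.
  by move=> /memv_imgP[x _ ->]; apply/hS; exists x; rewrite linfunE.
rewrite limg_dim_eq //; apply/eqP; rewrite capfv -subv0; apply/subvP => x.
by rewrite memv_ker linfunE // memv0 => /eqP/inj ->.
Qed.

End Lines.

Section Moduli.
Variable R : realType.
Notation H := 'rV[R]_4.
Notation bracket := 'Hom(H, 'Hom(H, H)).
Implicit Types (mu la : bracket) (L : {vspace bracket}) (S : set bracket).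

Lemma maps_lineP phi mu L : maps_line phi <[mu]>%VS L <-> L = <[act phi mu]>%VS.
Proof.
have e : act phi @` [set` <[mu]>%VS] = [set` <[act phi mu]>%VS].
  apply/seteqP; split=> v /=.
    by move=> [w /vlineP[c ->] <-]; rewrite actZ memvZ ?memv_line.
  by move=> /vlineP[c ->]; exists (c *: mu); rewrite ?actZ //= memvZ ?memv_line.
rewrite /maps_line e; split=> [h|-> //]; apply/vspaceP => v.
by have /= := congr1 (@^~ v) h => /propeqP h'; apply/idP/idP; rewrite h'.
Qed.

Lemma line_orbitP mu L : line_orbit <[mu]>%VS L <->
  exists2 phi, Sp1Sp1 phi & L = <[act phi mu]>%VS.
Proof. by split=> -[phi h /maps_lineP]; exists phi => //; apply/maps_lineP. Qed.

Lemma line_orbit_eq mu la : mu != 0 ->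
  line_orbit <[mu]>%VS = line_orbit <[la]>%VS <-> orbit_rel mu la.
Proof.
move=> mu0; have sub (nu ka : bracket) : orbit_rel nu ka ->
    line_orbit <[nu]>%VS `<=` line_orbit <[ka]>%VS.
  move=> /orbit_relP[c [p [r [c0 p1 r1 ->]]]] L hL.
  have [phi /Sp1Sp1P[q [s [q1 s1 ->]]] ->] := (line_orbitP _ _).1 hL.
  apply/line_orbitP; exists (rm (qmul p q), rm (qmul r s)).
    by apply/Sp1Sp1P; exists (qmul p q), (qmul r s); rewrite !dot_qmulr p1 q1 r1 s1 !mulr1.
  by rewrite actZ lineZ // act_comp.
split=> [e|h].
  have : line_orbit <[mu]>%VS <[mu]>%VS.
    apply/line_orbitP; exists (rm (qr 1), rm (qr 1)); last by rewrite act1.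
    by apply/Sp1Sp1P; exists (qr 1), (qr 1); rewrite dot_qr1.
  rewrite e => /line_orbitP[phi hphi /(line_eq mu0) [c c0 ->]].
  by exists c => //; exists phi => //; rewrite actZ.
by apply/seteqP; split; apply: sub => //; apply: orbit_rel_sym.
Qed.

Lemma parameterized (M : (lie_data R -> Prop) -> Prop) S : S `<=` @Wh R ->
  (forall c mu, S mu -> S (c *: mu)) ->
  (forall C, M C <-> exists2 mu, S mu & C = isoclass (N_ mu)) ->
  parameterized_by M S.
Proof.
move=> SW SZ MP; have lP := linesP SZ.
(* Quantifying over all representatives of [q] avoids choosing one; by [FE] they all give the same
   class. *)
pose F (q : set {vspace bracket}) : lie_data R -> Prop := fun n =>
  exists mu, [/\ S mu, mu != 0, q = line_orbit <[mu]>%VS & isoclass (N_ mu) n].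
have FE mu : S mu -> mu != 0 -> F (line_orbit <[mu]>%VS) = isoclass (N_ mu).
  move=> Smu mu0; apply/funext => n; apply/propext; split=> [[la [Sla la0 e h]]|h].
    suff -> : isoclass (N_ mu) = isoclass (N_ la) by [].
    by apply: isoclass_eq; apply/isomorphic_orbit; apply/line_orbit_eq.
  by exists mu.
have W0 : Wh (0 : bracket).
  split; first by move=> x; rewrite !zero_lfunE.
  by move=> i [x x'] [y y']; congr pair; rewrite /= ?zero_lfunE !Jq !qmul0r !addr0.
exists F; split.
- move=> q [L /lP[mu [mu0 Smu ->]] <-]; rewrite FE //; split; first by apply/MP; exists mu.
  move/(isoclass_inj (N_hypercomplex8 W0))/isomorphic_orbit/orbit_relP => -[c [p [r [_ _ _ e]]]].
  move/eqP: mu0; apply; rewrite e; apply: bracket_ext => x y.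
  by rewrite scale_lfunE scale_lfunE actE !zero_lfunE linear0 scaler0.
- move=> q q' [L /lP[mu [mu0 Smu ->]] <-] [L' /lP[la [la0 Sla ->]] <-].
  rewrite !FE // => /(isoclass_inj (N_hypercomplex8 (SW _ Sla)))/isomorphic_orbit h.
  exact/line_orbit_eq.
- move=> C /MP[mu Smu ->] n0; have mu0 : mu != 0 by apply/eqP => e; apply: n0; rewrite e.
  by exists (line_orbit <[mu]>%VS); [exists <[mu]>%VS => //; apply/lP; exists mu|exact: FE].
- move=> L mu lL muL mu0; rewrite -FE //; last by have [_] := lL; apply.
  by have [d1 _] := lL; rewrite {1}(mem_line_eq d1 muL mu0).
Qed.

Lemma wbrZ c z v : c *: wbr z v = wbr (fun k => c *: z k) (c *: v) :> bracket.
Proof.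
apply: bracket_ext => x y; rewrite scale_lfunE scale_lfunE !wbrE /wform scaler_sumr.
by apply: eq_bigr => k _; rewrite qmulZr scalerDr !scalerA ![c * _]mulrC.
Qed.

Lemma WhP mu : Wh mu <-> exists z v, mu = wbr z v.
Proof.
split=> [h|[z [v ->]]]; last exact: wbr_Wh.
by exists (zc mu), (vc mu); apply: Wh_wbr.
Qed.

Lemma WhZ c mu : Wh mu -> Wh (c *: mu).
Proof. by move=> /WhP[z [v ->]]; rewrite wbrZ; apply: wbr_Wh. Qed.

Lemma WahZ c mu : Wah mu -> Wah (c *: mu).
Proof.
by move=> /Wah_wbr[z ->]; rewrite wbrZ scaler0; apply/Wah_wbr; exists (fun k => c *: z k).
Qed.

Theorem moduli_parameterized : parameterized_by (@moduli R) (@Wh R).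
Proof.
apply: parameterized => // [c mu|C]; first exact: WhZ.
split=> [[n hn ->]|[mu hmu ->]]; last by exists (N_ mu) => //; apply: N_hypercomplex8.
by have [mu hmu iso] := hypercomplex8_model hn; exists mu => //; apply: isoclass_eq.
Qed.

Theorem moduli_abelian_parameterized :
  parameterized_by (@moduli_abelian R) (@Wah R).
Proof.
apply: parameterized => [mu []//|c mu|C]; first exact: WahZ.
split=> [[n [hn ab] ->]|[mu hmu ->]].
  have [mu hmu iso] := hypercomplex8_model hn; exists mu; last exact: isoclass_eq.
  exact/(N_abelian hmu)/(isomorphic_abelian iso).
have [hW _] := hmu.
by exists (N_ mu) => //; split; [exact: N_hypercomplex8|exact/N_abelian].
Qed.

Definition wmx (M : ('M[R]_(3, 4) * H)%type) : bracket := wbr (fun k => row k M.1) M.2.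

Lemma wmx_linear : linear wmx.
Proof.
move=> a M N; apply: bracket_ext => x y; rewrite add_lfunE add_lfunE scale_lfunE scale_lfunE.
rewrite !wbrE /wform !sum3 /= !linearP /= !(qmulDr, qmulZr).
by apply/rowP => b; rewrite !mxE; ring.
Qed.

Lemma wmx_inj M : wmx M = 0 -> M = 0.
Proof.
have wbr0 : wbr (fun=> 0) 0 = 0 :> bracket.
  apply: bracket_ext => x y; rewrite wbrE !zero_lfunE /wform; apply: big1 => k _.
  by rewrite qmul0r !scaler0 addr0.
case: M => M v e; have := wbr_coord (fun k => row k M) v; rewrite -[wbr _ _]/(wmx (M, v)) e -wbr0.
rewrite !wbr_coord => -[+ <-] => /(congr1 (@^~ _)) h; congr pair.
by apply/row_matrixP => k; rewrite -h row0.
Qed.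

Theorem Wh_dim : has_dimv (@Wh R) 16.
Proof.
have -> : 16%N = \dim {: ('M[R]_(3, 4) * H)%type} by rewrite dimvf.
apply: has_dimv_param wmx_linear wmx_inj _ => mu; rewrite WhP.
split=> [[z [v ->]]|[[M v] ->]]; last by exists (fun k => row k M), v.
exists (\matrix_k z k, v); rewrite /wmx /=; congr wbr.
by apply/funext => k; rewrite rowK.
Qed.

Theorem Wah_dim : has_dimv (@Wah R) 12.
Proof.
have -> : 12%N = \dim {: 'M[R]_(3, 4)} by rewrite dimvf.
apply: (@has_dimv_param _ _ _ (fun M => wmx (M, 0))).
- move=> a M N; rewrite -wmx_linear; congr wmx; congr pair.
  by rewrite /= scaler0 addr0.
- by move=> M /wmx_inj [].
- move=> mu; rewrite Wah_wbr; split=> [[z ->]|[M ->]]; last by exists (fun k => row k M).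
  exists (\matrix_k z k); rewrite /wmx /=; congr wbr.
  by apply/funext => k; rewrite rowK.
Qed.

Lemma sp1P (a : 'End(H)) : sp1 a <-> exists2 p : H, p 0 0 = 0 & a = rm p.
Proof.
have e (x y p : H) : dot (qmul x p) y + dot x (qmul y p) = 2%:R * p 0 0 * dot x y by dring.
split=> [[ad aJ]|[p p0 ->]].
  have ea : a = rm (a (qr 1)).
    by apply/lfunP => x; rewrite rmE -(comm_J_rm _ aJ) //; exact: linearP.
  exists (a (qr 1)) => //; have := ad (qr 1) (qr 1).
  rewrite ea !rmE !qmul1l => h.
  by move: h; rewrite dotE [dot (qr 1) _]dotE !qrE; lra.
by split=> [x y|i x]; rewrite !rmE ?e ?p0 ?mulr0 ?mul0r // !Jq qmulA.
Qed.

Theorem sp1_dim : has_dimv (@sp1 R `*` @sp1 R) 6.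
Proof.
have -> : 6%N = \dim {: ('rV[R]_3 * 'rV[R]_3)%type} by rewrite dimvf.
pose im (a : 'rV[R]_3) := quat 0 (a 0 0) (a 0 1) (a 0 2).
have imL c a b : im (c *: a + b) = c *: im a + im b.
  by apply: quat_ext; rewrite !(quatE, mxE) ?mulr0 ?addr0.
have rmL c p q : rm (c *: p + q) = c *: rm p + rm q :> 'End(H).
  by apply/lfunP => x; rewrite add_lfunE scale_lfunE !rmE qmulDr qmulZr.
have rm0 (p : H) : rm p = 0 -> p = 0 by move/lfunP/(_ (qr 1)); rewrite rmE qmul1l zero_lfunE.
have im0 a : im a = 0 -> a = 0.
  move=> /rowP h; apply/rowP; elim/ord3P; rewrite mxE.
  - by have := h 1; rewrite quatE mxE.
  - by have := h 2; rewrite quatE mxE.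
  - by have := h 3; rewrite quatE mxE.
have imP (p : H) : p 0 0 = 0 -> p = im (\row_(k < 3) nth 0 [:: p 0 1; p 0 2; p 0 3] k).
  by move=> p0; apply: quat_ext; rewrite !quatE ?mxE.
apply: (@has_dimv_param _ _ _ (fun ab => (rm (im ab.1), rm (im ab.2)))).
- by move=> c a b; rewrite /= !imL !rmL.
- by move=> [a b] [/rm0/im0 /= -> /rm0/im0 ->].
- move=> [a b]; split=> [[/= /sp1P[p p0 ->] /sp1P[q q0 ->]]|[[x y] [-> ->]]].
    exists (\row_(k < 3) nth 0 [:: p 0 1; p 0 2; p 0 3] k,
            \row_(k < 3) nth 0 [:: q 0 1; q 0 2; q 0 3] k).
    by rewrite /= -!imP.
  by split; apply/sp1P; [exists (im x)|exists (im y)] => //; rewrite quatE.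
Qed.

End Moduli.

(** * The representations *)

Section SU2.
Variable R : realType.
Notation H := 'rV[R]_4.
Notation C := R[i].
Implicit Types (x y p q r : H).

Lemma ord2P (P : 'I_2 -> Prop) : P 0 -> P 1 -> forall i, P i.
Proof.
move=> P0 P1 [[|[|i]] Hi] //.
- by rewrite (_ : Ordinal Hi = 0) //; apply: val_inj.
- by rewrite (_ : Ordinal Hi = 1) //; apply: val_inj.
Qed.

Lemma sum2 (V : nmodType) (F : 'I_2 -> V) : \sum_i F i = F 0 + F 1.
Proof.
by rewrite !big_ord_recr big_ord0 /= add0r; congr (F _ + F _); apply: val_inj.
Qed.

Lemma complex_ext (a b : C) : complex.Re a = complex.Re b ->
  complex.Im a = complex.Im b -> a = b.
Proof. by case: a b => [a1 a2] [b1 b2] /= -> ->. Qed.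

Definition mx2 (a b c d : C) : 'M[C]_2 :=
  \matrix_(k, l) if k == 0 then (if l == 0 then a else b) else (if l == 0 then c else d).

Lemma mx2_ext (A B : 'M[C]_2) : A 0 0 = B 0 0 -> A 0 1 = B 0 1 ->
  A 1 0 = B 1 0 -> A 1 1 = B 1 1 -> A = B.
Proof. by move=> *; apply/matrixP; elim/ord2P; elim/ord2P. Qed.

(** Right multiplication by p on (H, J1) = C^2, in the complex basis 1, j. *)
Definition qmx p : 'M[C]_2 := mx2 (p 0 0 +i* p 0 1)%C (- p 0 2 +i* p 0 3)%C
  (p 0 2 +i* p 0 3)%C (p 0 0 -i* p 0 1)%C.

Lemma qmxE p : ((qmx p 0 0 = (p 0 0 +i* p 0 1)%C) * (qmx p 0 1 = (- p 0 2 +i* p 0 3)%C) *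
  (qmx p 1 0 = (p 0 2 +i* p 0 3)%C) * (qmx p 1 1 = (p 0 0 -i* p 0 1)%C))%type.
Proof. by rewrite /qmx /mx2 !mxE. Qed.

Lemma toSU2_rm p : toSU2 (rm p) = qmx p.
Proof.
have d0 : delta_mx 0 0 = qr 1 :> H by apply: quat_ext; rewrite !qrE mxE.
have d2 : delta_mx 0 2 = qj :> H by apply: quat_ext; rewrite !qjE mxE.
by apply: mx2_ext; rewrite qmxE !mxE /= ?d0 ?d2 rmE ?qmul1l ?qcoordE;
  apply: complex_ext => /=; ring.
Qed.

Lemma qmxM p q : qmx (qmul p q) = qmx q *m qmx p.
Proof.
by apply: mx2_ext; rewrite !mxE sum2 !qmxE !qcoordE; apply: complex_ext => /=; ring.
Qed.

Lemma qmx1 : qmx (qr 1) = 1%:M.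
Proof.
by apply: mx2_ext; rewrite !mxE /=; apply: complex_ext => /=; rewrite !qrE ?oppr0.
Qed.

Lemma qmx_inj p q : qmx p = qmx q -> p = q.
Proof.
move=> /matrixP e; have := (e 0 0, e 1 0); rewrite !qmxE => -[[e0 e1] [e2 e3]].
exact: quat_ext.
Qed.

Lemma invmx_qmx p : dot p p = 1 -> invmx (qmx p) = qmx (qconj p).
Proof.
move=> p1; have e : qmx p *m qmx (qconj p) = 1%:M by rewrite -qmxM qmulCl p1 qmx1.
have [pu _] := mulmx1_unit e.
by rewrite -[RHS]mul1mx -(mulVmx pu) -mulmxA e mulmx1.
Qed.

Lemma det_mx2 (A : 'M[C]_2) : \det A = A 0 0 * A 1 1 - A 0 1 * A 1 0.
Proof.
have l0 : lift (0 : 'I_2) (0 : 'I_1) = 1 by apply: val_inj.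
have l1 : lift (1 : 'I_2) (0 : 'I_1) = 0 by apply: val_inj.
rewrite (expand_det_row _ 0) sum2 /cofactor !det_mx11 !mxE l0 l1.
by rewrite /= expr0 expr1 !mul1r mulN1r mulrN.
Qed.

Lemma SU2P (u : 'M[C]_2) : SU2 u <-> exists2 p, dot p p = 1 & u = qmx p.
Proof.
split=> [[uu du]|[p p1 ->]].
  (* The adjugate inverts [u], since its determinant is 1; comparing it with the conjugate transpose
     gives [u] the shape of a quaternion. *)
  have uY : u *m mx2 (u 1 1) (- u 0 1) (- u 1 0) (u 0 0) = 1%:M.
    rewrite det_mx2 in du.
    by apply: mx2_ext; rewrite !mxE sum2 !mxE /= -?du; ring.
  have /matrixP e : (map_mx conjc u)^T = mx2 (u 1 1) (- u 0 1) (- u 1 0) (u 0 0).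
    by rewrite -[LHS]mulmx1 -uY mulmxA (mulmx1C uu) mul1mx.
  have := (e 0 0, e 0 1); rewrite !mxE /= => -[e1 e2].
  exists (quat (complex.Re (u 0 0)) (complex.Im (u 0 0)) (complex.Re (u 1 0)) (complex.Im (u 1 0))).
    move: du; rewrite det_mx2 -e1 -[u 0 1]opprK -e2 => /(congr1 (@complex.Re _)).
    by rewrite dotE !quatE; case: (u 0 0) (u 1 0) => a b [c d] /= <-; ring.
  apply: mx2_ext; rewrite !qmxE !quatE ?e1.
  - by case: (u 0 0).
  - by rewrite -[u 0 1]opprK -e2; case: (u 1 0) => a b; apply: complex_ext => /=; rewrite ?opprK.
  - by case: (u 1 0).
  - by rewrite -e1; case: (u 0 0).
have e : (map_mx conjc (qmx p))^T = qmx (qconj p).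
  by apply: mx2_ext; rewrite [LHS]mxE [LHS]mxE !qmxE !qconjE; apply: complex_ext => /=; rewrite ?opprK.
split; first by rewrite e -qmxM qmulCl p1 qmx1.
rewrite det_mx2 !qmxE; apply: complex_ext => /=; last by ring.
by rewrite -p1 dotE; ring.
Qed.

Theorem Sp1_SU2 : Sp1_iso_SU2 R.
Proof.
split; last first.
  move=> f g /Sp1P[p p1 ->] /Sp1P[q q1 ->].
  have -> : (rm p \o rm q)%VF = rm (qmul q p).
    by apply/lfunP => x; rewrite comp_lfunE !rmE qmulA.
  by rewrite !toSU2_rm qmxM.
split.
- by move=> f /Sp1P[p p1 ->]; rewrite toSU2_rm; apply/SU2P; exists p.
- move=> f g /set_mem/Sp1P[p p1 ->] /set_mem/Sp1P[q q1 ->].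
  by rewrite !toSU2_rm => /qmx_inj ->.
- move=> u /SU2P[p p1 ->]; exists (rm p); last exact: toSU2_rm.
  by apply/Sp1P; exists p.
Qed.

End SU2.

(** * The bracket space as a tensor product *)

Section Tensor.
Variable R : realType.
Notation H := 'rV[R]_4.
Notation C := R[i].
Notation bracket := 'Hom(H, 'Hom(H, H)).
Notation M2C := (realify 'M[R[i]]_2).
Notation C2 := (realify 'cV[R[i]]_2).
Implicit Types (x y p q r : H).

Lemma qu_re k : qu k 0 0 = 0 :> R.
Proof. by elim/ord3P: k; rewrite quE !qcoordE. Qed.

(* The matrix of the rotation [x |-> conj p * x * p] of the imaginary quaternions. *)
Definition qrot p (l k : 'I_3) : R := dot (qu l) (qmul (qmul (qconj p) (qu k)) p).

Lemma im_decomp q : q 0 0 = 0 -> q = \sum_l dot (qu l) q *: qu l.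
Proof.
move=> q0; rewrite sum3 !quE {1}[q]quat_eta q0.
by apply: quat_ext; rewrite !(mxE, dotE, quatE, qcoordE); ring.
Qed.

Lemma conj_re p q : qmul (qmul (qconj p) q) p 0 0 = dot p p * q 0 0.
Proof. dring. Qed.

Lemma qrot_decomp p k : qmul (qmul (qconj p) (qu k)) p = \sum_l qrot p l k *: qu l.
Proof. by apply: im_decomp; rewrite conj_re qu_re mulr0. Qed.

Lemma rm_sum x (c : 'I_3 -> R) (q : 'I_3 -> H) y :
  dot (qmul x (\sum_l c l *: q l)) y = \sum_l c l * dot (qmul x (q l)) y.
Proof. by rewrite !sum3 !(qmulDr, qmulZr, dotDl, dotZl). Qed.

(** The forms <e_k x, y> are invariant under right multiplication of x and y by a unit, whereas on
    the forms <x e_k, y> it acts through conjugation of e_k. *)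
Lemma act_wbr p r z v : dot p p = 1 -> act (rm p, rm r) (wbr z v) =
  wbr (fun l => \sum_k qrot p l k *: qmul (z k) r) (qmul v r).
Proof.
move=> p1; apply: bracket_ext => x y; rewrite act_rm // !wbrE /wform !big_split /= qmulDl.
congr (_ + _); last first.
  rewrite !sum3 !(qmulDl, qmulZl, qmulA) !dot_qmulr !dot_conj p1 !mul1r.
  by rewrite -!qmulA.
under [RHS]eq_bigr do rewrite scaler_sumr.
rewrite exchange_big /=.
have -> : qmul (\sum_(i < 3) dot (qmul (qmul x (qconj p)) (qu i)) (qmul y (qconj p)) *: z i) r =
    \sum_i dot (qmul (qmul x (qconj p)) (qu i)) (qmul y (qconj p)) *: qmul (z i) r.
  by rewrite !sum3 !(qmulDl, qmulZl).
apply: eq_bigr => k _; under eq_bigr do rewrite scalerA.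
rewrite -scaler_suml; congr (_ *: _).
rewrite -[LHS]mul1r -p1 -dot_qmulr -(qmulA y) qmulCl p1 qmul1r.
rewrite -!qmulA (qmulA (qconj p)) qrot_decomp rm_sum.
by apply: eq_bigr => l _; rewrite mulrC.
Qed.

Definition ofC2 (v : 'cV[C]_2) : H := quat (complex.Re (v 0 0)) (complex.Im (v 0 0))
  (complex.Re (v 1 0)) (complex.Im (v 1 0)).

Lemma toC2E x : ((toC2 x 0 0 = (x 0 0 +i* x 0 1)%C) * (toC2 x 1 0 = (x 0 2 +i* x 0 3)%C))%type.
Proof. by rewrite /toC2 !mxE. Qed.

Lemma toC2K : cancel (@toC2 R) ofC2.
Proof. by move=> x; rewrite /ofC2 !toC2E /= -quat_eta. Qed.

Lemma ofC2K : cancel ofC2 (@toC2 R).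
Proof.
move=> v; apply/matrixP => k l; rewrite (ord1 l); elim/ord2P: k;
  by rewrite toC2E /ofC2 !quatE; case: (v _ 0).
Qed.

Lemma toC2_rm x p : toC2 (qmul x p) = qmx p *m toC2 x.
Proof.
apply/matrixP => k l; rewrite (ord1 l) [RHS]mxE sum2; elim/ord2P: k;
  by rewrite !toC2E !qmxE !qcoordE; apply: complex_ext => /=; ring.
Qed.

Lemma ofC2_rm (v : 'cV[C]_2) p : ofC2 (qmx p *m v) = qmul (ofC2 v) p.
Proof. by rewrite -{1}(ofC2K v) -toC2_rm toC2K. Qed.

Lemma realify_mxE (m n : nat) a (u v : realify 'M[C]_(m, n)) i j :
  ((a *: u + v : realify 'M[C]_(m, n)) : 'M[C]_(m, n)) i j =
  (a%:C)%C * (u : 'M[C]_(m, n)) i j + (v : 'M[C]_(m, n)) i j.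
Proof. by rewrite mxE /GRing.scale /= mxE. Qed.

Lemma realify_mx0 (m n : nat) i j :
  ((0 : realify 'M[C]_(m, n)) : 'M[C]_(m, n)) i j = 0.
Proof. by rewrite mxE. Qed.

Lemma Re_lin (a : R) (x y : C) :
  complex.Re ((a%:C)%C * x + y) = a * complex.Re x + complex.Re y.
Proof. by case: x y => [x1 x2] [y1 y2] /=; ring. Qed.
Lemma Im_lin (a : R) (x y : C) :
  complex.Im ((a%:C)%C * x + y) = a * complex.Im x + complex.Im y.
Proof. by case: x y => [x1 x2] [y1 y2] /=; ring. Qed.

Lemma ofC2_linear : linear (ofC2 : C2 -> H).
Proof.
move=> a u v; apply: quat_ext; rewrite /ofC2 quatE realify_mxE ?Re_lin ?Im_lin;
  by rewrite !mxE !quatE.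
Qed.

Lemma toC2_linear : linear (@toC2 R : H -> C2).
Proof.
by move=> a x y; apply: (can_inj ofC2K); rewrite ofC2_linear !toC2K.
Qed.

Definition su2c (a : 'M[C]_2) (k : 'I_3) : R :=
  nth 0 [:: complex.Im (a 0 0); complex.Re (a 1 0); complex.Im (a 1 0)] k.

Lemma su2c_linear k : linear (su2c^~ k : M2C -> R^o).
Proof.
by move=> a u v; elim/ord3P: k; rewrite /su2c /= !realify_mxE ?Re_lin ?Im_lin.
Qed.

Lemma su2c_qmx q k : su2c (qmx q) k = dot (qu k) q.
Proof.
by elim/ord3P: k; rewrite /su2c /= !qmxE /= quE dotE !qcoordE; ring.
Qed.

Lemma su2_qmx (a : 'M[C]_2) : su2 a <-> exists2 q : H, q 0 0 = 0 & a = qmx q.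
Proof.
split=> [[/matrixP h tr]|[q q0 ->]].
  move: (h 0 0) (h 0 1) (h 1 1) tr; rewrite /mxtrace sum2 !mxE.
  move=> h0 h1 h2 tr; exists (quat 0 (su2c a 0) (su2c a 1) (su2c a 2)); rewrite ?quatE //.
  move: (congr1 (@complex.Re R) h0) (congr1 (@complex.Re R) h1) (congr1 (@complex.Im R) h1)
    (congr1 (@complex.Re R) h2) (congr1 (@complex.Im R) tr).
  rewrite /su2c {h h0 h1 h2 tr}.
  case E00: (a 0 0) => [a0 a1]; case E01: (a 0 1) => [b0 b1].
  case E10: (a 1 0) => [c0 c1]; case E11: (a 1 1) => [d0 d1].
  move=> /= h0 h1 h1' h2 t1.
  by apply: mx2_ext; rewrite ?qmxE ?E00 ?E01 ?E10 ?E11 ?quatE;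
    apply: complex_ext => /=; lra.
split; last by rewrite /mxtrace sum2 !qmxE q0; apply: complex_ext => /=; ring.
by apply: mx2_ext; rewrite [LHS]mxE [LHS]mxE [RHS]mxE !qmxE ?q0;
  apply: complex_ext => /=; ring.
Qed.

Definition su2_tensor (a : M2C) (v : C2) : bracket :=
  wbr (fun k => su2c a k *: ofC2 v) 0.

Definition su2_gen (k : 'I_3) : M2C := qmx (qu k).

Lemma wbrL a z v z' v' : a *: wbr z v + wbr z' v' =
  wbr (fun k => a *: z k + z' k) (a *: v + v') :> bracket.
Proof.
apply: bracket_ext => x y; rewrite add_lfunE add_lfunE scale_lfunE scale_lfunE !wbrE.
rewrite /wform scaler_sumr -big_split; apply: eq_bigr => k _ /=.
by rewrite !(qmulDr, qmulZr); apply/rowP => b; rewrite !mxE; ring.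
Qed.

Lemma linear_on_sum (A B : lmodType R) (S : set A) (f : A -> B) (c : 'I_3 -> R) (x : 'I_3 -> A) :
  linear_on S f -> S 0 -> (forall a (x y : A), S x -> S y -> S (a *: x + y)) ->
  (forall k, S (x k)) -> S (\sum_k c k *: x k) /\ f (\sum_k c k *: x k) = \sum_k c k *: f (x k).
Proof.
move=> fl S0 SL Sx; have f0 : f 0 = 0.
  by have := fl 1 0 0 S0 S0; rewrite !scale1r addr0 => /eqP; rewrite -subr_eq subrr => /eqP <-.
elim: (index_enum _) => [|i s [Ss IH]]; first by rewrite !big_nil.
by rewrite !big_cons; split; [exact: SL|rewrite fl // IH].
Qed.

Lemma su2_lin a (x y : M2C) : su2 x -> su2 y -> su2 (a *: x + y).
Proof.
move=> /su2_qmx[p p0 ->] /su2_qmx[q q0 ->]; apply/su2_qmx; exists (a *: p + q).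
  by rewrite !mxE p0 q0 mulr0 addr0.
apply: mx2_ext; rewrite realify_mxE !qmxE !mxE; apply: complex_ext => /=; ring.
Qed.

Lemma su2_0 : su2 (0 : M2C).
Proof.
apply/su2_qmx; exists 0; rewrite ?mxE //; apply: mx2_ext; rewrite qmxE !mxE;
  by apply: complex_ext; rewrite /= ?oppr0.
Qed.

Lemma su2_gen_su2 k : su2 (su2_gen k).
Proof. by apply/su2_qmx; exists (qu k); rewrite ?qu_re. Qed.

Lemma su2_decomp (a : M2C) : su2 a -> a = \sum_k su2c a k *: su2_gen k.
Proof.
move=> /su2_qmx[q q0 ->]; rewrite sum3 !su2c_qmx -[X in _ + X]addr0 -!addrA.
rewrite /su2_gen !quE !dotE !qcoordE.
by apply: mx2_ext; rewrite !realify_mxE !qmxE !qcoordE realify_mx0 ?q0;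
  apply: complex_ext => /=; ring.
Qed.

Lemma linear_on_linear (A B : lmodType R) (S : set A) (f : A -> B) :
  linear f -> linear_on S f.
Proof. by move=> lf a x y _ _; exact: lf. Qed.

Lemma su2_tensor_lin_l v : linear (su2_tensor^~ v).
Proof.
move=> a x y; rewrite /su2_tensor wbrL scaler0 addr0; congr wbr; apply/funext => k.
by rewrite su2c_linear scalerDl scalerA.
Qed.

Lemma su2_tensor_lin_r a : linear (su2_tensor a).
Proof.
move=> c x y; rewrite /su2_tensor wbrL scaler0 addr0; congr wbr; apply/funext => k.
by rewrite ofC2_linear scalerDr !scalerA mulrC.
Qed.

Lemma su2_tensor_decomp z : wbr z 0 = \sum_k su2_tensor (su2_gen k) (toC2 (z k)).
Proof.
have D z1 z2 : wbr z1 0 + wbr z2 0 = wbr (fun k => z1 k + z2 k) 0 :> bracket.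
  rewrite -[wbr z1 0]scale1r wbrL scaler0 addr0; congr wbr.
  by apply/funext => k; rewrite scale1r.
rewrite sum3 /su2_tensor !D; congr wbr; apply/funext => k.
rewrite !toC2K /su2_gen !su2c_qmx.
by elim/ord3P: k; rewrite !quE !dot_units !(scale0r, scale1r, addr0, add0r).
Qed.

Lemma su2_tensor_tensor : is_su2_tensor_R4 (@Wah R) su2_tensor.
Proof.
split; last first.
  move=> phi a v /Sp1Sp1P[p [r [p1 r1 ->]]] /su2_qmx[q q0 ->] /=.
  rewrite /su2_tensor act_wbr // qmul0l /Ad /std !toSU2_rm invmx_qmx // -!qmxM.
  congr wbr; apply/funext => l; rewrite su2c_qmx ofC2_rm.
  under eq_bigr do rewrite su2c_qmx qmulZl scalerA.
  rewrite -scaler_suml; congr (_ *: _).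
  rewrite {1}[q]im_decomp // !sum3 !(qmulDr, qmulDl, qmulZl, qmulZr, dotDr, dotZr) /qrot.
  by rewrite !qmulA; ring.
have lin0 (z : 'I_3 -> H) : Wah (wbr z 0) by apply/Wah_wbr; exists z.
have genS k v : Wah (su2_tensor (su2_gen k) v) by exact: lin0.
split.
- by move=> a v _ _; exact: lin0.
- split=> [v _|a _]; apply: linear_on_linear; [exact: su2_tensor_lin_l|exact: su2_tensor_lin_r].
- move=> X b [b1 b2].
  (* The basis i, j, k of su(2) splits W_ah into three copies of R^4, and a bilinear map is
     determined by its values on this basis. *)
  exists (fun mu => \sum_k b (su2_gen k) (toC2 (zc mu k))).
    move=> a x y /Wah_wbr[z ->] /Wah_wbr[z' ->]; rewrite wbrL !wbr_coord scaler_sumr -big_split.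
    apply: eq_bigr => k _ /=; rewrite toC2_linear.
    by have := b2 _ (su2_gen_su2 k); apply.
  move=> a v ha _; rewrite /su2_tensor wbr_coord [in RHS](su2_decomp ha).
  have [_ ->] := linear_on_sum (su2c a) (b1 v I) su2_0 su2_lin su2_gen_su2.
  apply: eq_bigr => k _; have bk := b2 _ (su2_gen_su2 k).
  have -> : toC2 (su2c a k *: ofC2 v) = su2c a k *: (v : C2) + 0.
    rewrite -[X in toC2 X]addr0 toC2_linear ofC2K; congr (_ + _).
    by apply: (can_inj ofC2K); rewrite toC2K; have [-> _ _ _] := linear_lin ofC2_linear.
  rewrite bk //; have := bk 1 0 0 I I; rewrite !scale1r addr0 => /eqP.
  by rewrite -subr_eq subrr => /eqP <-; rewrite addr0.
- move=> X f f' lf lf' e x /Wah_wbr[z ->]; rewrite su2_tensor_decomp.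
  have Wah0 : Wah (0 : bracket).
    by have := WahZ 0 (lin0 (fun=> 0)); rewrite scale0r.
  have WahL a mu la : Wah mu -> Wah la -> Wah (a *: mu + la : bracket).
    by move=> /Wah_wbr[z1 ->] /Wah_wbr[z2 ->]; rewrite wbrL scaler0 addr0.
  pose t k := su2_tensor (su2_gen k) (toC2 (z k)).
  have -> : \sum_k t k = \sum_k 1 *: t k by apply: eq_bigr => k _; rewrite scale1r.
  have tS k : Wah (t k) by exact: genS.
  have [_ ->] := linear_on_sum (fun=> 1) lf Wah0 WahL tS.
  have [_ ->] := linear_on_sum (fun=> 1) lf' Wah0 WahL tS.
  by apply: eq_bigr => k _; rewrite /t e //; exact: su2_gen_su2.
Qed.

Theorem Wah_rep : equiv_su2_tensor_R4 (@Wah R).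
Proof. by exists su2_tensor; exact: su2_tensor_tensor. Qed.

Theorem Wh_rep : equiv_su2_tensor_R4_plus_R4 (@Wh R).
Proof.
have [T eT _] := Wah_dim R.
have memT mu : (mu \in T) <-> Wah mu by rewrite eT.
exists T, su2_tensor, (fun v => wbr (fun=> 0) (ofC2 v)); split.
- by rewrite -eT; exact: su2_tensor_tensor.
- move=> a u v; rewrite wbrL ofC2_linear; congr wbr; apply/funext => k.
  by rewrite scaler0 addr0.
- move=> phi v /Sp1Sp1P[p [r [p1 r1 ->]]] /=.
  rewrite act_wbr // toSU2_rm /std ofC2_rm; congr wbr; apply/funext => l.
  by rewrite big1 // => k _; rewrite qmul0l scaler0.
- move=> v /memT/Wah_wbr[z] /(congr1 (@vc R)); rewrite !wbr_coord => e.
  by rewrite -(ofC2K v) e; have [-> _ _ _] := linear_lin toC2_linear.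
- apply/seteqP; split=> mu /=.
    move=> /WhP[z [v ->]]; exists (wbr z 0); first by apply/memT/Wah_wbr; exists z.
    exists (toC2 v) => //; rewrite toC2K -[wbr z 0]scale1r wbrL scaler0 add0r.
    by congr wbr; apply/funext => k; rewrite scale1r addr0.
  move=> [x /memT/Wah_wbr[z ->] [v _ <-]]; rewrite -[wbr z 0]scale1r wbrL.
  exact: wbr_Wh.
Qed.

End Tensor.

(** * Normal forms of generic brackets *)

Section Slice.
Variable R : realType.
Notation H := 'rV[R]_4.
Notation bracket := 'Hom(H, 'Hom(H, H)).
Implicit Types (mu la : bracket) (x y p q r v : H) (z : 'I_3 -> H).

Definition cross x y : H := quat 0 (x 0 2 * y 0 3 - x 0 3 * y 0 2)
  (x 0 3 * y 0 1 - x 0 1 * y 0 3) (x 0 1 * y 0 2 - x 0 2 * y 0 1).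

(* For each unit [c], the invariant skew form [dot (c * x) y] turns [z] into a
   vector of the rotation representation, coded as an imaginary quaternion. *)
Definition cov z (c : 'I_3) : H := let q := qu c in locked_with quat_key
  (quat 0 (dot (qmul q (z 1)) (z 2)) (dot (qmul q (z 2)) (z 0)) (dot (qmul q (z 0)) (z 1))).

Lemma covU z c : cov z c = quat 0 (dot (qmul (qu c) (z 1)) (z 2))
  (dot (qmul (qu c) (z 2)) (z 0)) (dot (qmul (qu c) (z 0)) (z 1)).
Proof. by rewrite /cov unlock. Qed.

Lemma covE z c : ((cov z c 0 0 = 0) * (cov z c 0 1 = dot (qmul (qu c) (z 1)) (z 2)) *
  (cov z c 0 2 = dot (qmul (qu c) (z 2)) (z 0)) *
  (cov z c 0 3 = dot (qmul (qu c) (z 0)) (z 1)))%type.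
Proof. by rewrite !covU !quatE. Qed.

Definition rotate (g : 'I_3 -> H) z : 'I_3 -> H := fun l => \sum_k dot (g l) (qu k) *: z k.

Definition frame p (l : 'I_3) : H := qmul (qmul p (qu l)) (qconj p).

Lemma frame_qrot p l k : dot (frame p l) (qu k) = qrot p l k.
Proof. by rewrite /frame /qrot dot_adjr qconjK dot_adjl qmulA dotC dotC. Qed.

Lemma act_rotate p r z v : dot p p = 1 -> act (rm p, rm r) (wbr z v) =
  wbr (fun l => qmul (rotate (frame p) z l) r) (qmul v r).
Proof.
move=> p1; rewrite act_wbr //; congr wbr; apply/funext => l.
rewrite /rotate !sum3 !(qmulDl, qmulZl); by rewrite !frame_qrot.
Qed.

Lemma cov_scale z c a : cov (fun k => a *: z k) c = a ^+ 2 *: cov z c.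
Proof.
rewrite !covU !(qmulZr, dotZl, dotZr); apply: quat_ext; rewrite !(quatE, mxE); ring.
Qed.

Lemma cov_mul z c r : cov (fun k => qmul (z k) r) c = dot r r *: cov z c.
Proof.
rewrite !covU !qmulA !dot_qmulr; apply: quat_ext; rewrite !(quatE, mxE); ring.
Qed.

Lemma dot_skew c x y : dot (qmul (qu c) x) y = - dot (qmul (qu c) y) x.
Proof. by elim/ord3P: c; rewrite quE; dring. Qed.

Lemma dot_skew0 c x : dot (qmul (qu c) x) x = 0.
Proof. by elim/ord3P: c; rewrite quE; dring. Qed.

Lemma cov_comb (a b : 'I_3 -> R) z c :
  dot (qmul (qu c) (\sum_k a k *: z k)) (\sum_k b k *: z k) =
  (a 1 * b 2 - a 2 * b 1) * cov z c 0 1 + (a 2 * b 0 - a 0 * b 2) * cov z c 0 2 +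
  (a 0 * b 1 - a 1 * b 0) * cov z c 0 3.
Proof.
rewrite !sum3 !(qmulDr, qmulZr, dotDl, dotDr, dotZl, dotZr) !dot_skew0 !covE.
rewrite (dot_skew c (z 1) (z 0)) (dot_skew c (z 2) (z 1)) (dot_skew c (z 0) (z 2)); ring.
Qed.

Lemma dot_quv q : ((dot q qi = q 0 1) * (dot q qj = q 0 2) * (dot q qk = q 0 3))%type.
Proof. by repeat split; rewrite dotE !qcoordE; ring. Qed.

Lemma cov_rotate_comb (g : 'I_3 -> H) z c : cov (rotate g z) c = quat 0
  ((g 1 0 2 * g 2 0 3 - g 1 0 3 * g 2 0 2) * cov z c 0 1 +
   (g 1 0 3 * g 2 0 1 - g 1 0 1 * g 2 0 3) * cov z c 0 2 +
   (g 1 0 1 * g 2 0 2 - g 1 0 2 * g 2 0 1) * cov z c 0 3)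
  ((g 2 0 2 * g 0 0 3 - g 2 0 3 * g 0 0 2) * cov z c 0 1 +
   (g 2 0 3 * g 0 0 1 - g 2 0 1 * g 0 0 3) * cov z c 0 2 +
   (g 2 0 1 * g 0 0 2 - g 2 0 2 * g 0 0 1) * cov z c 0 3)
  ((g 0 0 2 * g 1 0 3 - g 0 0 3 * g 1 0 2) * cov z c 0 1 +
   (g 0 0 3 * g 1 0 1 - g 0 0 1 * g 1 0 3) * cov z c 0 2 +
   (g 0 0 1 * g 1 0 2 - g 0 0 2 * g 1 0 1) * cov z c 0 3).
Proof.
have e l m : dot (qmul (qu c) (rotate g z l)) (rotate g z m) =
   (g l 0 2 * g m 0 3 - g l 0 3 * g m 0 2) * cov z c 0 1 +
   (g l 0 3 * g m 0 1 - g l 0 1 * g m 0 3) * cov z c 0 2 +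
   (g l 0 1 * g m 0 2 - g l 0 2 * g m 0 1) * cov z c 0 3.
  have := cov_comb (fun k => dot (g l) (qu k)) (fun k => dot (g m) (qu k)) z c.
  by rewrite !quE !dot_quv.
by rewrite covU; congr quat; apply: e.
Qed.

Lemma crossE x y : cross x y = 2%:R^-1 *: (qmul x y - qmul y x).
Proof. by rewrite /cross; apply: quat_ext; rewrite !(quatE, mxE, qcoordE); field. Qed.

Lemma frame_mul p l m :
  qmul (frame p l) (frame p m) = dot p p *: qmul (qmul p (qmul (qu l) (qu m))) (qconj p).
Proof. by rewrite /frame -!qmulA (qmulA (qconj p)) qmulCl qrmul !qmulZr. Qed.

Lemma frame_cross p : ((cross (frame p 0) (frame p 1) = dot p p *: frame p 2) *
  (cross (frame p 1) (frame p 2) = dot p p *: frame p 0) *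
  (cross (frame p 2) (frame p 0) = dot p p *: frame p 1))%type.
Proof.
have h (x : H) : 2%:R^-1 *: (dot p p *: x - dot p p *: - x) = dot p p *: x.
  by apply/rowP => i; rewrite !mxE; field.
by rewrite !crossE !frame_mul /frame !quE mul_ij mul_jk mul_ki mul_ji mul_kj mul_ik
  !(qmulNr, qmulNl) !h.
Qed.

Lemma im_eta q : q 0 0 = 0 -> q = quat 0 (q 0 1) (q 0 2) (q 0 3).
Proof. by move=> q0; rewrite {1}[q]quat_eta q0. Qed.

Lemma cov_rotate p z c : dot p p = 1 ->
  cov (rotate (frame p) z) c = qmul (qmul (qconj p) (cov z c)) p.
Proof.
move=> p1; rewrite [RHS]im_eta; last by rewrite conj_re covE mulr0.
have e l : dot (qu l) (qmul (qmul (qconj p) (cov z c)) p) = dot (frame p l) (cov z c).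
  by rewrite dotC dot_adjr dot_adjl qconjK qmulA dotC.
have := (e 0, e 1, e 2); rewrite !quE ![dot _ (qmul _ p)]dotC !dot_quv => -[[-> ->] ->].
have im (q : H) : dot q (cov z c) =
    q 0 1 * cov z c 0 1 + q 0 2 * cov z c 0 2 + q 0 3 * cov z c 0 3.
  by rewrite dotE covE; ring.
(* The coefficients are the cross products of two vectors of the frame, and each of these is the
   third vector by [frame_cross]. *)
rewrite [LHS]cov_rotate_comb.
have := frame_cross p; rewrite p1 !scale1r.
move: (cov z c) im (frame p 0) (frame p 1) (frame p 2) => n im f0 f1 f2 [[c01 c12] c20].
by congr quat; [rewrite -c12|rewrite -c20|rewrite -c01]; rewrite im !quatE; ring.
Qed.

Lemma cross_conj x y p : dot p p = 1 ->
  cross (qmul (qmul (qconj p) x) p) (qmul (qmul (qconj p) y) p) =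
  qmul (qmul (qconj p) (cross x y)) p.
Proof.
move=> p1; rewrite !crossE !(qmulZr, qmulZl, qmulDr, qmulDl, qmulNr, qmulNl).
have e (a b : H) : qmul (qmul (qmul (qconj p) a) p) (qmul (qmul (qconj p) b) p) =
    qmul (qmul (qconj p) (qmul a b)) p.
  by rewrite -!qmulA (qmulA p) qmulCr p1 qmul1l.
by rewrite (e x y) (e y x).
Qed.

Lemma crossZ a b x y : cross (a *: x) (b *: y) = (a * b) *: cross x y.
Proof. by rewrite /cross; apply: quat_ext; rewrite !(quatE, mxE); ring. Qed.

(** The covariants are imaginary quaternions, so this vanishes exactly when the first two are
    linearly dependent. *)
Definition disc z : H := cross (cov z 0) (cov z 1).
Definition generic z := disc z != 0.

Lemma conj_eq0 p q : p != 0 -> (qmul (qmul (qconj p) q) p == 0) = (q == 0).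
Proof.
move=> p0; rewrite !qmul_eq0 (negbTE p0) orbF.
by rewrite -[qconj p == 0]dot_eq0 dot_conj dot_eq0 (negbTE p0).
Qed.

Lemma generic_act a p r z : a != 0 -> dot p p = 1 -> dot r r = 1 ->
  generic (fun l => a *: qmul (rotate (frame p) z l) r) = generic z.
Proof.
move=> a0 p1 r1; rewrite /generic /disc !cov_scale !cov_mul r1 !scale1r.
rewrite crossZ !cov_rotate // cross_conj // scaler_eq0.
by rewrite mulf_eq0 (negbTE (expf_neq0 2 a0)) /= (conj_eq0 _ (unit_neq0 p1)).
Qed.

(* Averaging [h |-> sum_l R_l h (qu l)^-1] over the quaternion group projects
   onto the intertwiners; its trace is nonzero. *)
Lemma frame_exists (R0 R2 : H) : R0 0 0 = 0 -> R2 0 0 = 0 ->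
  dot R0 R0 = 1 -> dot R2 R2 = 1 -> dot R0 R2 = 0 ->
  exists p, [/\ dot p p = 1, frame p 0 = R0, frame p 1 = qmul R2 R0 & frame p 2 = R2].
Proof.
move=> r0 r2 n0 n2 n02.
have sq (A : H) : A 0 0 = 0 -> dot A A = 1 -> forall x, qmul A (qmul A x) = - x.
  move=> a0 n x; have AA : qmul A A = - qr 1.
    rewrite -n dotE a0; apply: quat_ext; rewrite !(mxE, qcoordE) a0; ring.
  by rewrite qmulA AA qmulNl qmul1l.
have anti : forall y, qmul R0 (qmul R2 y) = - qmul R2 (qmul R0 y).
  move=> y.
  rewrite !qmulA -qmulNl; congr qmul.
  move: n02; rewrite dotE r0 => n; apply: quat_ext; rewrite !(mxE, qcoordE) r0 r2; try ring.
  by move: n; rewrite mul0r add0r; lra.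
pose F h := h - qmul (qmul R0 h) qi - qmul (qmul (qmul R2 R0) h) qj - qmul (qmul R2 h) qk.
have F0 h : qmul R0 (F h) = qmul (F h) qi.
  rewrite /F !(qmulDr, qmulNr, qmulDl, qmulNl) -!qmulA.
  rewrite qsq mul_ji mul_ki !(sq _ r0 n0, anti, qmulNr, qmul1r, opprK).
  by apply/rowP => i; rewrite !mxE; ring.
have F2 h : qmul R2 (F h) = qmul (F h) qk.
  rewrite /F !(qmulDr, qmulNr, qmulDl, qmulNl) -!qmulA.
  rewrite qsq mul_ik mul_jk !(sq _ r2 n2, anti, qmulNr, qmul1r, opprK).
  by apply/rowP => i; rewrite !mxE; ring.
have [h Fh] : exists h, F h != 0.
  apply: contrapT => /forallNP h; have Fz k : F k = 0 by apply/eqP/negPn/negP; exact: h.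
  pose tr (f : H -> H) := dot (qr 1) (f (qr 1)) + dot qi (f qi) + dot qj (f qj) + dot qk (f qk).
  have trE (K q : H) : tr (fun h => qmul (qmul K h) q) = 4%:R * K 0 0 * q 0 0.
    by rewrite /tr !dotE !qcoordE; ring.
  have : tr F = 4%:R.
    have -> : tr F = tr id - tr (fun h => qmul (qmul R0 h) qi)
        - tr (fun h => qmul (qmul (qmul R2 R0) h) qj) - tr (fun h => qmul (qmul R2 h) qk).
      by rewrite /tr /F !(dotDr, dotNr); ring.
    by rewrite !trE !qcoordE !mulr0 !subr0 /tr !dot_units; ring.
  by rewrite /tr !Fz !dot0r !addr0 => /eqP; rewrite eq_sym pnatr_eq0.
have [s [p [s0 p1 e]]] := normalize Fh.
have conv A q : qmul A (F h) = qmul (F h) q -> qmul (qmul p q) (qconj p) = A.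
  rewrite e qmulZr qmulZl => /(scalerI (lt0r_neq0 s0)) <-.
  by rewrite -qmulA qmulCr p1 qmul1r.
exists p; split=> //; rewrite /frame ?quE.
- exact: conv.
- by apply: conv; rewrite -mul_ki -qmulA F0 qmulA F2 -qmulA.
- exact: conv.
Qed.

End Slice.

(** * The slice and the reduction to it *)

Section NormalForm.
Variable R : realType.
Notation H := 'rV[R]_4.
Notation bracket := 'Hom(H, 'Hom(H, H)).
Implicit Types (mu la : bracket) (x y p q r v : H) (z : 'I_3 -> H) (s : nat -> R).

(** When the first vector is 1, [cov z 0] is a multiple of i exactly if the other two have no
    i-part, and [cov z 1] is orthogonal to k exactly if the second vector has no j-part. Five
    parameters remain for z, and four for v. *)
Definition secz s (k : 'I_3) : H :=
  nth 0 [:: qr 1; quat (s 0%N) 0 0 (s 1%N); quat (s 2%N) 0 (- s 3%N) (s 4%N)] k.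
Definition secv s : H := quat (s 5%N) (s 6%N) (s 7%N) (s 8%N).
Definition section s : bracket := wbr (secz s) (secv s).
(* The sign of [s 3] is such that the covariants of [secz s] define the frame
   (i, j, k) in the chamber. *)
Definition chamber s := 0 < s 1%N /\ 0 < s 3%N.

(** Orthonormalizes the first two covariants: [disc] is orthogonal to both, and r2 r0 is the cross
    product that completes an oriented frame. *)
Definition nframe z (l : 'I_3) : H :=
  let r0 := (Num.sqrt (dot (cov z 0) (cov z 0)))^-1 *: cov z 0 in
  let r2 := (Num.sqrt (dot (disc z) (disc z)))^-1 *: disc z in
  nth 0 [:: r0; qmul r2 r0; r2] l.
Definition nrot z : 'I_3 -> H := rotate (nframe z) z.
(** Right division by [nrot z 0], which turns that vector into 1. *)
Definition nscale z q : H := (dot (nrot z 0) (nrot z 0))^-1 *: qmul q (qconj (nrot z 0)).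
Definition ncoord z v (i : nat) : R :=
  nth 0 [:: nscale z (nrot z 1) 0 0; nscale z (nrot z 1) 0 3;
    nscale z (nrot z 2) 0 0; - nscale z (nrot z 2) 0 2; nscale z (nrot z 2) 0 3;
    nscale z v 0 0; nscale z v 0 1; nscale z v 0 2; nscale z v 0 3] i.

Lemma dot_cross x y : x 0 0 = 0 -> dot x (cross x y) = 0.
Proof. by move=> x0; rewrite dotE /cross !quatE x0; ring. Qed.

Lemma unit_sqrt (x : H) : x != 0 ->
  let y := (Num.sqrt (dot x x))^-1 *: x in
  [/\ 0 < Num.sqrt (dot x x), dot y y = 1 & x = Num.sqrt (dot x x) *: y].
Proof.
move=> x0 y; have h := dot_gt0 x0; have s0 : 0 < Num.sqrt (dot x x) by rewrite sqrtr_gt0.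
split=> //; last by rewrite /y scalerA mulfV ?scale1r // gt_eqF.
by rewrite dotZl dotZr mulrA -invfM -expr2 sqr_sqrtr ?ltW // mulVf // gt_eqF.
Qed.

Lemma normal_form z v : generic z -> [/\ nrot z 0 != 0,
  orbit_rel (section (ncoord z v)) (wbr z v) & chamber (ncoord z v)].
Proof.
move=> gz; have A0 : cov z 0 != 0.
  apply: contra_neq gz => A0; rewrite /disc A0 /cross.
  by apply: quat_ext; rewrite quatE !mxE; ring.
have [a0 nA eA] := unit_sqrt A0; have [w0 nW eW] := unit_sqrt gz.
set al := Num.sqrt _ in a0 nA eA; set om := Num.sqrt _ in w0 nW eW.
set R0 := _ *: _ in nA eA; set R2 := _ *: _ in nW eW.
have R00 : R0 0 0 = 0 by rewrite mxE covE mulr0.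
have R20 : R2 0 0 = 0 by rewrite mxE quatE mulr0.
have R02 : dot R0 R2 = 0.
  by rewrite dotZl dotZr dot_cross ?covE // !mulr0.
have [p [p1 f0 f1 f2]] := frame_exists R00 R20 nA nW R02.
have fE : nframe z = frame p by apply/funext; elim/ord3P; rewrite ?f0 ?f1 ?f2.
have rE : nrot z = rotate (frame p) z by rewrite /nrot fE.
have conjf l : qmul (qmul (qconj p) (frame p l)) p = qu l.
  by rewrite /frame -!qmulA qmulCl p1 qmul1r qmulA qmulCl p1 qmul1l.
(* In the new frame the first covariant is a positive multiple of i, and the second lies in the
   plane of i and j with positive j-part, as on the section. *)
have N0 : cov (nrot z) 0 = al *: qi.
  by rewrite rE cov_rotate // eA qmulZr qmulZl -f0 conjf.
have NW : cross (cov (nrot z) 0) (cov (nrot z) 1) = om *: qk.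
  by rewrite rE !cov_rotate // cross_conj // -/(disc z) eW qmulZr qmulZl -f2 conjf.
have [N13 N12] : cov (nrot z) 1 0 3 = 0 /\ 0 < cov (nrot z) 1 0 2.
  move: NW; rewrite N0 /cross => /rowP NW; move: (NW 2) (NW 3).
  rewrite !(quatE, mxE, qcoordE) => e2 e3; split; first nra.
  rewrite -(pmulr_rgt0 _ a0); suff -> : al * cov (nrot z) 1 0 2 = om by [].
  by move: e3; rewrite !mulr0 !mulr1 mul0r subr0.
have n0 : nrot z 0 != 0.
  by apply/eqP => n0; move: N12; rewrite covE n0 dot0r ltxx.
have D0 := dot_gt0 n0; set D := dot _ _ in D0.
have n00 : nscale z (nrot z 0) = qr 1.
  by rewrite /nscale qmulCr qrZ mulVf ?gt_eqF.
have covn c : cov (fun l => nscale z (nrot z l)) c = D^-1 *: cov (nrot z) c.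
  rewrite /nscale cov_scale cov_mul dot_conj scalerA; congr (_ *: _).
  by rewrite expr2 -mulrA mulVf ?mulr1 ?gt_eqF.
have [/rowP E0 /rowP E1] := (covn 0, covn 1).
have Di : 0 < D^-1 by rewrite invr_gt0.
move: (E0 1) (E0 2) (E0 3) (E1 2) (E1 3).
rewrite !mxE N0 N13 mulr0; move: (cov (nrot z) 1 0 2) N12 => be be0.
have dbe : 0 < D^-1 * be by rewrite mulr_gt0.
have dal : 0 < D^-1 * al by rewrite mulr_gt0.
rewrite !covE !quE n00 !mxE !qcoordE !mulr1 !mulr0.
set m1 := nscale z (nrot z 1); set m2 := nscale z (nrot z 2).
rewrite !dotE !qcoordE => e1 e2 e3 e4 e5.
have m11 : m1 0 1 = 0 by lra.
have m12 : m1 0 2 = 0 by lra.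
have m21 : m2 0 1 = 0 by lra.
have m2b : - m2 0 2 = D^-1 * be by lra.
(* The i-part of the first covariant reads m1_3 (- m2_2) = D^-1 al > 0, and - m2_2 is already known
   to be positive. *)
have m1b : 0 < m1 0 3.
  rewrite -(pmulr_lgt0 _ dbe) -m2b (_ : _ * _ = D^-1 * al) // -e1 m11 m12 m21; ring.
split=> //; last by split; rewrite /ncoord /= ?m2b.
have -> : section (ncoord z v) = wbr (fun l => nscale z (nrot z l)) (nscale z v).
  rewrite /section; congr wbr; last by rewrite /secv /ncoord /= -quat_eta.
  apply/funext; elim/ord3P; rewrite ?n00 // /secz /ncoord /=.
    by rewrite [RHS]quat_eta m11 m12.
  by rewrite [RHS]quat_eta m21 opprK.
have [s [q [s0 q1 eq]]] := normalize n0.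
have sE x : nscale z x = (D^-1 * s) *: qmul x (qconj q).
  rewrite /nscale -/D eq -scalerA; congr (_ *: _).
  have -> : qconj (s *: q) = s *: qconj q by qring.
  by rewrite qmulZr.
(* Right division by [nrot z 0] = s q is right multiplication by the unit conj q, up to the scale
   D^-1 s. *)
apply/orbit_relP; exists (D^-1 * s), p, (qconj q).
rewrite dot_conj mulf_neq0 ?gt_eqF //; split=> //.
rewrite act_rotate // wbrZ; congr wbr; last exact: sE.
by apply/funext => l; rewrite sE rE.
Qed.

Lemma frame_real (a : R) l : a ^+ 2 = 1 -> frame (qr a) l = qu l.
Proof.
move=> a1; rewrite /frame (_ : qconj (qr a) = qr a); last by qring.
by rewrite qmulr qrmul scalerA -expr2 a1 scale1r.
Qed.

Lemma rotate_id z : rotate qu z = z.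
Proof.
apply/funext => l; rewrite /rotate sum3 !quE.
by elim/ord3P: l; rewrite !quE !dot_units !(scale1r, scale0r, addr0, add0r).
Qed.

Lemma cov_secz s : cov (secz s) 0 = (s 1%N * s 3%N) *: qi /\
  cov (secz s) 1 = quat 0 (- s 0%N * s 3%N) (s 3%N) 0.
Proof.
split; rewrite covU /secz /= ?quE; apply: quat_ext; rewrite ?dotE !(quatE, mxE, qcoordE);
  rewrite ?dotE ?(quatE, mxE, qcoordE); ring.
Qed.

(** Conjugation by p matches the covariants up to c^2 > 0. In the chamber the first one is a
    positive multiple of i on both sides, so p commutes with i; the second one has a positive j-part
    on both sides, so p is real. Then z_1 = 1 on both sides gives c r = 1. *)
Lemma section_unique s s' c p r : c != 0 -> dot p p = 1 -> dot r r = 1 ->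
  chamber s -> chamber s' -> section s' = c *: act (rm p, rm r) (section s) ->
  [/\ section s' = section s, exists2 a, a ^+ 2 = 1 & p = qr a & c *: r = qr 1].
Proof.
move=> c0 p1 r1 [s1 s3] [s1' s3'] e.
have c2 : 0 < c ^+ 2 by rewrite exprn_even_gt0.
move: (e); rewrite act_rotate // wbrZ => /(congr1 (fun m => (zc m, vc m))).
rewrite !wbr_coord => -[ez ev].
have ecov k : cov (secz s') k = c ^+ 2 *: qmul (qmul (qconj p) (cov (secz s) k)) p.
  by rewrite ez cov_scale cov_mul r1 scale1r cov_rotate.
have ecov' k : qmul p (cov (secz s') k) = c ^+ 2 *: qmul (cov (secz s) k) p.
  by rewrite ecov qmulZr !qmulA qmulCr p1 qmul1l.
have [A1 B1] := cov_secz s; have [A2 B2] := cov_secz s'.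
have := (ecov' 0, ecov' 1); rewrite A1 A2 B1 B2 => -[/rowP EA /rowP EB].
move: (EA 2) (EA 3) (EB 3); rewrite !(mxE, qcoordE, quatE) => a2 a3 b3.
set al := s 1%N * s 3%N in a2 a3; set al' := s' 1%N * s' 3%N in a2 a3.
have al0 : 0 < al by rewrite mulr_gt0.
have al0' : 0 < al' by rewrite mulr_gt0.
have t0 : 0 < al' + c ^+ 2 * al by rewrite addr_gt0 // mulr_gt0.
have p3 : p 0 3 = 0.
  apply: (mulfI (lt0r_neq0 t0)); rewrite mulr0; lra.
have p2 : p 0 2 = 0.
  apply: (mulfI (lt0r_neq0 t0)); rewrite mulr0; lra.
have u0 : 0 < s' 3%N + c ^+ 2 * s 3%N by rewrite addr_gt0 // mulr_gt0.
have p1' : p 0 1 = 0.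
  by apply: (mulfI (lt0r_neq0 u0)); rewrite mulr0; move: b3; rewrite p2 p3; lra.
have pr : p = qr (p 0 0) by rewrite {1}[p]quat_eta p1' p2 p3 /qr.
have pp : p 0 0 ^+ 2 = 1 by rewrite -p1 dotE p1' p2 p3; ring.
have fp : frame p = qu by rewrite pr; apply/funext => l; rewrite frame_real.
have cr : c *: r = qr 1.
  by have := congr1 (@^~ 0) ez; rewrite fp rotate_id /secz /= qmul1l => <-.
split=> //; last by exists (p 0 0).
rewrite {1}/section ez ev fp rotate_id; congr wbr.
  by apply/funext => l; rewrite -qmulZr cr qmul1r.
by rewrite -qmulZr cr qmul1r.
Qed.

End NormalForm.

(** * Continuity of the normal form *)

Section Continuity.
Variable R : realType.
Notation H := 'rV[R]_4.
Variables (T : topologicalType) (t : T).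
Implicit Types (f g : T -> R) (F G : T -> H).

Definition cont f := {for t, continuous f}.

Lemma continuous_at_sum (I : Type) (s : seq I) (V : normedModType R) (F : I -> T -> V) :
  (forall i, {for t, continuous (F i)}) ->
  {for t, continuous (fun x => \sum_(i <- s) F i x)}.
Proof.
move=> h; elim: s => [|i s IH].
  rewrite (_ : (fun _ => _) = fun=> 0); first exact: cvg_cst.
  by apply/funext => x; rewrite big_nil.
rewrite (_ : (fun _ => _) = F i \+ (fun x => \sum_(j <- s) F j x)).
  exact: continuousD.
by apply/funext => x; rewrite big_cons.
Qed.

Lemma cont_sum (I : Type) (s : seq I) (F : I -> T -> R) :
  (forall i, cont (F i)) -> cont (fun x => \sum_(i <- s) F i x).
Proof. exact: continuous_at_sum. Qed.

Lemma cont_cst (a : R) : cont (fun=> a). Proof. exact: cvg_cst. Qed.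

Lemma cont_row d (F : T -> 'rV[R]_d) :
  (forall j, cont (fun x => F x 0 j)) -> {for t, continuous F}.
Proof.
move=> h; rewrite (_ : F = fun x => \sum_j F x 0 j *: delta_mx 0 j).
  by apply: continuous_at_sum => j; apply: cvgZr_tmp; exact: h.
by apply/funext => x; exact: row_sum_delta.
Qed.

Lemma cont_ext f g : f =1 g -> cont f -> cont g.
Proof. by move=> /funext ->. Qed.

Definition contq F := forall i, cont (fun x => F x 0 i).

Lemma contq_cst q : contq (fun=> q). Proof. by move=> i; exact: cont_cst. Qed.

Lemma contq_scale f F : cont f -> contq F -> contq (fun x => f x *: F x).
Proof.
move=> hf hF i; apply: (cont_ext (f := f \* (fun x => F x 0 i))) => [x|].
  by rewrite mxE.
exact: (continuousM hf (hF i)).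
Qed.

Lemma contD f g : cont f -> cont g -> cont (fun x => f x + g x).
Proof. exact: continuousD. Qed.
Lemma contM f g : cont f -> cont g -> cont (fun x => f x * g x).
Proof. exact: continuousM. Qed.
Lemma contN f : cont f -> cont (fun x => - f x).
Proof. exact: continuousN. Qed.
Lemma contV f : f t != 0 -> cont f -> cont (fun x => (f x)^-1).
Proof. by move=> f0 hf; apply: continuousV. Qed.
Lemma cont_sqrt f : cont f -> cont (fun x => Num.sqrt (f x)).
Proof. by move=> hf; apply: continuous_comp => //; apply: sqrt_continuous. Qed.

Lemma contq_quat f0 f1 f2 f3 : cont f0 -> cont f1 -> cont f2 -> cont f3 ->
  contq (fun x => quat (f0 x) (f1 x) (f2 x) (f3 x)).
Proof.
move=> h0 h1 h2 h3; elim/ord4P; [move: h0|move: h1|move: h2|move: h3];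
  by apply: cont_ext => x; rewrite quatE.
Qed.

Ltac cont_poly := repeat match goal with
  | |- cont (fun x => @?f x + @?g x) => apply: (@contD f g)
  | |- cont (fun x => @?f x * @?g x) => apply: (@contM f g)
  | |- cont (fun x => - @?f x) => apply: (@contN f)
  end; done.

Lemma contq_mul F G : contq F -> contq G -> contq (fun x => qmul (F x) (G x)).
Proof. by move=> hF hG; rewrite /qmul; apply: contq_quat; cont_poly. Qed.

Lemma contq_conj F : contq F -> contq (fun x => qconj (F x)).
Proof. by move=> hF; rewrite /qconj; apply: contq_quat; cont_poly. Qed.

Lemma contq_cross F G : contq F -> contq G -> contq (fun x => cross (F x) (G x)).
Proof.
move=> hF hG; rewrite /cross; apply: contq_quat; first exact: cont_cst; cont_poly.
Qed.

Lemma cont_dot F G : contq F -> contq G -> cont (fun x => dot (F x) (G x)).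
Proof.
move=> hF hG; apply: (cont_ext (f := fun x => F x 0 0 * G x 0 0 + F x 0 1 * G x 0 1
  + F x 0 2 * G x 0 2 + F x 0 3 * G x 0 3)) => [x|]; first by rewrite dotE.
cont_poly.
Qed.

Section NormalFormCont.
Variables (Z : T -> 'I_3 -> H) (V : T -> H).
Hypotheses (hZ : forall k, contq (Z^~ k)) (hV : contq V).

Lemma contq_cov c : contq (fun x => cov (Z x) c).
Proof.
have h k l : cont (fun x => dot (qmul (qu c) (Z x k)) (Z x l)).
  by apply: cont_dot => //; apply: contq_mul => //; apply: contq_cst.
have := contq_quat (@cont_cst 0) (h 1 2) (h 2 0) (h 0 1).
by move=> hq i; move: (hq i); apply: cont_ext => x; rewrite covU.
Qed.

Lemma contq_disc : contq (fun x => disc (Z x)).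
Proof. by apply: contq_cross; apply: contq_cov. Qed.

Hypothesis g : generic (Z t).

Lemma generic_cov0 (z : 'I_3 -> H) : generic z -> cov z 0 != 0.
Proof.
apply: contra_neq => A0; rewrite /disc A0 /cross.
by apply: quat_ext; rewrite quatE !mxE; ring.
Qed.

Lemma contq_nframe l : contq (fun x => nframe (Z x) l).
Proof.
have unit F : contq F -> F t != 0 ->
    contq (fun x => (Num.sqrt (dot (F x) (F x)))^-1 *: F x).
  move=> hF F0; apply: contq_scale => //; apply: contV; last by apply/cont_sqrt/cont_dot.
  by rewrite gt_eqF // sqrtr_gt0 dot_gt0.
have h0 := unit _ (@contq_cov 0) (generic_cov0 g).
have h2 := unit _ (@contq_disc) g.
by elim/ord3P: l; rewrite /nframe /= //; apply: contq_mul.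
Qed.

Lemma contq_nrot l : contq (fun x => nrot (Z x) l).
Proof.
rewrite /nrot /rotate => i.
apply: (cont_ext (f := fun x => \sum_k (dot (nframe (Z x) l) (qu k) *: Z x k) 0 i)).
  by move=> x; rewrite summxE.
apply: cont_sum => k; apply: contq_scale => //.
by apply: cont_dot; [exact: contq_nframe|exact: contq_cst].
Qed.

Lemma contq_nscale F : contq F -> contq (fun x => nscale (Z x) (F x)).
Proof.
have [n0 _ _] := normal_form 0 g.
move=> hF; apply: contq_scale; last by apply: contq_mul => //; apply/contq_conj/contq_nrot.
apply: contV; first by rewrite gt_eqF // dot_gt0.
by apply: cont_dot; apply: contq_nrot.
Qed.

Lemma cont_ncoord i : cont (fun x => ncoord (Z x) (V x) i).
Proof.
rewrite /ncoord; do 9 (case: i => [|i] /=; first by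
  try apply: contN; apply: contq_nscale => //; exact: contq_nrot).
by case: i => [|i] /=; exact: cont_cst.
Qed.

End NormalFormCont.
End Continuity.

(** * Open subsets of a finite-dimensional space by way of linear forms *)

Section VectorTopology.
Variables (R : realType) (V : vectType R).
Notation m := (\dim {:V}).
Implicit Types (phi : V -> R) (u : 'rV[R]_m).

Definition vlin u : V := \sum_(i < m) u 0 i *: (vbasis {:V})`_i.

Lemma linform_sum phi (I : Type) (s : seq I) (F : I -> V) : linform phi ->
  phi (\sum_(i <- s) F i) = \sum_(i <- s) phi (F i).
Proof.
move=> [fD _ _ f0]; elim: s => [|i s IH]; first by rewrite !big_nil.
by rewrite !big_cons fD IH.
Qed.

Lemma vlin_coord v : vlin (\row_i coord (vbasis {:V}) i v) = v.
Proof.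
by rewrite /vlin [RHS](coord_vbasis (memvf v)); apply: eq_bigr => i _; rewrite mxE.
Qed.

Lemma cont_linform phi u : linform phi -> cont u (phi \o vlin).
Proof.
move=> lphi; have [_ fZ _ _] := lphi.
apply: (@cont_ext R _ u (fun w : 'rV[R]_m => \sum_(i < m) w 0 i * phi (vbasis {:V})`_i)) => [w|].
  by rewrite /= /vlin linform_sum //; apply: eq_bigr => i _; rewrite fZ.
apply: cont_sum => i; apply: contM; last exact: cont_cst.
exact: coord_continuous.
Qed.

Lemma vopen_neq (P : V -> R) : (forall u, {for u, continuous (P \o vlin)}) ->
  vopen [set v | P v != 0].
Proof.
move=> hP; apply: (@open_comp _ _ (P \o vlin) [set x | x != 0]) => [u _|].
  exact: hP.
exact: open_neq.
Qed.

(** Continuity is asked of [f] only where [P] does not vanish, because the normal form divides by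
    the norms of the covariants. *)
Lemma vopen_comp d (f : V -> 'rV[R]_d) (P : V -> R) (B : set 'rV[R]_d) :
  (forall u, {for u, continuous (P \o vlin)}) ->
  (forall u, P (vlin u) != 0 -> {for u, continuous (f \o vlin)}) ->
  open B -> vopen [set v | P v != 0 /\ B (f v)].
Proof.
move=> hP hf oB; rewrite /vopen openE => u /= [Pu Bu].
have h1 : \forall w \near u, P (vlin w) != 0.
  by apply: (hP u [set x | x != 0]); apply: open_nbhs_nbhs; split=> //; exact: open_neq.
have h2 : \forall w \near u, B (f (vlin w)).
  by apply: (hf u Pu B); apply: open_nbhs_nbhs; split.
by near=> w; split; near: w.
Unshelve. all: by end_near. Qed.

Lemma vopen_preimage (T : topologicalType) (g : T -> V) (A : set V) :
  (forall phi, linform phi -> continuous (phi \o g)) -> vopen A -> open (g @^-1` A).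
Proof.
move=> hg oA; pose c x : 'rV[R]_m := \row_i coord (vbasis {:V}) i (g x).
have -> : g @^-1` A = c @^-1` [set u | A (vlin u)].
  by apply/seteqP; split=> x /=; rewrite vlin_coord.
apply: open_comp => // x _; apply: cont_row => j.
apply: (cont_ext (f := fun y => coord (vbasis {:V}) j (g y))) => [y|].
  by rewrite mxE.
exact: (hg _ (@linform_coord _ _ _ _ j id _)).
Qed.

End VectorTopology.

(** * The topology of the quotient *)

Section Quotient.
Variable R : realType.
Notation H := 'rV[R]_4.
Notation bracket := 'Hom(H, 'Hom(H, H)).
Notation m := (\dim {:bracket}).
Implicit Types (mu la : bracket) (p r v : H) (z : 'I_3 -> H) (u : 'rV[R]_m).

Lemma linform_comp (V V' : vectType R) (phi : V' -> R) (f : V -> V') :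
  linform phi -> linear f -> linform (phi \o f).
Proof.
move=> [fD fZ _ _] lf; have [_ lD lZ _] := linear_lin lf.
by apply: linform_mk => [x y|a x] /=; rewrite ?lD ?lZ ?fD ?fZ.
Qed.

Lemma linform_entry i : linform (fun x : H => x 0 i).
Proof. by apply: linform_mk => [x y|a x]; rewrite mxE. Qed.

Lemma zc_linear k : linear (fun mu => zc mu k).
Proof.
move=> a mu la; rewrite /zc !add_lfunE !scale_lfunE.
by apply/rowP => i; rewrite !(add_lfunE, scale_lfunE, mxE); ring.
Qed.

Lemma vc_linear : linear (@vc R).
Proof.
move=> a mu la; rewrite /vc !add_lfunE !scale_lfunE.
by rewrite !(qmulDr, qmulZr); apply/rowP => i; rewrite !mxE; ring.
Qed.

Lemma contq_zc u k : contq u (fun w => zc (vlin w) k).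
Proof.
move=> i; apply: (@cont_linform _ _ (fun mu => zc mu k 0 i) u).
exact: (linform_comp (linform_entry i) (@zc_linear k)).
Qed.

Lemma contq_vc u : contq u (fun w => vc (vlin w)).
Proof.
move=> i; apply: (@cont_linform _ _ (fun mu => vc mu 0 i) u).
exact: (linform_comp (linform_entry i) vc_linear).
Qed.

Definition discr mu : R := dot (disc (zc mu)) (disc (zc mu)).

Lemma discr_generic mu : (discr mu != 0) = generic (zc mu).
Proof. by rewrite /discr dot_eq0. Qed.

Lemma cont_discr u : cont u (@discr \o @vlin _ _).
Proof.
by apply: cont_dot; apply: (@contq_disc _ _ _ (fun w => zc (vlin w))) => k; exact: contq_zc.
Qed.

Lemma linform_mx a b (f : 'M[R]_(a, b) -> R) M : linform f ->
  f M = \sum_i \sum_j M i j * f (delta_mx i j).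
Proof.
move=> lf; have [_ fZ _ _] := lf; rewrite [in LHS](matrix_sum_delta M) linform_sum //.
by apply: eq_bigr => i _; rewrite linform_sum //; apply: eq_bigr => j _; rewrite fZ.
Qed.

Lemma wmx_linear1 : linear (fun M => wmx (M, 0 : H)).
Proof.
move=> a M N; rewrite -wmx_linear; congr wmx; congr pair.
by rewrite /= scaler0 addr0.
Qed.

Lemma wmx_linear2 : linear (fun v : H => wmx (0, v)).
Proof.
move=> a M N; rewrite -wmx_linear; congr wmx; congr pair.
by rewrite /= scaler0 addr0.
Qed.

Lemma wbr_split z v : wbr z v = wmx (\matrix_k z k, 0) + wmx (0, v) :> bracket.
Proof.
rewrite -[X in X + _]scale1r -wmx_linear /wmx /=; congr wbr; last by rewrite scaler0 add0r.
by apply/funext => k; rewrite scale1r addr0 rowK.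
Qed.

Lemma cont_linform_wbr (T : topologicalType) (t : T) (Z : T -> 'I_3 -> H) (V : T -> H) phi :
  linform phi -> (forall k, contq t (Z^~ k)) -> contq t V ->
  cont t (fun x => phi (wbr (Z x) (V x))).
Proof.
move=> lphi hZ hV; have [fD _ _ _] := lphi.
have l1 := linform_comp lphi wmx_linear1; have l2 := linform_comp lphi wmx_linear2.
pose f1 := phi \o (fun M => wmx (M, 0 : H)); pose f2 := phi \o (fun v : H => wmx (0, v)).
rewrite -/f1 in l1; rewrite -/f2 in l2.
apply: (@cont_ext _ _ t (fun x => f1 (\matrix_k Z x k) + f2 (V x))) => [x|].
  by rewrite wbr_split fD.
move: f1 f2 l1 l2 => f1 f2 l1 l2; apply: contD.
  apply: (@cont_ext _ _ t (fun x => \sum_(k < 3) \sum_(j < 4) Z x k 0 j * f1 (delta_mx k j))).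
    move=> x; rewrite (linform_mx _ l1); apply: eq_bigr => k _.
    by apply: eq_bigr => j _; rewrite mxE.
  by apply: cont_sum => k; apply: cont_sum => j; apply: contM; [exact: hZ|exact: cont_cst].
apply: (@cont_ext _ _ t (fun x => \sum_(k < 1) \sum_(j < 4) V x k j * f2 (delta_mx k j))).
  by move=> x; rewrite -(linform_mx _ l2).
apply: cont_sum => k; apply: cont_sum => j; rewrite (ord1 k).
by apply: contM; [exact: hV|exact: cont_cst].
Qed.

(** * The chart on the generic part of the quotient *)

Section GenericQuotient.
Variables (S : set bracket) (d : nat).
Hypotheses (SW : S `<=` @Wh R) (SL : forall a mu la, S mu -> S la -> S (a *: mu + la)).
Hypothesis d59 : (4 < d < 10)%N.
(** Extension by zero, so that one section serves both d = 9 and d = 5; in the latter case the four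
    parameters of v vanish. *)
Definition co (s : 'rV[R]_d) (i : nat) : R := \sum_(j < d) s 0 j *+ (j == i :> nat).
Hypothesis Ssec : forall s, S (section (co s)).
Hypothesis Snc : forall mu, S mu -> forall i, (d <= i)%N -> ncoord (zc mu) (vc mu) i = 0.

Definition nf mu : 'rV[R]_d := \row_j ncoord (zc mu) (vc mu) j.
Definition gset : set bracket := [set mu | S mu /\ generic (zc mu)].
Definition Sigma : set 'rV[R]_d := [set s | chamber (co s)].
Notation orb mu := (line_orbit <[mu]>%VS).
Notation sec s := (section (co s)).

Lemma co_ord s (j : 'I_d) : co s j = s 0 j.
Proof.
rewrite /co (bigD1 j) //= eqxx mulr1n big1 ?addr0 // => i ij.
by rewrite -val_eqE in ij; rewrite (negbTE ij) mulr0n.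
Qed.

Lemma co_nf mu : S mu -> co (nf mu) = ncoord (zc mu) (vc mu).
Proof.
move=> Smu; apply/funext => i; have [id|id] := ltnP i d.
  by have := co_ord (nf mu) (Ordinal id); rewrite mxE.
rewrite Snc // /co big1 // => j _; rewrite (_ : (j == i :> nat) = false) ?mulr0n //.
by apply/eqP => ji; move: (ltn_ord j); rewrite ji ltnNge id.
Qed.

Lemma Wh_eta mu : S mu -> mu = wbr (zc mu) (vc mu).
Proof. by move=> /SW /Wh_wbr. Qed.

Lemma SZ c mu : S mu -> S (c *: mu).
Proof.
by move=> Smu; rewrite -[c](subrK 1) scalerDl scale1r; exact: SL.
Qed.

Lemma nf_orbit mu : gset mu -> Sigma (nf mu) /\ orbit_rel (sec (nf mu)) mu.
Proof.
move=> [Smu gmu]; have [_ o c] := normal_form (vc mu) gmu.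
by rewrite /Sigma /= co_nf //; split=> //; rewrite [X in orbit_rel _ X]Wh_eta.
Qed.

Lemma sec_inj s s' : sec s = sec s' -> s = s'.
Proof.
move=> e; have := congr1 (fun m => (zc m, vc m)) e; rewrite !wbr_coord => -[ez ev].
have e1 := congr1 (@^~ 1) ez; have e2 := congr1 (@^~ 2) ez.
have E (q q' : H) : q = q' -> [/\ q 0 0 = q' 0 0, q 0 1 = q' 0 1, q 0 2 = q' 0 2 & q 0 3 = q' 0 3].
  by move=> ->.
move: (E _ _ e1) (E _ _ e2) (E _ _ ev); rewrite /secz /secv /= !quatE.
move=> [c0 _ _ c1] [c2 _ /oppr_inj c3 c4] [c5 c6 c7 c8].
have cE i : (i < 9)%N -> co s i = co s' i by do 9 (case: i => [//|i]).
apply/rowP => j; rewrite -!co_ord; apply: cE.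
by apply: leq_trans (ltn_ord j) _; case/andP: d59.
Qed.

Lemma sec_orbit_inj s s' : Sigma s -> Sigma s' -> orbit_rel (sec s') (sec s) -> s = s'.
Proof.
move=> hs hs' /orbit_relP[c [p [r [c0 p1 r1 e]]]]; apply: sec_inj.
by have [-> _ _] := section_unique c0 p1 r1 hs hs' e.
Qed.

Lemma gset_orbit mu la : S mu -> gset la -> orbit_rel mu la -> gset mu.
Proof.
move=> Smu [Sla gla] /orbit_relP[c [p [r [c0 p1 r1 e]]]]; split=> //.
by rewrite e [in act _ la](Wh_eta Sla) act_rotate // wbrZ !wbr_coord generic_act.
Qed.

Lemma sec_gset s : Sigma s -> gset (sec s).
Proof.
move=> [s1 s3]; split=> //; rewrite wbr_coord /generic /disc.
have [-> ->] := cov_secz (co s); apply/eqP => /rowP/(_ 3); rewrite /cross !(quatE, mxE, qcoordE).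
move=> e; have : co s 1%N * co s 3%N * co s 3%N == 0 by apply/eqP; rewrite -[RHS]e; ring.
by rewrite !mulf_eq0 (gt_eqF s1) (gt_eqF s3).
Qed.

Lemma gset_neq0 mu : gset mu -> mu != 0.
Proof.
move=> [_ g]; apply/eqP => mu0; move/eqP: (generic_cov0 g); apply.
have z0 k : zc mu k = 0 by have [e _ _ _] := linear_lin (@zc_linear k); rewrite mu0 e.
by rewrite covU !z0 !dot0r; apply: quat_ext; rewrite quatE mxE.
Qed.

Lemma gset_relopen : relopen S gset.
Proof.
exists [set mu | discr mu != 0]; first by apply: vopen_neq => u; exact: cont_discr.
by apply/seteqP; split=> mu /= [Smu]; rewrite discr_generic.
Qed.

Lemma nf_preimage (B : set 'rV[R]_d) : open B ->
  relopen S [set mu | gset mu /\ B (nf mu)].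
Proof.
move=> oB; exists [set mu | discr mu != 0 /\ B (nf mu)].
  apply: vopen_comp oB => [u|u]; first exact: cont_discr.
  rewrite discr_generic => g; apply: cont_row => j.
  apply: (@cont_ext _ _ u (fun w => ncoord (zc (vlin w)) (vc (vlin w)) j)) => [w|].
    by rewrite /= mxE.
  by apply: (cont_ncoord (Z := fun w => zc (vlin w))) => // [k|]; [exact: contq_zc|exact: contq_vc].
apply/seteqP; split=> mu /=; rewrite discr_generic; first by move=> [[]].
by move=> [? []].
Qed.

Lemma cont_co i : continuous (fun s => co s i).
Proof.
move=> s; apply: (@cont_sum _ _ s) => j; case: (_ == i).
  apply: (@cont_ext _ _ s (fun s : 'rV[R]_d => s 0 j)) => [s'|]; first by rewrite mulr1n.
  exact: coord_continuous.
by apply: (@cont_ext _ _ s (fun s : 'rV[R]_d => 0)) => [s'|]; [rewrite mulr0n|exact: cont_cst].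
Qed.

Lemma Sigma_open : open Sigma.
Proof.
have h i : open [set s : 'rV[R]_d | 0 < co s i].
  apply: (@open_comp _ _ (fun s => co s i) [set x | 0 < x]); last exact: open_gt.
  by move=> s _; apply: cont_co.
exact: (openI (h 1%N) (h 3%N)).
Qed.

Lemma sec_preimage (O : set bracket) : vopen O -> open [set s | O (sec s)].
Proof.
apply: vopen_preimage => phi lphi s.
apply: (@cont_linform_wbr _ s (fun s => secz (co s)) (fun s => secv (co s)) phi lphi) => [k|].
  by elim/ord3P: k; rewrite /secz /=; [exact: contq_cst|apply: contq_quat|apply: contq_quat];
    try exact: cont_cst; try apply: contN; exact: cont_co.
by apply: contq_quat; exact: cont_co.
Qed.

(** The distinct numbers e / (k + 2) with k < [size P] are too many to be all roots of [P]. *)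
Lemma poly_avoid (P : {poly R}) (e : R) : P != 0 -> 0 < e ->
  exists t, [/\ 0 < t, t < e & P.[t] != 0].
Proof.
move=> P0 e0; pose rs := [seq e / (k.+2)%:R | k <- iota 0 (size P)].
have kp k : 0 < (k.+2)%:R :> R by rewrite ltr0n.
have : ~~ all (root P) rs.
  apply/negP => /(max_poly_roots P0) h; have : uniq rs.
    rewrite map_inj_uniq ?iota_uniq // => k l /(mulfI (lt0r_neq0 e0)) /invr_inj /eqP.
    by rewrite eqr_nat => /eqP [].
  by move/h; rewrite size_map size_iota ltnn.
move=> /allPn[_ /mapP[k _ ->] hr]; exists (e / (k.+2)%:R); split=> //.
- by rewrite divr_gt0.
- by rewrite ltr_pdivrMr // ltr_pMr // ltr1n.
Qed.

Lemma cov_poly mu nu c (l : 'I_4) : exists P : {poly R},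
  forall t, cov (zc (t *: nu + mu)) c 0 l = P.[t].
Proof.
have zcL k t : zc (t *: nu + mu) k = t *: zc nu k + zc mu k by exact: zc_linear.
have h k k' : exists P : {poly R}, forall t,
    dot (qmul (qu c) (zc (t *: nu + mu) k)) (zc (t *: nu + mu) k') = P.[t].
  exists ((dot (qmul (qu c) (zc nu k)) (zc nu k'))%:P * 'X^2 +
    (dot (qmul (qu c) (zc nu k)) (zc mu k') + dot (qmul (qu c) (zc mu k)) (zc nu k'))%:P * 'X
    + (dot (qmul (qu c) (zc mu k)) (zc mu k'))%:P) => t.
  rewrite !hornerE !zcL; move: (zc nu k) (zc nu k') (zc mu k) (zc mu k') => a1 a2 b1 b2.
  rewrite !(qmulDr, qmulZr) !(dotDl, dotDr, dotZl, dotZr). rewrite /=; ring.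
elim/ord4P: l.
- by exists 0 => t; rewrite covE horner0.
- by have [P hP] := h 1 2; exists P => t; rewrite covE hP.
- by have [P hP] := h 2 0; exists P => t; rewrite covE hP.
- by have [P hP] := h 0 1; exists P => t; rewrite covE hP.
Qed.

Lemma disc3 z : disc z 0 3 = cov z 0 0 1 * cov z 1 0 2 - cov z 0 0 2 * cov z 1 0 1.
Proof. exact: quat3. Qed.

(** On the line from [mu0] to the section point with all parameters 1, the last coordinate of [disc]
    is a polynomial in t that is nonzero at t = 1, hence nonzero at arbitrarily small t > 0. *)
Lemma gset_dense A : relopen S A -> A !=set0 -> exists2 mu, A mu & gset mu.
Proof.
move=> [U oU ->] [mu0 [Smu0 Omu0]].
pose s1 : 'rV[R]_d := const_mx 1.
have co1 i : (i < d)%N -> co s1 i = 1.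
  by move=> id; have := co_ord s1 (Ordinal id); rewrite mxE.
have [d4 _] := andP d59.
have Ss1 : Sigma s1 by split; rewrite co1 ?ltr01 // (leq_trans _ d4).
pose nu := sec s1 - mu0.
have [P01 h01] := cov_poly mu0 nu 0 1; have [P02 h02] := cov_poly mu0 nu 0 2.
have [P11 h11] := cov_poly mu0 nu 1 1; have [P12 h12] := cov_poly mu0 nu 1 2.
pose P := P01 * P12 - P02 * P11.
have hP t : P.[t] = disc (zc (t *: nu + mu0)) 0 3.
  rewrite disc3 (h01 t) (h02 t) (h11 t) (h12 t) /P.
  by rewrite hornerD hornerN !hornerM.
have P0 : P != 0.
  apply/eqP => P0; have := hP 1; rewrite P0 horner0 scale1r subrK wbr_coord.
  rewrite /disc; have [-> ->] := cov_secz (co s1); rewrite /cross !(quatE, mxE, qcoordE).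
  rewrite !co1 ?(leq_trans _ d4) // => /eqP; rewrite eq_sym (_ : _ - _ = 1) ?oner_eq0 //.
  by ring.
have : open [set t : R | U (t *: nu + mu0)].
  apply: (@vopen_preimage _ _ _ (fun t : R => t *: nu + mu0)) oU => phi [fD fZ _ _] t.
  apply: (@cont_ext _ _ t (fun t => t * phi nu + phi mu0)) => [t'|].
    by rewrite -fZ -fD.
  by apply: contD; [apply: contM; [exact: cvg_id|]|]; exact: cont_cst.
rewrite openE => /(_ 0); rewrite /= scale0r add0r => /(_ Omu0) /nbhs_ballP[e /= e0 he].
have [t [t0 te Pt]] := poly_avoid P0 e0.
exists (t *: nu + mu0).
  split; first by apply: SL => //; rewrite /nu addrC -scaleN1r; exact: SL.
  by apply: he; rewrite /ball /= sub0r normrN gtr0_norm.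
split; first by apply: SL => //; rewrite /nu addrC -scaleN1r; exact: SL.
by apply: contraNneq Pt => d0; rewrite hP d0 mxE.
Qed.

Notation T := (set {vspace bracket}).

Lemma line_S mu : mu != 0 -> S mu -> lines S <[mu]>%VS.
Proof. by move=> mu0 Smu; apply/(linesP SZ); exists mu. Qed.

Lemma lines_mem mu : lines S <[mu]>%VS -> S mu.
Proof. by move=> [_]; apply; exact: memv_line. Qed.

(** The default 0 is taken only off [gquot], the domain of the chart. *)
Definition sec_coord (q : T) : 'rV[R]_d := xget 0 [set s | Sigma s /\ q = orb (sec s)].

Lemma orb_nf mu : gset mu -> orb mu = orb (sec (nf mu)).
Proof.
move=> gm; have [_ o] := nf_orbit gm.
by apply/line_orbit_eq; [exact: gset_neq0|exact: orbit_rel_sym].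
Qed.

Lemma sec_coordE mu : gset mu -> sec_coord (orb mu) = nf mu.
Proof.
move=> gm; have [hs o] := nf_orbit gm; apply: xget_unique.
  by split=> //; exact: orb_nf.
move=> s [hs' e]; apply: sec_orbit_inj => //.
apply/line_orbit_eq; first by apply/gset_neq0/sec_gset.
by rewrite -e (orb_nf gm).
Qed.

Definition gquot : set T := [set q | exists2 mu, gset mu & q = orb mu].

Definition lift (A : set T) : set bracket :=
  [set mu | mu != 0 /\ (lines S <[mu]>%VS /\ A (orb mu))].

Lemma qopenE A : qopen S A <-> A `<=` quotient S /\ relopen S (lift A).
Proof.
split=> [[h [_ o]]|[h o]]; split=> //; split=> //.
by move=> L [].
Qed.

Lemma lift_gquot A mu : A `<=` gquot -> lift A mu -> gset mu.
Proof.
move=> AG [mu0 [lm /AG [la gla e]]].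
apply: gset_orbit gla _; first exact: lines_mem.
exact/line_orbit_eq.
Qed.

(** Openness passes to R^d by preimage under the section, and back by preimage under the normal
    form, both of which are continuous. *)
Lemma gquot_open A : A `<=` gquot -> qopen S A <-> open (sec_coord @` A).
Proof.
move=> AG; have Aq : A `<=` quotient S.
  move=> q /AG [mu gm ->]; exists <[mu]>%VS => //.
  by apply: line_S; [exact: gset_neq0|case: gm].
rewrite qopenE; split=> [[_ [U oU e]]|oA].
  have -> : sec_coord @` A = Sigma `&` [set s | U (sec s)].
    apply/seteqP; split=> [_ [q Aq' <-]|s [hs Os]].
      have [mu gm eq] := AG _ Aq'; have [hs _] := nf_orbit gm.
      rewrite eq sec_coordE //; split=> //=.
      suff : lift A (sec (nf mu)) by rewrite e => -[].
      have gs := sec_gset hs; split; first exact: gset_neq0.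
      split; first by apply: line_S; [exact: gset_neq0|exact: Ssec].
      by rewrite -orb_nf // -eq.
    have gs := sec_gset hs.
    have : lift A (sec s) by rewrite e; split=> //; exact: Ssec.
    move=> [_ [_ Aor]]; exists (orb (sec s)) => //; rewrite sec_coordE //.
    by have [hn o] := nf_orbit gs; apply: (sec_orbit_inj hn hs (orbit_rel_sym o)).
  by apply: openI; [exact: Sigma_open|exact: sec_preimage].
split=> //; suff -> : lift A = [set mu | gset mu /\ (sec_coord @` A) (nf mu)].
  exact: nf_preimage.
apply/seteqP; split=> mu.
  move=> h; have gm := lift_gquot AG h; split=> //.
  by have [_ [_ Ao]] := h; exists (orb mu) => //; exact: sec_coordE.
move=> [gm [q Aq' e]]; have [la gla eq] := AG _ Aq'.
have mu0 := gset_neq0 gm; split=> //; split; first by apply: line_S => //; case: gm.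
rewrite (orb_nf gm) -e eq (sec_coordE gla) -(orb_nf gla) -eq //.
Qed.

Theorem generic_top_dim : top_dim R (qopen S) d.
Proof.
move=> A /qopenE[Aq oA] [q Aq'].
have [L lL eL] := Aq _ Aq'; have [mu [mu0 Smu e]] := (linesP SZ L).1 lL.
have [|nu [nu0 [lnu Anu]] gnu] := gset_dense oA.
  by exists mu; split=> //; rewrite -e; split=> //; rewrite eL.
exists (orb nu) => //; exists gquot, sec_coord; split.
- apply/qopenE; split.
    move=> _ [ka gka ->]; exists <[ka]>%VS => //.
    by apply: line_S; [exact: gset_neq0|case: gka].
  suff -> : lift gquot = gset by exact: gset_relopen.
  apply/seteqP; split=> ka; first exact: lift_gquot.
  move=> gka; split; first exact: gset_neq0.
  by split; [apply: line_S; [exact: gset_neq0|case: gka]|exists ka].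
- by exists nu.
- move=> x y /set_mem[ka gka ->] /set_mem[la gla ->].
  by rewrite !sec_coordE // => e'; rewrite (orb_nf gka) (orb_nf gla) e'.
- exact: gquot_open.
Qed.

(** After conjugation by an element that moves mu into the section, [section_unique] applies to a
    point and itself. The group elements obtained are real, so undoing the conjugation does not
    change them. *)
Lemma isotropy_gset mu : gset mu -> isotropy <[mu]>%VS `<=`
  [set phi | exists a c : R, [/\ a ^+ 2 = 1, c ^+ 2 = 1 & phi = (rm (qr a), rm (qr c))]].
Proof.
move=> gm phi [/Sp1Sp1P[p [r [p1 r1 ->]]] /maps_lineP].
move=> /(line_eq (gset_neq0 gm)) [c c0 emu].
have [hs /orbit_relP[c1 [p0 [r0 [c10 p01 r01 es]]]]] := nf_orbit gm.
set sg := sec (nf mu) in es.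
have emu' : mu = c1^-1 *: act (rm (qconj p0), rm (qconj r0)) sg.
  by rewrite es actZ act_inv // scalerA mulVf // scale1r.
pose pp := qmul (qmul (qconj p0) p) p0; pose rr := qmul (qmul (qconj r0) r) r0.
have pp1 : dot pp pp = 1 by rewrite !dot_qmulr dot_conj p1 p01 !mulr1.
have rr1 : dot rr rr = 1 by rewrite !dot_qmulr dot_conj r1 r01 !mulr1.
have esg : sg = c *: act (rm pp, rm rr) sg.
  transitivity (c1 *: act (rm p0, rm r0)
      (c *: act (rm p, rm r) (c1^-1 *: act (rm (qconj p0), rm (qconj r0)) sg))).
    by rewrite -emu' -emu.
  rewrite !actZ !act_comp ?dot_conj ?dot_qmulr ?dot_conj ?p1 ?p01 ?mulr1 //.
  by rewrite !scalerA !qmulA mulrAC mulfV // mul1r.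
have [_ [a a1 ea] er] := section_unique c0 pp1 rr1 hs hs esg.
have back (x y : H) : dot y y = 1 -> qmul (qmul y (qmul (qmul (qconj y) x) y)) (qconj y) = x.
  by move=> y1; rewrite -!qmulA qmulCr y1 qmul1r qmulA qmulCr y1 qmul1l.
have conjr (x : H) b : dot x x = 1 -> qmul (qmul x (qr b)) (qconj x) = qr b :> H.
  by move=> x1; rewrite qmulr qmulZl qmulCr x1 qrZ mulr1.
have ep : p = qr a by rewrite -(back p p0 p01) -/pp ea conjr.
have err : rr = qr c^-1.
  by rewrite -[rr]scale1r -(mulVf c0) -scalerA er qrZ mulr1.
have erc : r = qr c^-1 by rewrite -(back r r0 r01) -/rr err conjr.
exists a, c^-1; rewrite ep erc; split=> //.
by move: r1; rewrite erc dotE !qrE !mulr0 !addr0 -expr2.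
Qed.

Theorem generic_isotropy : generic_isotropy_finite S.
Proof.
exists gset; split; first exact: gset_relopen.
  move=> mu gm; split; first exact: gset_neq0.
  apply: sub_finite_set (isotropy_gset gm) _.
  pose f (a c : R) := (rm (qr a) : 'End(H), rm (qr c) : 'End(H)).
  apply: (@sub_finite_set _ _ [set f 1 1; f 1 (- 1); f (- 1) 1; f (- 1) (- 1)]); last first.
    by rewrite !finite_setU; do !split; exact: finite_set1.
  have sq1 (a : R) : a ^+ 2 = 1 -> a = 1 \/ a = - 1.
    by move=> /eqP; rewrite sqrf_eq1 => /orP[] /eqP; [left|right].
  move=> _ [a [c [/sq1 a1 /sq1 c1 ->]]] /=; rewrite -/(f a c).
  by case: a1 => ->; case: c1 => ->; [left; left; left|left; left; right|left; right|right].
move=> A oA A0; have [mu Amu gm] := gset_dense oA A0; by exists mu.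
Qed.

End GenericQuotient.

Lemma ncoord_big z v i : (8 < i)%N -> ncoord z v i = 0.
Proof. by move=> hi; rewrite /ncoord nth_default. Qed.

Theorem Wh_top_dim : top_dim R (qopen (@Wh R)) 9 /\ generic_isotropy_finite (@Wh R).
Proof.
have WL a mu la : Wh mu -> Wh la -> Wh (a *: mu + la).
  by move=> /WhP[z [v ->]] /WhP[z' [v' ->]]; rewrite wbrL; exact: wbr_Wh.
have sec (s : 'rV[R]_9) : Wh (section (co s)) by exact: wbr_Wh.
have nc mu : Wh mu -> forall i, (9 <= i)%N -> ncoord (zc mu) (vc mu) i = 0.
  by move=> _; exact: ncoord_big.
split; [exact: (generic_top_dim (d := 9))|exact: (generic_isotropy (d := 9))].
Qed.

Theorem Wah_top_dim : top_dim R (qopen (@Wah R)) 5 /\ generic_isotropy_finite (@Wah R).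
Proof.
have WW : @Wah R `<=` @Wh R by move=> mu [].
have WL a mu la : Wah mu -> Wah la -> Wah (a *: mu + la).
  move=> /Wah_wbr[z ->] /Wah_wbr[z' ->]; rewrite wbrL scaler0 addr0.
  by apply/Wah_wbr; exists (fun k => a *: z k + z' k).
have sec (s : 'rV[R]_5) : Wah (section (co s)).
  apply/Wah_wbr; exists (secz (co s)); congr wbr.
  have h i : (4 < i)%N -> co s i = 0.
    move=> hi; rewrite /co big1 // => j _; rewrite (_ : (j == i :> nat) = false) ?mulr0n //.
    by apply/eqP => e; move: (ltn_ord j); rewrite e ltnNge hi.
  by rewrite /secv !h //; apply: quat_ext; rewrite quatE mxE.
have nc mu : Wah mu -> forall i, (5 <= i)%N -> ncoord (zc mu) (vc mu) i = 0.
  move=> /Wah_wbr[z ->] i hi; rewrite !wbr_coord.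
  have n0 : nscale z 0 = 0 by rewrite /nscale qmul0l scaler0.
  have [i9|/ncoord_big -> //] := leqP i 8.
  move: hi i9; do 5 (case: i => [//|i]); rewrite /ncoord n0 !mxE /=.
  by do 4 (case: i => [//|i]).
split; [exact: (generic_top_dim (d := 5))|exact: (generic_isotropy (d := 5))].
Qed.

End Quotient.

(** * Invariance of the curvature *)

Section RieszTrace.
Variables (R : realType) (n : lie_data R).
Notation b := (vbasis {:n}).
Implicit Types (g : n -> n -> R) (x y z : n) (T : n -> n).

Section Inner.
Variable g : n -> n -> R.
Hypothesis ig : inner_product g.

Lemma ipC x y : g x y = g y x. Proof. by have [_ ->] := ig. Qed.
Lemma ip_linform_l z : linform (g^~ z).
Proof.
have [gl _ _] := ig; apply: linform_mk => [x y|a x].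
  by have := gl 1 x y z; rewrite scale1r mul1r.
by have := gl a x 0 z; have := gl (-1) 0 0 z; rewrite scaler0 !addr0 => h ->; lra.
Qed.
Lemma ip_linform_r x : linform (g x).
Proof.
have [fD fZ _ _] := ip_linform_l x.
by apply: linform_mk => [y z|a y]; rewrite !(ipC x) ?fD ?fZ.
Qed.

Lemma ip_inj x y : (forall z, g x z = g y z) -> x = y.
Proof.
move=> h; apply/eqP; rewrite -subr_eq0; apply/negPn/negP => n0.
have [_ _ /(_ _ n0)] := ig; have [fD _ fN _] := ip_linform_l (x - y).
by rewrite fD fN h subrr ltxx.
Qed.

Lemma riesz_spec f z : linform f -> g (riesz g f) z = f z.
Proof.
move=> lf; set G := \matrix_(i < \dim {:n}, j < \dim {:n}) g b`_i b`_j.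
(* A kernel vector of the Gram matrix consists of the coordinates of an x that is orthogonal to
   everything. *)
have Gu : G \in unitmx.
  rewrite -row_free_unit -kermx_eq0; apply/rowV0P => u /sub_kermxP uG.
  pose x := \sum_i u 0 i *: b`_i.
  have x0 : x = 0.
    apply: ip_inj => y; have [_ _ _ ->] := ip_linform_l y.
    rewrite (coord_vbasis (memvf y)) (linform_sum _ _ (ip_linform_r x)).
    apply: big1 => j _; have [_ -> _ _] := ip_linform_r x.
    rewrite (linform_sum _ _ (ip_linform_l _)).
    have /rowP/(_ j) := uG; rewrite !mxE => e; apply/eqP; rewrite mulf_eq0; apply/orP; right.
    apply/eqP; rewrite -[RHS]e; apply: eq_bigr => i _; have [_ -> _ _] := ip_linform_l b`_j.
    by rewrite mxE.
  apply/rowP => i; rewrite mxE.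
  have /freeP/(_ (fun i => u 0 i) x0 i) := basis_free (vbasisP {:n}).
  exact.
rewrite (coord_vbasis (memvf z)) (linform_sum _ _ (ip_linform_r _)) (linform_sum _ _ lf).
apply: eq_bigr => k _; have [_ -> _ _] := lf; have [_ -> _ _] := ip_linform_r (riesz g f).
congr (_ * _); rewrite /riesz (linform_sum _ _ (ip_linform_l _)) -/G.
under eq_bigr => i _.
  have [_ -> _ _] := ip_linform_l b`_k; rewrite mulr_suml.
  over.
rewrite exchange_big /=.
under eq_bigr => j _.
  under eq_bigr => i _ do rewrite -mulrA.
  rewrite -mulr_sumr.
  rewrite (_ : \sum_i _ = (invmx G *m G) j k); last first.
    by rewrite mxE; apply: eq_bigr => i _; congr (_ * _); rewrite mxE.
  rewrite mulVmx // mxE.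
  over.
by rewrite (bigD1 k) //= eqxx mulr1 big1 ?addr0 // => j /negbTE ->; rewrite mulr0.
Qed.

End Inner.

(** Frees the trace from the basis [vbasis]: it will be computed in an orthonormal basis, and in a
    basis carried over by an isomorphism. *)
Lemma trace_frame (I : finType) (e : I -> n) (eps : I -> n -> R) T : linear T ->
  (forall i, linform (eps i)) -> (forall x, x = \sum_i eps i x *: e i) ->
  trace T = \sum_i eps i (T (e i)).
Proof.
move=> lT le h; have [T0 TD TZ _] := linear_lin lT.
have lc k : linform (coord b k) by exact: (@linform_coord _ _ _ b k id).
have Tsum (J : finType) (F : J -> n) : T (\sum_j F j) = \sum_j T (F j).
  by elim/big_rec2: _ => // j x y _ <-; rewrite TD.
transitivity (\sum_(k < \dim {:n}) \sum_i eps i (T b`_k) * coord b k (e i)).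
  apply: eq_bigr => k _; rewrite {1}[T b`_k]h (linform_sum _ _ (lc k)).
  by apply: eq_bigr => i _; have [_ -> _ _] := lc k.
rewrite exchange_big /=; apply: eq_bigr => i _.
rewrite {2}[e i](coord_vbasis (memvf _)) Tsum (linform_sum _ _ (le i)).
by apply: eq_bigr => k _; rewrite TZ; have [_ -> _ _] := le i; rewrite mulrC.
Qed.

Section Curvature.
Variable g : n -> n -> R.
Hypotheses (ig : inner_product g) (lieP : lie_algebra n).
Notation br := (@lie_br R n).
Notation LC := (levi_civita g).

Let brE := (brDl lieP, brZl lieP, brDr lieP, brZr lieP).
Let gD z : forall x y, g (x + y) z = g x z + g y z.
Proof. by have [] := ip_linform_l ig z. Qed.
Let gZ z : forall a x, g (a *: x) z = a * g x z.
Proof. by have [] := ip_linform_l ig z. Qed.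
Let gDr z : forall x y, g z (x + y) = g z x + g z y.
Proof. by have [] := ip_linform_r ig z. Qed.
Let gZr z : forall a x, g z (a *: x) = a * g z x.
Proof. by have [] := ip_linform_r ig z. Qed.

Lemma levi_civitaE x y z :
  g (LC x y) z = (g (br x y) z - g (br y z) x + g (br z x) y) / 2%:R.
Proof.
rewrite /levi_civita riesz_spec //; apply: linform_mk => [u v|a u].
  by rewrite !(brE, gD, gDr); field.
by rewrite !(brE, gZ, gZr); field.
Qed.

Lemma lc_linear_r x : linear (LC x).
Proof.
move=> a y z; apply: (ip_inj ig) => w; rewrite gD gZ !levi_civitaE.
by rewrite !(brE, gD, gZ, gDr, gZr); field.
Qed.

Lemma lc_linear_l y : linear (LC^~ y).
Proof.
move=> a x z; apply: (ip_inj ig) => w; rewrite gD gZ !levi_civitaE.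
by rewrite !(brE, gD, gZ, gDr, gZr); field.
Qed.

Lemma curv_linear1 y z : linear (fun x => curvature g x y z).
Proof.
move=> a u v; have [_ rD rZ _] := linear_lin (lc_linear_r y).
rewrite /curvature !(lc_linear_l _ a u v) rD rZ (brDl lieP) (brZl lieP).
rewrite (lc_linear_l z a).
by apply: linform_ext => phi [fD fZ fN _]; rewrite !(fD, fZ, fN); ring.
Qed.

Lemma curv_linear2 x z : linear (fun y => curvature g x y z).
Proof.
move=> a u v; have [_ rD rZ _] := linear_lin (lc_linear_r x).
rewrite /curvature !(lc_linear_l _ a u v) rD rZ (brDr lieP) (brZr lieP).
rewrite (lc_linear_l z a).
by apply: linform_ext => phi [fD fZ fN _]; rewrite !(fD, fZ, fN); ring.
Qed.

Lemma curv_linear3 x y : linear (curvature g x y).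
Proof.
move=> a u v; rewrite /curvature !(lc_linear_r _ a).
by apply: linform_ext => phi [fD fZ fN _]; rewrite !(fD, fZ, fN); ring.
Qed.

Lemma trace_lin a (T1 T2 T3 : n -> n) : (forall x, T1 x = a *: T2 x + T3 x) ->
  trace T1 = a * trace T2 + trace T3.
Proof.
move=> h; rewrite /trace mulr_sumr -big_split; apply: eq_bigr => i _ /=.
by rewrite h linearP.
Qed.

Lemma ricci_linear_r a x y z :
  ricci_form g x (a *: y + z) = a * ricci_form g x y + ricci_form g x z.
Proof. by apply: trace_lin => u; exact: curv_linear3. Qed.

Lemma ricci_linear_l a x y z :
  ricci_form g (a *: x + y) z = a * ricci_form g x z + ricci_form g y z.
Proof. by apply: trace_lin => u; exact: curv_linear2. Qed.

Lemma RicE x y : g (Ric g x) y = ricci_form g x y.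
Proof.
rewrite /Ric riesz_spec //; apply: linform_mk => [u v|a u].
  by have := ricci_linear_r 1 x u v; rewrite scale1r mul1r.
have := ricci_linear_r a x u 0; have := ricci_linear_r (-1) x 0 0.
by rewrite scaler0 !addr0 => h ->; lra.
Qed.

Lemma Ric_linear : linear (Ric g).
Proof.
by move=> a x y; apply: (ip_inj ig) => z; rewrite gD gZ !RicE ricci_linear_l.
Qed.

Lemma Ric_inv_linear : quaternionic n -> linear (Ric_inv g).
Proof.
move=> qP a x y; rewrite /Ric_inv !sum3 !(lJD qP, lJZ qP) !Ric_linear !(lJD qP, lJZ qP).
by apply: linform_ext => phi [fD fZ fN _]; rewrite !(fD, fZ, fN); ring.
Qed.

End Curvature.
End RieszTrace.

(** * Isomorphisms that are isometric up to a factor *)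

Section Transport.
Variables (R : realType) (n n' : lie_data R).
Variables (g : n -> n -> R) (g' : n' -> n' -> R) (f : n' -> n) (a : R).
Hypotheses (ig : inner_product g) (ig' : inner_product g').
Hypotheses (lieP : lie_algebra n) (lieP' : lie_algebra n').
Hypotheses (qP : quaternionic n) (qP' : quaternionic n').
Hypotheses (lf : linear f) (bf : bijective f).
Hypotheses (fb : forall x y, f (lie_br x y) = lie_br (f x) (f y)).
Hypotheses (fJ : forall i x, f (lieJ i x) = lieJ i (f x)).
Hypotheses (a0 : a != 0) (hg : forall x y, g' x y = a * g (f x) (f y)).

Lemma transport_inj x y : (forall z, g x (f z) = g y (f z)) -> x = y.
Proof. by case: bf => h _ fh e; apply: (ip_inj ig) => z; rewrite -(fh z). Qed.

Lemma transport_lc x y : f (levi_civita g' x y) = levi_civita g (f x) (f y).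
Proof.
apply: transport_inj => z; apply: (mulfI a0).
by rewrite -hg !levi_civitaE // !hg !fb; ring.
Qed.

Lemma transport_curv x y z : f (curvature g' x y z) = curvature g (f x) (f y) (f z).
Proof.
have [_ fD _ fN] := linear_lin lf.
by rewrite /curvature !(fD, fN) !transport_lc fb.
Qed.

Lemma transport_trace (T' : n' -> n') (T : n -> n) c : linear T' ->
  (forall x, f (T' x) = c *: T (f x)) -> trace T' = c * trace T.
Proof.
move=> lT h; case: bf => k fk kf.
have [_ fD fZ _] := linear_lin lf.
have lk : linear k by move=> s x y; apply: (can_inj fk); rewrite lf !kf.
have [k0 kD kZ _] := linear_lin lk.
pose b := vbasis {:n}.
rewrite (@trace_frame _ _ 'I_(\dim {:n}) (fun i => k b`_i) (fun i x => coord b i (f x)) T' lT).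
- rewrite mulr_sumr; apply: eq_bigr => i _; by rewrite h kf linearZ.
- move=> i; have lc : linform (coord b i) by exact: (@linform_coord _ _ _ b i id).
  exact: (linform_comp lc lf).
- move=> x; rewrite -{1}(fk x) {1}(coord_vbasis (memvf (f x))).
  have ksum : forall (J : finType) (F : J -> n), k (\sum_j F j) = \sum_j k (F j).
    by move=> J F; elim/big_rec2: _ => // j u v _ <-; rewrite kD.
  by rewrite ksum; apply: eq_bigr => i _; rewrite kZ.
Qed.

Lemma transport_ricci x y : ricci_form g' x y = ricci_form g (f x) (f y).
Proof.
rewrite /ricci_form -[RHS]mul1r; apply: transport_trace; first exact: curv_linear1.
by move=> z; rewrite scale1r transport_curv.
Qed.

(** The connection, the curvature and the Ricci form are insensitive to the factor [a]; the Ricci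
    operator is the form divided by the metric. *)
Lemma transport_Ric x : f (Ric g' x) = a^-1 *: Ric g (f x).
Proof.
apply: transport_inj => z; apply: (mulfI a0); rewrite -hg RicE // transport_ricci.
by have [_ -> _ _] := ip_linform_l ig (f z); rewrite RicE // mulrA mulfV // mul1r.
Qed.

Lemma transport_scal : scal g' = a^-1 * scal g.
Proof. by apply: transport_trace; [exact: Ric_linear|exact: transport_Ric]. Qed.

Lemma transport_Ric_inv x : f (Ric_inv g' x) = a^-1 *: Ric_inv g (f x).
Proof.
have [_ fD fZ fN] := linear_lin lf.
rewrite /Ric_inv !sum3 !(fZ, fD, fN) !fJ !transport_Ric !fJ !(lJZ qP).
by apply: linform_ext => phi [hD hZ hN _]; rewrite !(hD, hZ, hN); ring.
Qed.

Lemma transport_Ric_inv2 :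
  trace (Ric_inv g' \o Ric_inv g') = (a^-1 * a^-1) * trace (Ric_inv g \o Ric_inv g).
Proof.
have l := Ric_inv_linear ig' lieP' qP'; have [_ lD lZ _] := linear_lin (Ric_inv_linear ig lieP qP).
apply: transport_trace => [s x y|x] /=; first by rewrite !l.
by rewrite !transport_Ric_inv lZ scalerA.
Qed.

End Transport.

(** * Compatible metrics *)

Section StandardMetric.
Variable R : realType.
Notation H := 'rV[R]_4.
Notation bracket := 'Hom(H, 'Hom(H, H)).
Implicit Types (x y z w : H).

Lemma dot_J i x y : dot (J i x) (J i y) = dot x y.
Proof.
rewrite !Jq dot_qmull (_ : dot (qu i) (qu i) = 1) ?mul1r //.
by elim/ord3P: i; rewrite quE dot_units.
Qed.

Lemma dot_J_skew i x y : dot (J i x) y = - dot x (J i y).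
Proof.
by elim/ord3P: i; rewrite !Jq ?quE ?dot_adj_i ?dot_adj_j ?dot_adj_k opprK.
Qed.

(** * Curvature of the standard metric *)

Section Std.
Variable mu : bracket.
Hypothesis hmu : Wh mu.
Implicit Types (p q : N_ mu).

Let hN := N_hypercomplex8 hmu.
Let lieN : lie_algebra (N_ mu). Proof. by have [[]] := hN. Qed.
Let quatN : quaternionic (N_ mu). Proof. by have [[]] := hN. Qed.
Let Wmu : W mu. Proof. by have [] := hmu. Qed.

Definition g0 p q : R := dot p.1 q.1 + dot p.2 q.2.

Lemma g0_ip : inner_product g0.
Proof.
split=> [a p q r|p q|[p1 p2] p0].
- by rewrite /g0 /= !(dotDl, dotZl); ring.
- by rewrite /g0 !(dotC q.1) !(dotC q.2).
- rewrite /g0 /=; have [p10|p10] := eqVneq p1 0.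
    rewrite p10 dot0l add0r; apply: dot_gt0; apply: contra_neq p0 => p20.
    by rewrite p10 p20.
  by rewrite ltr_pwDl ?dot_gt0 ?dot_ge0.
Qed.

Lemma g0_compatible : compatible g0.
Proof. by split; [exact: g0_ip|move=> i p q; rewrite /g0 /= !dot_J]. Qed.

(** Kaplan's operator j_z of a two-step nilpotent Lie algebra with an inner product. *)
Definition jmap z x : H := \row_k dot (mu x (delta_mx 0 k)) z.

Lemma dot_jmap z x y : dot (jmap z x) y = dot (mu x y) z.
Proof.
rewrite [in RHS](row_sum_delta y) !dotE sum4 !(brkDr, brkZr) !mxE.
rewrite !dotE ?mxE; ring.
Qed.

Lemma lcN p q : levi_civita g0 p q =
  (- (2%:R^-1 *: (jmap p.2 q.1 + jmap q.2 p.1)), 2%:R^-1 *: mu p.1 q.1) :> N_ mu.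
Proof.
apply: (ip_inj g0_ip) => r; rewrite (levi_civitaE g0_ip lieN) /g0 /= !dot0l !add0r.
by rewrite !(dotNl, dotZl, dotDl, dot_jmap) (W_antisym r.1 p.1 Wmu) dotNl; field.
Qed.

Lemma jmap0 x : jmap 0 x = 0.
Proof. by apply/rowP => k; rewrite !mxE dot0r. Qed.
Lemma jmapr0 z : jmap z 0 = 0.
Proof. by apply/rowP => k; rewrite !mxE linear0 zero_lfunE dot0l. Qed.
Lemma jmapZ a z x : jmap (a *: z) x = a *: jmap z x.
Proof. by apply/rowP => k; rewrite !mxE dotZr. Qed.
Definition dirac4 (i : 'I_4) : H := delta_mx 0 i.
Definition on_frame (i : 'I_4 + 'I_4) : N_ mu :=
  match i with inl i => (dirac4 i, 0) | inr i => (0, dirac4 i) end.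

Lemma dot_dirac x i : dot x (dirac4 i) = x 0 i.
Proof.
rewrite /dot (bigD1 i) //= mxE !eqxx mulr1 big1 ?addr0 // => j /negbTE h.
by rewrite mxE h andbF mulr0.
Qed.

Lemma trace_on_frame (T : N_ mu -> N_ mu) : linear T ->
  trace T = \sum_i g0 (T (on_frame i)) (on_frame i).
Proof.
move=> lT; rewrite (@trace_frame R (N_ mu) _ on_frame (fun i (x : N_ mu) => g0 x (on_frame i)) T lT) // => [i|p].
  exact: (ip_linform_l g0_ip).
rewrite big_sumType /=.
have h1 (x : H) : x = \sum_i dot x (dirac4 i) *: dirac4 i.
  by rewrite {1}[x]row_sum_delta; apply: eq_bigr => i _; rewrite dot_dirac.
have s1 (c : 'I_4 -> R) : \sum_i c i *: ((dirac4 i, 0) : N_ mu) = (\sum_i c i *: dirac4 i, 0).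
  by rewrite !sum4; congr pair; rewrite /= !scaler0 !addr0.
have s2 (c : 'I_4 -> R) : \sum_i c i *: ((0, dirac4 i) : N_ mu) = (0, \sum_i c i *: dirac4 i).
  by rewrite !sum4; congr pair; rewrite /= !scaler0 !addr0.
rewrite s1 s2; case: p => p1 p2; congr pair; rewrite /= ?addr0 ?add0r /g0 /=.
  by rewrite {1}[p1]h1; apply: eq_bigr => i _; rewrite dot0r addr0.
by rewrite {1}[p2]h1; apply: eq_bigr => i _; rewrite dot0r add0r.
Qed.

Definition sect p q : R := g0 (curvature g0 p q q) p.

Lemma sect11 x y : sect (x, 0) (y, 0) = - (3%:R / 4%:R) * dot (mu x y) (mu x y).
Proof.
rewrite /sect /curvature !lcN /= !(jmap0, jmapr0, Wmu, scaler0, addr0, add0r, oppr0).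
rewrite !(linear0, zero_lfunE, scaler0, jmap0, jmapr0, addr0, add0r, oppr0).
rewrite /g0 /= dot0r addr0 !(dotDl, dotNl, dotZl, jmapZ, dot_jmap, dot0l).
by rewrite (W_antisym y x Wmu) !(dotNl, dotZr); field.
Qed.

Let zeroE := (linear0, zero_lfunE, jmap0, jmapr0, dot0r, dot0l, scaler0, addr0, add0r, oppr0).

Lemma jmap_skew z x y : dot (jmap z x) y = - dot (jmap z y) x.
Proof. by rewrite !dot_jmap (W_antisym x y Wmu) dotNl. Qed.

Lemma sect12 x z : sect (x, 0) (0, z) = 4%:R^-1 * dot (jmap z x) (jmap z x).
Proof.
rewrite /sect /curvature !lcN /= ?zeroE /= ?zeroE /g0 /= ?zeroE.
by rewrite opprK dotZl jmap_skew dotNr dotZr; field.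
Qed.

Lemma sect21 x z : sect (0, z) (x, 0) = 4%:R^-1 * dot (jmap z x) (jmap z x).
Proof.
rewrite /sect /curvature !lcN /= !Wmu ?zeroE /= ?zeroE /g0 /= ?zeroE.
by rewrite dotNl dotZl -dot_jmap dotNr dotZr; field.
Qed.

Lemma sect22 z w : sect (0, z) (0, w) = 0.
Proof. by rewrite /sect /curvature !lcN /= ?zeroE /= ?zeroE /g0 /= ?zeroE. Qed.

Definition sq_norm : R := \sum_i \sum_j dot (mu (dirac4 i) (dirac4 j)) (mu (dirac4 i) (dirac4 j)).

Lemma sum_inlr (F : 'I_4 + 'I_4 -> R) :
  \sum_i F i = \sum_i F (inl i) + \sum_i F (inr i).
Proof. exact: big_sumType. Qed.

(** The sectional curvatures of the orthonormal basis add up as follows: pairs in n_1 give -3/4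
    |mu|^2, and the mixed pairs give 1/4 |mu|^2 in each of the two orders, because sum_k |j_(Z_k)
    x|^2 = sum_j |mu (x, X_j)|^2. *)
Lemma scalN : scal g0 = - (4%:R^-1 * sq_norm).
Proof.
rewrite /scal trace_on_frame; last exact: (Ric_linear g0_ip lieN).
have -> : \sum_i g0 (Ric g0 (on_frame i)) (on_frame i) =
    \sum_i \sum_j sect (on_frame j) (on_frame i).
  apply: eq_bigr => i _; rewrite (RicE g0_ip lieN).
  rewrite /ricci_form trace_on_frame //; exact: (curv_linear1 g0_ip lieN).
have jn x : \sum_k dot (jmap (dirac4 k) x) (jmap (dirac4 k) x) =
    \sum_j dot (mu x (dirac4 j)) (mu x (dirac4 j)).
  rewrite /dot exchange_big /=; apply: eq_bigr => j _; apply: eq_bigr => k _.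
  by rewrite !mxE -/(dirac4 j) dot_dirac.
have s1 : \sum_i \sum_j sect (on_frame j) (on_frame (inl i)) =
    - (3%:R / 4%:R) * sq_norm + 4%:R^-1 * sq_norm.
  under eq_bigr => i _.
    rewrite big_sumType /=; under eq_bigr do rewrite sect11.
    under [X in _ + X]eq_bigr do rewrite sect21.
    rewrite -!mulr_sumr jn; over.
  by rewrite big_split /= -!mulr_sumr exchange_big.
have s2 : \sum_i \sum_j sect (on_frame j) (on_frame (inr i)) = 4%:R^-1 * sq_norm.
  under eq_bigr => i _.
    rewrite big_sumType /=; under eq_bigr do rewrite sect12.
    under [X in _ + X]eq_bigr do rewrite sect22.
    rewrite -!mulr_sumr [X in _ + X]big1 // addr0; over.
  by rewrite -!mulr_sumr exchange_big /=; congr (_ * _); apply: eq_bigr => i _; rewrite jn.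
have arith (u v w : R) : u = - (3%:R / 4%:R) * w + 4%:R^-1 * w -> v = 4%:R^-1 * w ->
  u + v = - (4%:R^-1 * w) by move=> -> ->; field.
by apply: etrans (arith _ _ _ s1 s2); exact: sum_inlr.
Qed.

Lemma scalN_eq0 : scal g0 = 0 -> mu = 0.
Proof.
rewrite scalN => /eqP; rewrite oppr_eq0 mulf_eq0 invr_eq0 pnatr_eq0 /=.
have ge i : 0 <= \sum_j dot (mu (dirac4 i) (dirac4 j)) (mu (dirac4 i) (dirac4 j)).
  by apply: sumr_ge0 => j _; exact: dot_ge0.
rewrite psumr_eq0 // => /allP h; apply: bracket_ext => x y.
have e i j : mu (delta_mx 0 i) (delta_mx 0 j) = 0.
  have := h i (mem_index_enum _); rewrite /= psumr_eq0 => [/allP /(_ j (mem_index_enum _))|k _].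
    by rewrite /= dot_eq0 => /eqP.
  exact: dot_ge0.
rewrite !zero_lfunE [x]row_sum_delta [y]row_sum_delta !sum4 !(brkDl, brkZl, brkDr, brkZr).
by rewrite !(e, scaler0, addr0).
Qed.

Lemma Ric_inv_flat : mu = 0 -> trace (Ric_inv g0 \o Ric_inv g0) = 0.
Proof.
move=> mu0; have lc0 p q : levi_civita g0 p q = 0.
  rewrite lcN mu0 !zero_lfunE scaler0; congr pair.
  have j0 z x : jmap z x = 0 by apply/rowP => k; rewrite !mxE mu0 !zero_lfunE dot0l.
  by rewrite !j0 addr0 scaler0 oppr0.
have r0 p q : ricci_form g0 p q = 0.
  by rewrite /ricci_form /trace big1 // => i _; rewrite /curvature !lc0 !subr0 linear0.
have Ric0 p : Ric g0 p = 0.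
  apply: (ip_inj g0_ip) => q; rewrite (RicE g0_ip lieN) r0.
  by rewrite /g0 !dot0l addr0.
have Ri0 p : Ric_inv g0 p = 0.
  by rewrite /Ric_inv !Ric0 sub0r big1 ?oppr0 ?scaler0 // => i _; rewrite Ric0 (lJ0 quatN).
by rewrite /trace big1 // => i _; rewrite /= !Ri0 linear0.
Qed.

End Std.

(** * Compatible metrics up to automorphism *)

Section Classification.
Variable mu : bracket.
Hypothesis hmu : Wh mu.
Variable g : N_ mu -> N_ mu -> R.
Hypothesis cg : compatible g.
Let ig : inner_product g. Proof. by case: cg. Qed.
Let gJ i p q : g (lieJ i p) (lieJ i q) = g p q. Proof. by case: cg. Qed.

(** Each [J i] is an isometry with square -1, so u and [J i u] are orthogonal for q. Hence 1, i, j,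
    k are pairwise orthogonal, and they have the same length. *)
Lemma invariant_form (q : H -> H -> R) : (forall x, linform (q x)) ->
  (forall x y, q x y = q y x) -> (forall i x y, q (J i x) (J i y) = q x y) ->
  forall x y, q x y = q (qr 1) (qr 1) * dot x y.
Proof.
move=> lq qC qJ x y.
have qN u v : q u (- v) = - q u v by have [_ _ -> _] := lq u.
have JN i u : J i (J i u) = - u by elim/ord3P: i; rewrite !Jq quE ?(qii, qjj, qkk).
have sk i u : q u (J i u) = 0.
  have := qJ i u (J i u); rewrite JN qN qC => h; lra.
have J1 i : J i (qr 1) = qu i by rewrite Jq qmul1r.
have e1 i : q (qr 1) (qu i) = 0 by rewrite -J1 sk.
have ee i : q (qu i) (qu i) = q (qr 1) (qr 1) by rewrite -J1 qJ.
have eij i j : q (qu i) (qu j) = - q (qr 1) (J i (qu j)).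
  by rewrite -(qJ i (qr 1)) JN qN J1 opprK.
have q01 : q qi qj = 0 by have := eij 0 1; rewrite J0q !quE mul_ij (e1 2) oppr0.
have q12 : q qj qk = 0 by have := eij 1 2; rewrite J1q !quE mul_jk (e1 0) oppr0.
have q20 : q qk qi = 0 by have := eij 2 0; rewrite J2q !quE mul_ki (e1 1) oppr0.
have lql v : linform (fun u => q u v).
  have [fD fZ _ _] := lq v.
  by apply: linform_mk => [u w|a u]; rewrite !(qC _ v) ?fD ?fZ.
have expand (u : H) : u = u 0 0 *: qr 1 + u 0 1 *: qi + u 0 2 *: qj + u 0 3 *: qk.
  by rewrite {1}(qdecomp u); congr (_ + _ + _ + _); qring.
rewrite {1}(expand x) {1}(expand y); have [fD fZ _ _] := lql (y 0 0 *: qr 1 + y 0 1 *: qi + y 0 2 *: qj + y 0 3 *: qk).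
rewrite !fD !fZ.
have r u : q u (y 0 0 *: qr 1 + y 0 1 *: qi + y 0 2 *: qj + y 0 3 *: qk) =
   y 0 0 * q u (qr 1) + y 0 1 * q u qi + y 0 2 * q u qj + y 0 3 * q u qk.
  by have [hD hZ _ _] := lq u; rewrite !hD !hZ.
rewrite !r (qC qi (qr 1)) (qC qj (qr 1)) (qC qk (qr 1)) (qC qj qi) (qC qk qj) (qC qi qk).
have := (e1 0, e1 1, e1 2); rewrite !quE => -[[-> ->] ->].
have := (ee 0, ee 1, ee 2); rewrite !quE => -[[-> ->] ->].
by rewrite q01 q12 q20 dotE; ring.
Qed.

Lemma compatible_std : exists (a : R) (psi : N_ mu -> N_ mu), 0 < a /\ [/\ linear psi,
  bijective psi, forall p q : N_ mu, psi (lie_br p q) = lie_br (psi p) (psi q),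
  forall i p, psi (lieJ i p) = lieJ i (psi p)
  & forall p q, g p q = a * g0 (psi p) (psi q)].
Proof.
have gl (p : N_ mu) := ip_linform_r ig p.
have gC (p q : N_ mu) : g p q = g q p by case: ig.
have gpos (p : N_ mu) : p != 0 -> 0 < g p p.
  by case: ig => _ _; apply.
have q0 i : J i 0 = 0 :> H by rewrite Jq qmul0r.
have JN i (u : H) : J i (J i u) = - u by elim/ord3P: i; rewrite !Jq quE ?(qii, qjj, qkk).
have JJ i (p : N_ mu) : lieJ i (lieJ i p) = - p.
  by case: p => u v; congr pair; exact: JN.
have gS i (p q : N_ mu) : g (lieJ i p) q = - g p (lieJ i q).
  by rewrite -[in RHS](gJ i) JJ; have [_ _ -> _] := gl (lieJ i p); rewrite opprK.
pose c2 := g (0, qr 1) (0, qr 1).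
have pairV (u v : H) a : ((0, a *: u + v) : N_ mu) = a *: (0, u) + (0, v).
  by congr pair; rewrite /= scaler0 addr0.
have lV (p : N_ mu) : linform (fun z : H => g p (0, z)).
  have [fD fZ _ f0] := gl p; apply: linform_mk => [u v|a u].
    by rewrite -[u]scale1r pairV fD fZ mul1r scale1r.
  by rewrite -[_ *: _]addr0 pairV fD fZ f0 addr0.
have gV (z w : H) : g (0, z) (0, w) = c2 * dot z w.
  apply: (@invariant_form (fun z w => g (0, z) (0, w))) => [x|x y|i x y]; [exact: lV|exact: gC|].
  have e (u : H) : ((0, J i u) : N_ mu) = lieJ i ((0, u) : N_ mu) by rewrite /= q0.
  by rewrite !e gJ.
have one0 : qr 1 != 0 :> H.
  by apply/eqP => /rowP/(_ 0); rewrite qcoordE mxE => /eqP; rewrite oner_eq0.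
have c20 : 0 < c2.
  by apply: gpos; apply: contra_neq one0 => -[].
(* [L] measures the failure of n_1 to be orthogonal to n_2. It commutes with the [J i], so p ->
   (p.1, p.2 + L p.1) is an automorphism, n_2 being central and containing all brackets. *)
pose L (x : H) : H := c2^-1 *: \row_k g (x, 0) (0, delta_mx 0 k).
have LE (x z : H) : g (x, 0) (0, z) = c2 * dot (L x) z.
  rewrite dotZl mulrA divff ?gt_eqF // mul1r [in LHS](row_sum_delta z) sum4.
  have [fD fZ _ _] := lV (x, 0).
  by rewrite !(fD, fZ) dotE !mxE; ring.
have pairH (u v : H) a : ((a *: u + v, 0) : N_ mu) = a *: (u, 0) + (v, 0).
  by congr pair; rewrite /= scaler0 addr0.
have lL : linear L.
  move=> a u v; apply: dot_inj => z; apply: (mulfI (lt0r_neq0 c20)).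
  rewrite dotDl dotZl mulrDr mulrCA -!LE pairH gC.
  by have [-> -> _ _] := gl (0, z); rewrite !(gC (0, z)).
have JL i (x : H) : L (J i x) = J i (L x).
  apply: dot_inj => z; apply: (mulfI (lt0r_neq0 c20)); rewrite -LE dot_J_skew mulrN -LE.
  have e (u : H) : ((J i u, 0) : N_ mu) = lieJ i ((u, 0) : N_ mu) by rewrite /= q0.
  by rewrite e gS /= q0.
have [L0 LD LZ LN] := linear_lin lL.
pose q (x y : H) := g (x, 0) (y, 0) - c2 * dot (L x) (L y).
pose c1 := q (qr 1) (qr 1).
have lq (x : H) : linform (q x).
  have [fD fZ _ _] := gl (x, 0); apply: linform_mk => [u v|a u]; rewrite /q.
    rewrite -[u in LHS]scale1r pairH fD fZ LD LZ !(dotDr, dotZr); ring.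
  have e : ((a *: u, 0) : N_ mu) = a *: (u, 0) by congr pair; rewrite /= scaler0.
  by rewrite e fZ LZ dotZr; ring.
have qE (x y : H) : q x y = c1 * dot x y.
  apply: (invariant_form lq) => [u v|i u v]; rewrite /q; first by rewrite gC dotC.
  have e (w : H) : ((J i w, 0) : N_ mu) = lieJ i ((w, 0) : N_ mu) by rewrite /= q0.
  by rewrite !e gJ !JL dot_J.
have gDD (p p' r r' : N_ mu) : g (p + p') (r + r') = g p r + g p r' + (g p' r + g p' r').
  have [-> _ _ _] := gl (p + p'); rewrite !(gC (p + p')).
  have [-> _ _ _] := gl r; have [-> _ _ _] := gl r'; rewrite !(gC r) !(gC r'); ring.
have gE (p r : N_ mu) : g p r = c1 * dot p.1 r.1 + c2 * dot (p.2 + L p.1) (r.2 + L r.1).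
  have e (t : N_ mu) : t = (t.1, 0) + (0, t.2) by case: t => u v; congr pair; rewrite /= ?addr0 ?add0r.
  rewrite {1}(e p) {1}(e r) gDD (gC (0, p.2) (r.1, 0)) !LE gV -qE /q.
  by rewrite !(dotDl, dotDr) (dotC p.2 (L r.1)); ring.
have c10 : 0 < c1.
  have h : 0 < g (qr 1, - L (qr 1)) (qr 1, - L (qr 1)).
    by apply: gpos; apply: contra_neq one0 => -[].
  by move: h; rewrite gE /= addNr dot0l mulr0 addr0 dot_qr1 mulr1.
pose s := Num.sqrt (c2 / c1).
have s0 : 0 < s by rewrite sqrtr_gt0 divr_gt0.
have s2 : s * s = c2 / c1 by rewrite -expr2 sqr_sqrtr // divr_ge0 // ltW.
have sn0 := lt0r_neq0 s0.
(* The automorphism with factors s on n_1 and s^2 on n_2 balances the two summands: s^2 = c2 / c1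
   and a = c1^2 / c2 solve a s^2 = c1 and a s^4 = c2. *)
exists (c1 * c1 / c2), (fun p => (s *: p.1, (s * s) *: (p.2 + L p.1))).
split; first by rewrite divr_gt0 ?mulr_gt0.
split.
- move=> a [u v] [u' v']; congr pair; rewrite /=.
    by apply: linform_ext => f [fD fZ _ _]; rewrite !(fD, fZ); ring.
  by apply: linform_ext => f [fD fZ _ _]; rewrite LD LZ !(fD, fZ); ring.
- exists (fun p => (s^-1 *: p.1, (s * s)^-1 *: p.2 - L (s^-1 *: p.1))) => -[u v]; congr pair => /=.
  + by rewrite scalerA mulVf // scale1r.
  + by rewrite scalerA mulVf ?mulf_neq0 // scalerA mulVf // !scale1r addrK.
  + by rewrite scalerA mulfV // scale1r.
  + by rewrite subrK scalerA mulfV ?mulf_neq0 // scale1r.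
- move=> [u v] [u' v']; congr pair; first by rewrite /= scaler0.
  by rewrite /= L0 addr0 brkZl brkZr scalerA.
- move=> i [u v]; congr pair; first by rewrite /= !Jq qmulZr.
  by rewrite /= JL !Jq -qmulDr qmulZr.
- move=> p r; rewrite gE /g0 /= !(dotZl, dotZr) mulrDr.
  have c1n := lt0r_neq0 c10; have c2n := lt0r_neq0 c20.
  rewrite !(mulrA s s) !(mulrA (s * s) (s * s)) s2; move: (dot _ _) (dot _ _) => d d'.
  by field; rewrite c1n.
Qed.

End Classification.

(** After transport to [N_ mu], a competitor is the pullback of a times the standard metric, so its
    scalar curvature and its trace are those of the standard metric divided by a and by a^2. *)
Theorem existence_minimal (n : lie_data R) : hypercomplex8 n ->
  exists g : n -> n -> R, minimal g.
Proof.
move=> h8; have [[lien _ quatn _] _] := h8.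
have [mu hmu isoN] := hypercomplex8_model h8.
have [[lieN _ quatN _] _] := N_hypercomplex8 hmu.
have [f [lf bf fb fJ]] := isoN.
have [h [lh bh hb hJ]] := isomorphic_sym isoN.
have one1 : 1 != 0 :> R := oner_neq0 R.
have [[gl gC gp] gJ] := g0_compatible mu.
have i0 := g0_ip mu.
have h0 (x : n) : x != 0 -> h x != 0.
  by apply: contra_neq => hx; apply: (bij_inj bh); rewrite hx; have [->] := linear_lin lh.
pose g (x y : n) := g0 (h x) (h y).
have cg : compatible g.
  split; last by move=> i x y; rewrite /g !hJ gJ.
  by split=> [a x y z|x y|x x0]; rewrite /g ?lh ?gl // gp ?h0.
have ig : inner_product g by case: cg.
have gE (x y : n) : g x y = 1 * g0 (h x) (h y) by rewrite mul1r.
clearbody g.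
have sg := transport_scal i0 ig lieN lien lh bh hb one1 gE.
have tg := transport_Ric_inv2 i0 ig lieN lien quatN quatn lh bh hb hJ one1 gE.
exists g; split; [exact: cg|move=> g' cg' sg'].
have ig' : inner_product g' by case: cg'.
pose k (p q : N_ mu) : R := g' (f p) (f q).
have f0 (p : N_ mu) : p != 0 -> f p != 0.
  by apply: contra_neq => fx; apply: (bij_inj bf); rewrite fx; have [->] := linear_lin lf.
have [[gl' gC' gp'] gJ'] := cg'.
have ck : compatible k.
  split; last by move=> i x y; rewrite /k !fJ gJ'.
  by split=> [a x y z|x y|x x0]; rewrite /k ?lf ?gl' // gp' ?f0.
have ik : inner_product k by case: ck.
have kE (p q : N_ mu) : k p q = 1 * g' (f p) (f q) by rewrite mul1r.
clearbody k.
have sk := transport_scal ig' ik lien lieN lf bf fb one1 kE.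
have tk := transport_Ric_inv2 ig' ik lien lieN quatn quatN lf bf fb fJ one1 kE.
have [a [psi [a0 [lpsi bpsi psib psiJ psiE]]]] := compatible_std ck.
have an := lt0r_neq0 a0.
have sp := transport_scal i0 ik lieN lieN lpsi bpsi psib an psiE.
have tp := transport_Ric_inv2 i0 ik lieN lieN quatN quatN lpsi bpsi psib psiJ an psiE.
move: sg tg sk tk; rewrite !invr1 !mul1r => sg tg sk tk.
have aux (A B C D b : R) : A = D -> C = B -> C = b * D -> b * D = D -> A <= B.
  by move=> -> <- -> ->.
apply: (aux _ _ _ _ _ tg tk tp).
(* If the standard scalar curvature is 0, then mu = 0 and the traces vanish for every a; otherwise
   equal scalar curvatures force a = 1. *)
have [s0|sn0] := eqVneq (scal (g0 (mu := mu))) 0.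
  by rewrite (Ric_inv_flat hmu (scalN_eq0 hmu s0)) mulr0.
have a1 : a = 1; last by rewrite a1 invr1 !mul1r.
have aux2 (A B C D : R) : A = D -> C = B -> C = a^-1 * D -> B = A -> D != 0 -> a = 1.
  move=> -> -> -> /esym h1 D0; apply: invr_inj; apply: (mulIf D0).
  by rewrite -h1 invr1 mul1r.
exact: (aux2 _ _ _ _ sg sk sp sg' sn0).
Qed.

End StandardMetric.

Theorem proposition5p4 (R : realType) :
  (* (i) *)
  (forall n : lie_data R, hypercomplex8 n ->
     exists g : n -> n -> R, minimal g) /\
  (* (ii) *)
  (forall mu lambda : 'Hom('rV[R]_4, 'Hom('rV[R]_4, 'rV[R]_4)),
     Wh mu -> Wh lambda ->
     (isomorphic (N_ mu) (N_ lambda) <->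
      exists2 c : R, c != 0 &
        exists2 phi, Sp1Sp1 phi & mu = act phi (c *: lambda))) /\
  Sp1_iso_SU2 R /\
  has_dimv (@sp1 R `*` @sp1 R) 6 /\
  (* (iii) *)
  (parameterized_by (@moduli R) (@Wh R) /\
   equiv_su2_tensor_R4_plus_R4 (@Wh R) /\
   generic_isotropy_finite (@Wh R) /\
   has_proj_dim (@Wh R) 15 /\
   top_dim R (qopen (@Wh R)) (15 - 6)%N) /\
  (* (iv) *)
  (parameterized_by (@moduli_abelian R) (@Wah R) /\
   equiv_su2_tensor_R4 (@Wah R) /\
   generic_isotropy_finite (@Wah R) /\
   has_proj_dim (@Wah R) 11 /\
   top_dim R (qopen (@Wah R)) (11 - 6)%N).
Proof.
split; first exact: existence_minimal.
split; first by move=> mu la _ _; exact: isomorphic_orbit.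
split; first exact: Sp1_SU2.
split; first exact: sp1_dim.
have [hd hi] := Wh_top_dim R; have [ad ai] := Wah_top_dim R.
split; split.
- exact: moduli_parameterized.
- by split; [exact: Wh_rep|split=> //; split=> //; exact: Wh_dim].
- exact: moduli_abelian_parameterized.
- by split; [exact: Wah_rep|split=> //; split=> //; exact: Wah_dim].
Qed.
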